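(* Let $e=\min\{i\ge 2 : \ell \mid \frac{q^i-1}{q-1}\}$. (a) If $\lfloor n/e\rfloor\le \ell$, then $L$ is uniserial and its only composition series is $L=L(0)\supseteq L(1)\supseteq L(2)\supseteq\cdots$ (repeated terms deleted). (b) If $\lfloor n/e\rfloor>\ell$, then the first $\ell+1$ terms of the socle series of $L$, together with $0$, are $$0\subset L(P_0)\subset L(P_1)\subset\cdots\subset L(P_\ell).$$ This is in fact a composition series of $L(P_\ell)$. In particular, $L(P_\ell)$ is uniserial of length $\ell+1$, and the first $\ell+1$ factors, starting from the bottom, of the series $0\subset L(P_0)\subset\cdots\subset L(P_{V-1})=L$ are irreducible.
   Context: Let $n\ge 2$ and $G=\mathrm{GL}_n(q)$, the general linear group over the finite field $F_q$ of characteristic $p$. Let $\ell\ne p$ be a prime, and let $R$ be a local principal ideal domain of characteristic $0$ with maximal ideal $\ell R$, containing a primitive $p$-th root of unity; $K=R/\ell R$. Modules are left modules. $\nu_\ell$ denotes the $\ell$-adic valuation of integers. $B$ is the group of upper triangular matrices in $G$; $S_n$ is viewed as the subgroup of permutation matrices of $G$; $\widehat{S}=\sum_{s\in S}s\in RG$ for $S\subseteq G$. Put $\varepsilon=\sum_{\sigma\in S_n}\mathrm{sg}(\sigma)\,\sigma\widehat{B}\in RG$. The Steinberg lattice is the left ideal $I=RG\cdot\varepsilon$, and $L=I/\ell I$, a $KG$-module. Let $f:I\times I\to R$ be the restriction to $I$ of the $R$-bilinear form on $RG$ given by $(g,h)\mapsto\delta_{g,h}$ for $g,h\in G$, scaled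 by $1/|B|$ (it takes values in $R$). For $c\ge 0$ put $I(c)=\{x\in I : f(x,I)\subseteq \ell^cR\}$ and $L(c)=(I(c)+\ell I)/\ell I$. Let $\mathcal P$ be the set of standard parabolic subgroups, i.e. subgroups of $G$ containing $B$. A $\mathcal P$-value is an integer of the form $\nu_\ell([G:P])$ with $P\in\mathcal P$; $V$ is the number of distinct $\mathcal P$-values. For $P\in\mathcal P$, $L(P)=L(c)$ where $c=\nu_\ell([G:P])$. Choose $P_0,\dots,P_{V-1}\in\mathcal P$ with $\nu_\ell([G:P_0])>\cdots>\nu_\ell([G:P_{V-1}])$. By results of Gow, deleting repeated terms from $L=L(0)\supseteq L(1)\supseteq\cdots$ yields the series of strict inclusions $0\subset L(P_0)\subset\cdots\subset L(P_{V-1})=L$. The first term of the socle series of a module is its socle. *)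

(* Defs.v *)
From HB Require Import structures.
From mathcomp Require Import all_boot all_order all_fingroup all_algebra.
From mathcomp Require Import boolp.

Set Implicit Arguments.
Unset Strict Implicit.
Unset Printing Implicit Defensive.

Import GRing.Theory.
Local Open Scope ring_scope.
Local Open Scope quotient_scope.

(* Submodules are decided classically: an arbitrary propositional predicate    *)
(* closed under the module operations gives one through [psubmod].             *)
Record submod (A : pzRingType) (M : lmodType A) := Submod {
  submod_pred :> M -> bool;
  submodP : submod_closed submod_pred }.

HB.instance Definition _ (A : pzRingType) (M : lmodType A) :=
  gen_eqMixin (submod M).

HB.instance Definition _ (A : pzRingType) (M : lmodType A) (N : submod M) :=
  GRing.isSubmodClosed.Build A M (submod_pred N) (GRing.submod_closed_semi (submodP N)).

Section Submodules.
Variables (A : pzRingType) (M : lmodType A).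
Implicit Types (N S T : submod M) (P : M -> Prop).

Lemma submod_eqP S T : (S : M -> bool) =1 T -> S = T.
Proof.
case: S T => [s hs] [t ht] /= /funext st; move: hs; rewrite st => hs.
by congr Submod; apply: Prop_irrelevance.
Qed.

Definition psubmod_closed P :=
  P 0 /\ forall a u v, P u -> P v -> P (a *: u + v).

Lemma psubmod_subproof P :
  psubmod_closed P -> submod_closed (fun x : M => `[< P x >]).
Proof.
case=> P0 Plin; split; first exact/asboolP.
by move=> a u v /asboolP Pu /asboolP Pv; apply/asboolP/Plin.
Qed.

Definition psubmod P (h : psubmod_closed P) : submod M :=
  Submod (psubmod_subproof h).

Lemma submod_lin N a u v : N u -> N v -> N (a *: u + v).
Proof. by move=> Nu Nv; apply: (submodP N).2. Qed.

Lemma zero_submod_subproof : psubmod_closed (fun x : M => x = 0).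
Proof. by split=> // a u v -> ->; rewrite scaler0 addr0. Qed.
Definition zero_submod := psubmod zero_submod_subproof.

Lemma full_submod_subproof : psubmod_closed (fun _ : M => True).
Proof. by []. Qed.
Definition full_submod := psubmod full_submod_subproof.

Lemma add_submod_subproof S T :
  psubmod_closed (fun x => exists u v, [/\ S u, T v & x = u + v]).
Proof.
split=> [|a _ _ [u [v [Su Tv ->]]] [u' [v' [Su' Tv' ->]]]].
  by exists 0, 0; rewrite addr0; split=> //; exact: (submodP _).1.
exists (a *: u + u'), (a *: v + v'); split; try exact: submod_lin.
by rewrite scalerDr addrACA.
Qed.
Definition add_submod S T := psubmod (add_submod_subproof S T).

Definition submod_le S T := forall x, S x -> T x.

(* Inside M: the submodules of S are the submodules of M contained in S.        *)
Definition simple_submod S :=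
  S <> zero_submod /\
  forall T, submod_le T S -> T = zero_submod \/ T = S.

Lemma socle_subproof :
  psubmod_closed (fun x => exists s : seq M,
    (forall y, y \in s -> exists2 S, simple_submod S & S y) /\
    x = \sum_(y <- s) y).
Proof.
split; first by exists [::]; split=> //; rewrite big_nil.
move=> a _ _ [s [hs ->]] [t [ht ->]].
exists ([seq a *: y | y <- s] ++ t); split=> [y|]; last first.
  by rewrite big_cat big_map /= scaler_sumr.
rewrite mem_cat => /orP[/mapP[z zs ->]|/ht//].
have [S simS Sz] := hs _ zs; exists S => //.
by rewrite -[_ *: _]addr0; apply: submod_lin => //; exact: (submodP S).1.
Qed.
Definition socle := psubmod socle_subproof.

Definition submodType N := {x : M | N x}.
HB.instance Definition _ N := SubChoice.on (submodType N).
HB.instance Definition _ N := [SubChoice_isSubLmodule of submodType N by <:].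

Definition submod_zmod N : zmodClosed M := (N : {pred M}).
Definition quotm N := Quotient.quot (submod_zmod N).
HB.instance Definition _ N :=
  GRing.Zmodule.copy (quotm N) (Quotient.quot (submod_zmod N)).

Definition quotm_pi N (x : M) : quotm N := \pi_(Quotient.quot (submod_zmod N)) x.

Definition quotm_repr N (x : quotm N) : M :=
  generic_quotient.repr (x : Quotient.quot (submod_zmod N)).

Definition quotm_scale N (a : A) (x : quotm N) : quotm N :=
  quotm_pi N (a *: quotm_repr x).

Lemma quotm_reprK N (x : quotm N) : quotm_pi N (quotm_repr x) = x.
Proof. exact: reprK. Qed.

Lemma quotm_eqP N x y : quotm_pi N x = quotm_pi N y <-> N (x - y).
Proof.
have e : (x == y %[mod (Quotient.quot (submod_zmod N))]) = N (x - y) by rewrite -Quotient.idealrBE.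
by rewrite -e; split=> [xy|/eqP//]; apply/eqP.
Qed.

Lemma quotm_scaleE N a x : quotm_scale a (quotm_pi N x) = quotm_pi N (a *: x).
Proof.
apply/quotm_eqP; rewrite -scalerBr -[_ *: _]addr0.
by apply: submod_lin (submodP N).1; apply/quotm_eqP/quotm_reprK.
Qed.

Lemma quotm_piD N x y : quotm_pi N (x + y) = quotm_pi N x + quotm_pi N y.
Proof. exact: (raddfD (\pi_(Quotient.quot (submod_zmod N)))). Qed.

Lemma quotm_scaleA N a b (x : quotm N) :
  quotm_scale a (quotm_scale b x) = quotm_scale (a * b) x.
Proof. by rewrite -[x]quotm_reprK !quotm_scaleE scalerA. Qed.
Lemma quotm_scale1 N : left_id 1 (@quotm_scale N).
Proof. by move=> x; rewrite -[x]quotm_reprK !quotm_scaleE scale1r. Qed.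
Lemma quotm_scaleDr N : right_distributive (@quotm_scale N) +%R.
Proof.
move=> a x y; rewrite -[x]quotm_reprK -[y]quotm_reprK -quotm_piD.
by rewrite !quotm_scaleE scalerDr quotm_piD.
Qed.
Lemma quotm_scaleDl N (x : quotm N) :
  {morph (fun a => quotm_scale a x) : a b / a + b}.
Proof.
move=> a b; rewrite -[x]quotm_reprK.
by rewrite !quotm_scaleE scalerDl quotm_piD.
Qed.
HB.instance Definition _ N := GRing.Zmodule_isLmodule.Build A (quotm N)
  (@quotm_scaleA N) (@quotm_scale1 N) (@quotm_scaleDr N) (@quotm_scaleDl N).

Lemma quotm_pi_lin N a x y :
  quotm_pi N (a *: x + y) = a *: quotm_pi N x + quotm_pi N y.
Proof. by rewrite quotm_piD -quotm_scaleE. Qed.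
End Submodules.

Section Series.
Variables (A : pzRingType) (M : lmodType A).
Implicit Types (N S T : submod M).

(* The submodule (T + S)/S of M/S, which is T/S when S is contained in T.      *)
Lemma factor_subproof S T :
  psubmod_closed (fun y : quotm S => exists2 x, T x & y = quotm_pi S x).
Proof.
split=> [|a _ _ [u Tu ->] [v Tv ->]].
  by exists 0; [exact: (submodP T).1 | rewrite /quotm_pi raddf0].
by exists (a *: u + v); [exact: submod_lin | rewrite quotm_pi_lin].
Qed.
Definition factor S T : submod (quotm S) := psubmod (factor_subproof S T).

Definition irreducible_factor S T :=
  submod_le S T /\ simple_submod (factor S T).

(* Composition series are listed from 0 upwards.                               *)
Definition composition_series N (s : seq (submod M)) :=
  [/\ (0 < size s)%N, head (zero_submod M) s = zero_submod M,
      last (zero_submod M) s = N &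
      forall i, (i.+1 < size s)%N ->
        irreducible_factor (nth (zero_submod M) s i) (nth (zero_submod M) s i.+1)].

Definition has_length N (k : nat) :=
  exists2 s, composition_series N s & size s = k.+1.

Definition uniserial N :=
  forall S T, submod_le S N -> submod_le T N -> submod_le S T \/ submod_le T S.

Lemma preim_quot_subproof N (S : submod (quotm N)) :
  psubmod_closed (fun x : M => S (quotm_pi N x)).
Proof.
split=> [|a u v Su Sv]; first by rewrite /quotm_pi raddf0; exact: (submodP S).1.
by rewrite quotm_pi_lin; exact: submod_lin.
Qed.
Definition preim_quot N (S : submod (quotm N)) : submod M := psubmod (@preim_quot_subproof N S).

(* Indexed so that term 0 is 0 and term 1 is the socle.                        *)
Fixpoint socle_series (i : nat) : submod M :=
  if i is j.+1 then preim_quot (socle (quotm (socle_series j)))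
  else zero_submod M.
End Series.

(* [undup] removes all duplicates, so this deletes exactly the repetitions of X *)
(* when equal terms of X are adjacent, e.g. for a monotone X.                   *)
Definition repeats_deleted (T : eqType) (X : nat -> T) (s : seq T) :=
  exists N, (forall c, (N <= c)%N -> X c = X N) /\ s = undup (mkseq X N.+1).

Section Ideals.
Variable R : comPzRingType.

Lemma pideal_subproof (a : R) :
  psubmod_closed (fun x : R^o => exists r : R, x = a * r).
Proof.
split=> [|b _ _ [r ->] [t ->]]; first by exists 0; rewrite mulr0.
by exists (b * r + t); rewrite mulrDr mulrCA.
Qed.
Definition pideal (a : R) : submod R^o := psubmod (pideal_subproof a).

Definition is_pid := forall J : submod R^o, exists a : R, J = pideal a.

Definition maximal_ideal (J : submod R^o) :=
  J <> full_submod R^o /\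
  forall J' : submod R^o, submod_le J J' -> J' = J \/ J' = full_submod R^o.

Definition local_with_maximal_ideal (m : submod R^o) :=
  forall J : submod R^o, maximal_ideal J <-> J = m.

Definition quot_ring (a : R) := quotm (pideal a).
HB.instance Definition _ a := GRing.Zmodule.on (quot_ring a).

Variable a : R.
Definition quot_ring_pi (x : R) : quot_ring a := quotm_pi (pideal a) (x : R^o).
Definition quot_ring_repr (x : quot_ring a) : R := quotm_repr x.
Definition quot_ring_mul (x y : quot_ring a) : quot_ring a :=
  quot_ring_pi (quot_ring_repr x * quot_ring_repr y).

Lemma quot_ring_reprK x : quot_ring_pi (quot_ring_repr x) = x.
Proof. exact: quotm_reprK. Qed.

Lemma quot_ring_piP x y :
  quot_ring_pi x = quot_ring_pi y <-> exists r, x - y = a * r.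
Proof.
by rewrite /quot_ring_pi quotm_eqP; split=> [/asboolP|h]; last apply/asboolP.
Qed.

Lemma quot_ring_piD x y :
  quot_ring_pi (x + y) = quot_ring_pi x + quot_ring_pi y.
Proof. exact: quotm_piD. Qed.

Lemma quot_ring_piM x y :
  quot_ring_mul (quot_ring_pi x) (quot_ring_pi y) = quot_ring_pi (x * y).
Proof.
have /quot_ring_piP[r er] := quot_ring_reprK (quot_ring_pi x).
have /quot_ring_piP[t et] := quot_ring_reprK (quot_ring_pi y).
apply/quot_ring_piP; move: er et.
move: (quot_ring_repr _) (quot_ring_repr _) => x' y' /(canRL (subrK _)) ->.
move=> /(canRL (subrK _)) ->.
exists (r * (a * t + y) + x * t).
rewrite mulrDl [x * (_ + _)]mulrDr addrA addrK [RHS]mulrDr -mulrA.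
by rewrite [a * (x * t)]mulrCA.
Qed.

Lemma quot_ring_mulA : associative quot_ring_mul.
Proof.
move=> x y z; rewrite -[x]quot_ring_reprK -[y]quot_ring_reprK.
by rewrite -[z]quot_ring_reprK !quot_ring_piM mulrA.
Qed.
Lemma quot_ring_mulC : commutative quot_ring_mul.
Proof. by move=> x y; rewrite /quot_ring_mul mulrC. Qed.
Lemma quot_ring_mul1 : left_id (quot_ring_pi 1) quot_ring_mul.
Proof. by move=> x; rewrite -[x]quot_ring_reprK quot_ring_piM mul1r. Qed.
Lemma quot_ring_mulD : left_distributive quot_ring_mul +%R.
Proof.
move=> x y z; rewrite -[x]quot_ring_reprK -[y]quot_ring_reprK.
by rewrite -[z]quot_ring_reprK -quot_ring_piD !quot_ring_piM mulrDl quot_ring_piD.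
Qed.
HB.instance Definition _ := GRing.Zmodule_isComPzRing.Build (quot_ring a)
  quot_ring_mulA quot_ring_mulC quot_ring_mul1 quot_ring_mulD.
End Ideals.

(* The group algebra RG: functions G -> R with convolution product.            *)
Definition galg (R : pzRingType) (gT : finGroupType) := {ffun gT -> R}.

Section GroupAlgebra.
Variables (R : pzRingType) (gT : finGroupType).
Local Notation RG := (galg R gT).
Implicit Types a b c : RG.

HB.instance Definition _ := GRing.Zmodule.on RG.
Definition gelt (g : gT) : RG := [ffun h => (h == g)%:R].
Definition gmul a b : RG := [ffun g => \sum_(h : gT) a h * b (h^-1 * g)%g].

Lemma gmulA : associative gmul.
Proof.
move=> a b c; apply/ffunP=> g; rewrite !ffunE.
under eq_bigr => h _ do rewrite ffunE mulr_sumr.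
under [RHS]eq_bigr => k _ do rewrite ffunE mulr_suml.
rewrite [RHS]exchange_big /=; apply: eq_bigr => h _.
rewrite [RHS](reindex_inj (mulgI h)) /=; apply: eq_bigr => k _.
by rewrite mulKg invMg !mulgA mulrA.
Qed.

Lemma gmul1l : left_id (gelt 1%g) gmul.
Proof.
move=> a; apply/ffunP=> g; rewrite !ffunE (bigD1 1%g) //= ffunE eqxx mul1r.
rewrite invg1 mul1g big1 ?addr0 // => h /negPf h1.
by rewrite ffunE h1 mul0r.
Qed.

Lemma gmul1r : right_id (gelt 1%g) gmul.
Proof.
move=> a; apply/ffunP=> g; rewrite !ffunE (bigD1 g) //= ffunE mulVg eqxx mulr1.
rewrite big1 ?addr0 // => h hg; rewrite ffunE eq_sym -(inj_eq (mulgI h)).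
by rewrite mulKVg mulg1 (negPf hg) mulr0.
Qed.

Lemma gmulDl : left_distributive gmul +%R.
Proof.
move=> a b c; apply/ffunP=> g; rewrite !ffunE -big_split /=.
by apply: eq_bigr => h _; rewrite ffunE mulrDl.
Qed.

Lemma gmulDr : right_distributive gmul +%R.
Proof.
move=> a b c; apply/ffunP=> g; rewrite !ffunE -big_split /=.
by apply: eq_bigr => h _; rewrite ffunE mulrDr.
Qed.

HB.instance Definition _ := GRing.Zmodule_isPzRing.Build RG
  gmulA gmul1l gmul1r gmulDl gmulDr.

Definition gsum (S : {set gT}) : RG := \sum_(s in S) gelt s.
End GroupAlgebra.

Section Steinberg.
Variables (n : nat) (F : finFieldType) (R : idomainType) (ell : nat).
Local Notation G := {'GL_n[F]}.
Local Notation RG := (galg R G).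

Definition borel : {set G} :=
  [set g : G | [forall i : 'I_n.-1.+1, forall j : 'I_n.-1.+1,
                 (j < i)%N ==> (GLval g i j == 0)]].

Definition perm_elt (s : 'S_n.-1.+1) : G :=
  FinRing.Unit (unitmx_perm F s).

Definition steinberg_elt : RG :=
  \sum_(s : 'S_n.-1.+1) (-1) ^+ s * (gelt R (perm_elt s) * gsum R borel).

Lemma steinberg_subproof :
  psubmod_closed (fun x : RG^o => exists a : RG, x = a * steinberg_elt).
Proof.
split=> [|b _ _ [r ->] [t ->]]; first by exists 0; rewrite mul0r.
by exists (b * r + t); rewrite mulrDl -mulrA.
Qed.

Definition steinberg_ideal : submod RG^o := psubmod steinberg_subproof.
Definition steinberg_lattice := submodType steinberg_ideal.
HB.instance Definition _ := GRing.Lmodule.on steinberg_lattice.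
Local Notation I := steinberg_lattice.

(* An element of I as a function on G; [val] lands in the regular module.      *)
Definition lattice_fun (x : I) : RG := val x.

(* Since |B| may be a non-unit of R, the form is valued in the fraction field  *)
(* of R.                                                                       *)
Definition steinberg_form (x y : I) : {fraction R} :=
  tofrac (\sum_(g : G) lattice_fun x g * lattice_fun y g) / #|borel|%:R.

Definition gstar (a : RG) : RG := [ffun g => a g^-1%g].

Lemma form_scale (a : RG) (x y : I) :
  steinberg_form (a *: x) y = steinberg_form x (gstar a *: y).
Proof.
congr (tofrac _ / _).
transitivity (\sum_(g : G) \sum_(h : G) a h * lattice_fun x (h^-1 * g)%g * lattice_fun y g).
  by apply: eq_bigr => g _; rewrite [lattice_fun (a *: x) g]ffunE mulr_suml.
rewrite exchange_big /=.
transitivity (\sum_(h : G) \sum_(g : G) a h * lattice_fun x g * lattice_fun y (h * g)%g).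
  apply: eq_bigr => h _; rewrite (reindex_inj (mulgI h)) /=.
  by apply: eq_bigr => g _; rewrite mulKg.
rewrite exchange_big /=; apply: eq_bigr => g _.
rewrite [lattice_fun (_ *: y) g]ffunE mulr_sumr (reindex_inj invg_inj) /=.
by apply: eq_bigr => h _; rewrite ffunE mulrCA mulrA.
Qed.

Lemma form_addl (x x' y : I) :
  steinberg_form (x + x') y = steinberg_form x y + steinberg_form x' y.
Proof.
rewrite /steinberg_form -mulrDl -tofracD -big_split /=.
congr (tofrac _ / _); apply: eq_bigr => g _.
by rewrite [lattice_fun (x + x') g]ffunE mulrDl.
Qed.

Lemma lattice_filt_subproof (c : nat) :
  psubmod_closed (fun x : I => forall y : I,
    exists r : R, steinberg_form x y = tofrac (ell%:R ^+ c * r)).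
Proof.
split=> [y|a u v hu hv y].
  exists 0; rewrite mulr0 /steinberg_form big1 ?tofrac0 ?mul0r // => g _.
  by rewrite [lattice_fun 0 g]ffunE mul0r.
have [[r er] [t et]] := (hu (gstar a *: y), hv y).
by exists (r + t); rewrite form_addl form_scale er et -tofracD mulrDr.
Qed.
Definition lattice_filt (c : nat) : submod I := psubmod (lattice_filt_subproof c).

Lemma ell_lattice_subproof :
  psubmod_closed (fun x : I => exists y : I, x = y *+ ell).
Proof.
split=> [|b _ _ [r ->] [t ->]]; first by exists 0; rewrite mul0rn.
by exists (b *: r + t); rewrite mulrnDl scalerMnr.
Qed.
Definition ell_lattice : submod I := psubmod ell_lattice_subproof.

Definition residue := quot_ring (ell%:R : R).
HB.instance Definition _ := GRing.ComPzRing.on residue.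
Local Notation KG := (galg residue G).

(* L = I / ell I; a in KG acts as any lift of a to RG.                         *)
Definition steinberg_mod := quotm ell_lattice.
HB.instance Definition _ := GRing.Zmodule.on steinberg_mod.

Definition mod_pi (x : I) : steinberg_mod := quotm_pi ell_lattice x.
Definition mod_repr (x : steinberg_mod) : I := quotm_repr x.
Definition reduce (a : RG) : KG := [ffun g => quot_ring_pi (ell%:R : R) (a g)].
Definition lift_galg (k : KG) : RG := [ffun g => quot_ring_repr (k g : quot_ring _)].
Definition mod_scale (k : KG) (x : steinberg_mod) : steinberg_mod :=
  mod_pi (lift_galg k *: mod_repr x).

Lemma mod_reprK x : mod_pi (mod_repr x) = x. Proof. exact: quotm_reprK. Qed.
Lemma mod_piD x y : mod_pi (x + y) = mod_pi x + mod_pi y.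
Proof. exact: quotm_piD. Qed.

Lemma lift_galgK k : reduce (lift_galg k) = k.
Proof. by apply/ffunP => g; rewrite !ffunE quot_ring_reprK. Qed.

Lemma reduce_eqP (a b : RG) :
  reduce a = reduce b -> exists c : RG, a - b = c *+ ell.
Proof.
move=> /ffunP eab.
have h g : exists r, a g - b g = ell%:R * r.
  by apply/quot_ring_piP; have := eab g; rewrite !ffunE.
exists [ffun g => projT1 (cid (h g))]; apply/ffunP => g.
rewrite [LHS]ffunE [X in _ + X]ffunE ffunMnE ffunE.
by case: cid => r /= ->; rewrite mulr_natl.
Qed.

Lemma mod_scaleE (a : RG) (x : I) :
  mod_scale (reduce a) (mod_pi x) = mod_pi (a *: x).
Proof.
have [c ec] := reduce_eqP (lift_galgK (reduce a)).
have /quotm_eqP/asboolP[y ey] := mod_reprK (mod_pi x).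
apply/quotm_eqP/asboolP.
rewrite -(subrK a (lift_galg _)) ec -(subrK x (mod_repr _)) ey.
exists (c *: (y *+ ell + x) + a *: y).
rewrite mulrnDl !(scalerMnl c) (scalerMnr a) scalerDl -addrA; congr (_ + _).
by rewrite scalerDr addrK.
Qed.

Lemma reduceD a b : reduce (a + b) = reduce a + reduce b.
Proof. by apply/ffunP=> g; rewrite !ffunE quot_ring_piD. Qed.
Lemma reduceM a b : reduce (a * b) = reduce a * reduce b.
Proof.
apply/ffunP=> g; rewrite !ffunE.
under [RHS]eq_bigr => h _ do rewrite !ffunE [_ * _]quot_ring_piM.
by rewrite (big_morph _ (@quot_ring_piD R _) (erefl (quot_ring_pi _ 0)))
   /quot_ring_pi /quotm_pi raddf0.
Qed.
Lemma reduce1 : reduce 1 = 1.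
Proof.
apply/ffunP=> g; rewrite !ffunE; case: eqP => _ //.
by rewrite /quot_ring_pi /quotm_pi raddf0.
Qed.

Lemma mod_scaleA a b x : mod_scale a (mod_scale b x) = mod_scale (a * b) x.
Proof.
rewrite -[x]mod_reprK -[a]lift_galgK -[b]lift_galgK -reduceM.
by rewrite !mod_scaleE scalerA.
Qed.
Lemma mod_scale1 : left_id 1 mod_scale.
Proof. by move=> x; rewrite -reduce1 -[x]mod_reprK mod_scaleE scale1r. Qed.
Lemma mod_scaleDr : right_distributive mod_scale +%R.
Proof.
move=> a x y; rewrite -[x]mod_reprK -[y]mod_reprK -[a]lift_galgK -mod_piD.
by rewrite !mod_scaleE scalerDr mod_piD.
Qed.
Lemma mod_scaleDl x : {morph mod_scale^~ x : a b / a + b}.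
Proof.
move=> a b; rewrite -[x]mod_reprK -[a]lift_galgK -[b]lift_galgK -reduceD.
by rewrite !mod_scaleE scalerDl mod_piD.
Qed.
HB.instance Definition _ := GRing.Zmodule_isLmodule.Build KG steinberg_mod
  mod_scaleA mod_scale1 mod_scaleDr mod_scaleDl.

Lemma mod_filt_subproof (c : nat) :
  psubmod_closed (fun x : steinberg_mod =>
    exists2 u, add_submod (lattice_filt c) ell_lattice u & x = mod_pi u).
Proof.
split=> [|k _ _ [u Su ->] [v Sv ->]].
  by exists 0; [exact: (submodP (add_submod _ _)).1
               | rewrite /mod_pi /quotm_pi raddf0].
exists (lift_galg k *: u + v); first exact: submod_lin.
by rewrite mod_piD -mod_scaleE lift_galgK.
Qed.
Definition mod_filt (c : nat) : submod steinberg_mod :=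
  psubmod (mod_filt_subproof c).

(* The subgroups containing B are the standard parabolic subgroups.            *)
Definition parabolics : {set {group G}} := [set P : {group G} | borel \subset P].
Definition parabolic_value (P : {group G}) : nat := logn ell #|'GL_n[F] : P|%g.
Definition num_parabolic_values : nat :=
  size (undup [seq parabolic_value P | P in parabolics]).
Definition mod_filt_parabolic (P : {group G}) := mod_filt (parabolic_value P).

End Steinberg.

(* Main.v *)
Require Import Defs.
From mathcomp Require Import all_boot all_order all_fingroup all_algebra.
From mathcomp Require Import all_field boolp ring zify.

(** Fix a nontrivial character psi of the additive group of F with values in R,
    which exists because R contains a primitive p-th root of unity, and let U be
    the group of upper unitriangular matrices.  A set J of positions between 1
    and n - 1, where k in J means that k - 1 and k lie in the same block, encodes
    a standard parabolic subgroup P_J, a composition of n, and the linear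
    character of U sending u to psi of the sum of the entries u_(k-1,k), k in J.
    Projecting the generator of the Steinberg lattice I to that character gives
    an eigenvector gvec J.  Everything is read off from these vectors.

    - A submodule of L is determined by the J whose eigenvector it contains
      (separating_gvec).  If S is not contained in T, a vector of S outside T is
      made an eigenvector of one column of U after the other: a column is an
      elementary abelian group of order prime to ell, and matrices acting on the
      earlier coordinates move each of its nontrivial characters to one that
      only sees the superdiagonal entry.  As I is spanned by the U-translates of
      its generator (steinberg_span), an eigenvector of type J in S and outside T
      is gvec J up to scalars prime to ell.

    - The form takes the value [G : P_J] at gvec J and the generator
      (gform_gvec, parabolic_index), so gvec J lies in L(c) exactly when c is at
      most the valuation v(J) of [G : P_J] (gvec_filt).

    - If J' is contained in J, then gvec J generates gvec J', with a coefficient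
      that is a power of q up to sign (gvec_generates).  By the symmetry of the
      form gvec J' also generates gvec J when v(J) = v(J') (gvec_reciprocity).

    - The valuation of the q-integer [m] vanishes unless e divides m, and is
      that of [e] when m = e j with 0 < j < ell.  Hence parts of a composition
      that are smaller than e ell can be broken into parts e and 1, and parts e
      and 1 can be exchanged, at no cost in v.  It follows that gvec J generates
      gvec J' as soon as v(J) <= v(J'), provided that n / e <= ell or that v(J')
      is among the ell + 1 largest values (gens_of_qdefect, gen_of_pval).

    If n / e <= ell, a submodule is thus determined by the least v(J) occurring
    in it, so that the L(c) are all the submodules.  Otherwise the ell + 1 largest
    values of v are those of the compositions with s parts e and all other parts
    1, for s = 0, ..., ell (qdefect_low), and every submodule strictly containing
    one of the corresponding L(c) contains the next one (layer_least).  Such a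
    least overmodule is at once the unique minimal one and the next term of the
    socle series (socle_quot). *)

Set Implicit Arguments.
Unset Strict Implicit.
Unset Printing Implicit Defensive.

Import Defs.

(** * The q-integers and the block structure of a set of positions *)

(** The q-integer [m], that is (q^m - 1) / (q - 1). *)
Definition qint (q m : nat) := \sum_(i < m) q ^ i.

Lemma qintD q m k : qint q (m + k) = qint q m + q ^ m * qint q k.
Proof.
rewrite /qint big_split_ord /=; congr addn.
by rewrite big_distrr; apply: eq_bigr => i _; rewrite expnD.
Qed.

Lemma qintS q m : qint q m.+1 = qint q m + q ^ m.
Proof. exact: big_ord_recr. Qed.

Lemma qintM q m k : qint q (m * k) = qint q m * qint (q ^ m) k.
Proof.
elim: k => [|k IHk]; first by rewrite muln0 /qint !big_ord0 muln0.
by rewrite mulnS addnC qintD IHk qintS mulnDr -expnM [q ^ _ * _]mulnC.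
Qed.

Lemma qint_gt0 q m : 0 < q -> 0 < m -> 0 < qint q m.
Proof. by case: m => // m q0 _; rewrite /qint big_ord_recl expn0. Qed.

Lemma qintE q m : 1 < q -> (q ^ m - 1) %/ (q - 1) = qint q m.
Proof. by move=> q1; rewrite !subn1 predn_exp mulKn // -ltnS prednK // ltnW. Qed.

Lemma qint_mod1 d q k : q = 1 %[mod d] -> qint q k = k %[mod d].
Proof.
move=> q1; elim: k => [|k IHk]; first by rewrite /qint big_ord0.
rewrite qintS -modnDm IHk -[q ^ k %% d]modnXm q1 modnXm exp1n.
by rewrite modnDm addn1.
Qed.

Section Types.
Implicit Types (J : pred nat) (l : seq nat).

(** Position k is joined to position k - 1 when k is in J; the resulting blocks
    of 0, ..., n - 1 are listed from the last one to the first. *)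
Fixpoint block_sizes J n : seq nat :=
  if n is k.+1 then
    if block_sizes J k is m :: l then
      if J k then m.+1 :: l else [:: 1, m & l]
    else [:: 1]
  else [::].

(** The rank of k in its block, counted from 1. *)
Fixpoint block_pos J k : nat :=
  if k is i.+1 then if J k then (block_pos J i).+1 else 1 else 1.

Lemma block_sizesS J k :
  block_sizes J k.+1 =
  block_pos J k :: (if J k then behead (block_sizes J k) else block_sizes J k).
Proof.
elim: k => [|k IHk]; first by rewrite /=; case: (J 0).
by rewrite [LHS]/= -/(block_sizes J k.+1) IHk /=; case: (J k.+1).
Qed.

(** The m positions of a block contribute nu 1, ..., nu m.  With nu the valuation
    of a q-integer, g is the valuation of a q-factorial. *)
Lemma block_sizes_sum J (g nu : nat -> nat) n :
  g 0 = 0 -> (forall m, g m.+1 = g m + nu m.+1) ->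
  \sum_(m <- block_sizes J n) g m = \sum_(i < n) nu (block_pos J i).
Proof.
move=> g0 gS; elim: n => [|n IHn]; first by rewrite big_nil big_ord0.
rewrite big_ord_recr -IHn /= -/(block_sizes J n).
case: n {IHn} => [|n] /=; first by rewrite big_cons !big_nil gS g0 addnC.
rewrite -/(block_sizes J n.+1) block_sizesS.
case: (J n.+1); rewrite !big_cons !gS ?g0; lia.
Qed.

Lemma sumn_block_sizes J n : sumn (block_sizes J n) = n.
Proof.
rewrite sumnE (block_sizes_sum J (nu := fun=> 1)) // => [|m]; last by rewrite addn1.
by rewrite sum1_card card_ord.
Qed.

Lemma block_sizes_gt0 J n : all (leq 1) (block_sizes J n).
Proof.
elim: n => //= n; case: (block_sizes J n) => [|m l] //= /andP[m0 l0].
by case: (J n); rewrite /= ?m0.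
Qed.

(** The first positions of the blocks, including 0. *)
Fixpoint cuts l : seq nat := if l is _ :: l' then sumn l' :: cuts l' else [::].

Definition joins l : pred nat := fun k => k \notin cuts l.

Lemma cuts_lt l k : all (leq 1) l -> k \in cuts l -> k < sumn l.
Proof.
elim: l => //= m l IHl /andP[m0 l0]; rewrite inE => /orP[/eqP->|/(IHl l0)]; lia.
Qed.

Lemma cuts_block_sizes J n k :
  0 < k < n -> (k \in cuts (block_sizes J n)) = ~~ J k.
Proof.
elim: n => [|n IHn] kn; first by lia.
have lt_n i : i \in cuts (block_sizes J n) -> i < n.
  by move/(cuts_lt (block_sizes_gt0 J n)); rewrite sumn_block_sizes.
have := sumn_block_sizes J n; rewrite /=.
move: IHn lt_n; case: (block_sizes J n) => [|m l] IHn lt_n sum_n.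
  by move: kn; rewrite -sum_n /=; lia.
have [kltn|] := ltnP k n.
  rewrite -IHn; last by lia.
  by case: (J n) => //=; rewrite !inE; move/eqP: sum_n => /=; case: eqP => // ?; lia.
move=> nk; have -> : k = n by lia.
have n_nin : n \notin sumn l :: cuts l by apply/negP => /lt_n; rewrite ltnn.
case: (J n) => /=; first exact: negbTE.
by rewrite -sum_n /= inE eqxx.
Qed.

Lemma eq_block_sizes J J' n :
  (forall k, 0 < k < n -> J k = J' k) -> block_sizes J n = block_sizes J' n.
Proof.
elim: n => //= n IHn eqJ; rewrite IHn => [|k kn]; last by apply: eqJ; lia.
case: n eqJ {IHn} => [|n] eqJ //=; first by rewrite eqJ //; lia.
Qed.

Lemma block_sizes_joins l : all (leq 1) l -> block_sizes (joins l) (sumn l) = l.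
Proof.
elim: l => //= m l IHl /andP[m0 l0].
have [k ->] : exists k, m = k.+1 by exists m.-1; lia.
rewrite addSn addnC; elim: k => [|k IHk].
  rewrite addn0 /= (eq_block_sizes (J' := joins l)) ?IHl //; last first.
    move=> k kl; rewrite /joins !inE; case: eqP => //; lia.
  by case: l {IHl l0} => //= a l; rewrite /joins /= !inE eqxx.
rewrite addnS [LHS]/= -/(block_sizes _ (sumn l + k).+1) IHk.
rewrite /joins inE (_ : _ == sumn l = false) /=; last by apply/eqP; lia.
by case: ifP => // /negbFE /(cuts_lt l0); lia.
Qed.

Lemma cuts_cat l1 l2 :
  cuts (l1 ++ l2) = [seq k + sumn l2 | k <- cuts l1] ++ cuts l2.
Proof. by elim: l1 => //= m l1 ->; rewrite sumn_cat. Qed.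

Lemma cuts_flatten (ll : seq (seq nat)) :
  all (fun l => l != [::]) ll ->
  {subset cuts [seq sumn l | l <- ll] <= cuts (flatten ll)}.
Proof.
elim: ll => //= l ll IHll /andP[l0 /IHll sub] k; rewrite cuts_cat inE mem_cat.
case/orP=> [/eqP->|/sub->]; last by rewrite orbT.
apply/orP; left; apply/mapP; exists 0.
  by elim: l l0 => //= m [|m' l] IHl _; rewrite inE ?IHl ?orbT.
by rewrite add0n sumn_flatten.
Qed.

Lemma cuts_single l : l != [::] -> {subset cuts [:: sumn l] <= cuts l}.
Proof.
by move=> l0; have := @cuts_flatten [:: l]; rewrite /= l0 cats0; apply.
Qed.

Lemma cuts_ones r k : (k \in cuts (nseq r 1)) = (k < r).
Proof. by elim: r => //= r IHr; rewrite inE IHr sumn_nseq; lia. Qed.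

End Types.

(** * Valuations of q-factorials and the comparison of compositions *)

Section Valuation.
Variables (q ell e : nat).
Hypotheses (q1 : 1 < q) (ell_prime : prime ell) (e2 : 1 < e).
Hypothesis e_dvd : ell %| qint q e.
Hypothesis e_min : forall i, 1 < i -> ell %| qint q i -> e <= i.

Let q0 : 0 < q := ltnW q1.
Let e0 : 0 < e := ltnW e2.

Definition qval m := logn ell (qint q m).

(** Modulo [e], the q-integer [m] is congruent to [m mod e], to which the
    minimality of e applies. *)
Lemma qval_ndvd m : ~~ (e %| m) -> qval m = 0.
Proof.
move=> em; have m0 : 0 < m by case: m em => //; rewrite dvdn0.
rewrite /qval lognE ell_prime qint_gt0 //=.
case: ifP => //; rewrite {1}(divn_eq m e) addnC qintD [_ %/ e * e]mulnC qintM.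
rewrite dvdn_addl; last by rewrite mulnCA dvdn_mulr.
have := ltn_pmod m e0; have : m %% e != 0 by [].
case: (m %% e) => // -[_ _|i _ ie ellqi]; last first.
  by have := @e_min i.+2 isT ellqi; rewrite leqNgt ie.
by rewrite /qint big_ord1 expn0 dvdn1 => /eqP ell1; move: ell_prime; rewrite ell1.
Qed.

Lemma qval_mul j : 0 < j -> qval (e * j) = qval e + logn ell (qint (q ^ e) j).
Proof. by move=> j0; rewrite /qval qintM lognM ?qint_gt0 ?expn_gt0 ?q0. Qed.

Lemma qpow_mod : q ^ e = 1 %[mod ell].
Proof.
apply/eqP; rewrite eqn_mod_dvd ?expn_gt0 ?q0 // subn1 predn_exp.
exact: dvdn_mull.
Qed.

(** One has [e j] = [e] [j]', where [j]' is the q^e-integer; as q^e is 1 modulo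
    ell, [j]' is congruent to j. *)
Lemma qval_lt j : 0 < j < ell -> qval (e * j) = qval e.
Proof.
case/andP=> j0 jell; rewrite qval_mul // lognE ell_prime qint_gt0 ?expn_gt0 ?q0 //=.
rewrite /dvdn (qint_mod1 _ qpow_mod) modn_small // (_ : j == 0 = false) ?addn0 //.
by case: j j0 {jell}.
Qed.

Lemma qval_ge j : 0 < j -> qval e <= qval (e * j).
Proof. by move=> j0; rewrite qval_mul // leq_addr. Qed.

Lemma qval_e_gt0 : 0 < qval e.
Proof. by rewrite /qval logn_gt0 mem_primes ell_prime qint_gt0. Qed.

Lemma qval_top : qval e < qval (e * ell).
Proof.
rewrite qval_mul ?prime_gt0 // -addn1 leq_add2l logn_gt0 mem_primes ell_prime.
rewrite qint_gt0 ?expn_gt0 ?q0 ?prime_gt0 //=.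
by rewrite /dvdn (qint_mod1 _ qpow_mod) modnn.
Qed.

(** The valuation of the q-factorial of m. *)
Definition qfval m := \sum_(i < m) qval i.+1.

Lemma qfvalS m : qfval m.+1 = qfval m + qval m.+1.
Proof. exact: big_ord_recr. Qed.

(** The valuation of the product of [e], [2 e], ..., [k e]. *)
Definition qfval_mul k := \sum_(j < k) qval (e * j.+1).

(** Only the multiples of e contribute, by qval_ndvd. *)
Lemma qfvalE m : qfval m = qfval_mul (m %/ e).
Proof.
elim: m => [|m IHm]; first by rewrite div0n /qfval /qfval_mul !big_ord0.
rewrite qfvalS IHm divnS //; case: (boolP (e %| m.+1)) => em.
  rewrite add1n /qfval_mul big_ord_recr /=; congr (_ + qval _).
  by rewrite -{1}(divnK em) mulnC divnS // em.
by rewrite qval_ndvd // addn0.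
Qed.

Lemma qfval_mul_small k : k < ell -> qfval_mul k = qval e * k.
Proof.
move=> kell; rewrite /qfval_mul (eq_bigr (fun=> qval e)) => [|j _].
  by rewrite sum_nat_const card_ord mulnC.
by apply: qval_lt; rewrite (leq_ltn_trans (ltn_ord j) kell).
Qed.

Lemma qfval_mul_ge k : qval e * k <= qfval_mul k.
Proof.
rewrite -[k in X in X <= _]card_ord mulnC -sum_nat_const.
by apply: leq_sum => j _; apply: qval_ge.
Qed.

Lemma qfval_mul_gt k : ell <= k -> qval e * ell < qfval_mul k.
Proof.
move=> ellk; rewrite -(subnKC ellk) /qfval_mul big_split_ord /=.
apply: leq_trans (leq_addr _ _).
case: {k ellk} ell (prime_gt0 ell_prime) qval_top => // k _ top.
rewrite big_ord_recr /= mulnS addnC -addnS; apply: leq_add => //.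
exact: qfval_mul_ge.
Qed.

Lemma qfval_small m : m %/ e < ell -> qfval m = qval e * (m %/ e).
Proof. by rewrite qfvalE => /qfval_mul_small. Qed.

Lemma qfval_ge m : qval e * (m %/ e) <= qfval m.
Proof. by rewrite qfvalE qfval_mul_ge. Qed.

Section Generation.
Variable n : nat.
Implicit Types (J : pred nat) (l : seq nat).

(** The valuation of the index of the Borel subgroup in the parabolic subgroup
    of J, by which the valuation of the index of the latter falls short of the
    largest one. *)
Definition qdefect J := \sum_(i < n) qval (block_pos J i).

Definition qdefect_seq l := \sum_(m <- l) qfval m.
(** The number of parts e once every part is broken into parts e and 1. *)
Definition eweight l := \sum_(m <- l) m %/ e.

Lemma eweight_cons m l : eweight (m :: l) = m %/ e + eweight l.
Proof. exact: big_cons. Qed.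

Lemma eweight_le l : eweight l <= sumn l %/ e.
Proof.
elim: l => [|m l IHl]; first by rewrite /eweight big_nil.
by rewrite eweight_cons /= divnD // -addnA leq_add2l (leq_trans IHl) ?leq_addr.
Qed.

Lemma qdefectE J : qdefect J = qdefect_seq (block_sizes J n).
Proof.
rewrite /qdefect_seq (block_sizes_sum _ (nu := qval)) //; last exact: qfvalS.
by rewrite /qfval big_ord0.
Qed.

Lemma qdefect_seq_ge l : qval e * eweight l <= qdefect_seq l.
Proof. by rewrite big_distrr; apply: leq_sum => m _; apply: qfval_ge. Qed.

Lemma qdefect_seq_small l :
  {in l, forall m, m %/ e < ell} -> qdefect_seq l = qval e * eweight l.
Proof.
move=> small; rewrite big_distrr; apply: eq_big_seq => m /small.
exact: qfval_small.
Qed.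

Lemma large_qdefect l m :
  m \in l -> ell <= m %/ e -> qval e * ell < qdefect_seq l.
Proof.
move=> ml large; rewrite /qdefect_seq (big_rem m) //=.
by apply: ltn_addr; rewrite qfvalE qfval_mul_gt.
Qed.

Lemma large_eweight l m : m \in l -> m %/ e <= eweight l.
Proof. by move=> ml; rewrite /eweight (big_rem m) //= leq_addr. Qed.

Hypothesis qdefect_max : forall J, qdefect J <= qfval n.
(* The relation gen J J' stands for: every submodule of L containing the
   eigenvector of J contains that of J'. *)
Variable gen : pred nat -> pred nat -> Prop.
Hypothesis gen_trans : forall J1 J2 J3, gen J1 J2 -> gen J2 J3 -> gen J1 J3.
Hypothesis gen_sub : forall J J',
  (forall k, 0 < k < n -> J' k -> J k) -> gen J J'.
Hypothesis gen_sup : forall J J',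
  (forall k, 0 < k < n -> J' k -> J k) -> qdefect J = qdefect J' -> gen J' J.

Definition gens l l' := gen (joins l) (joins l').

Lemma gens_sub l l' : {subset cuts l <= cuts l'} -> gens l l'.
Proof. by move=> sub; apply: gen_sub => k _; apply/contra/sub. Qed.

Definition is_composition l := all (leq 1) l && (sumn l == n).

Lemma qdefect_joins l : is_composition l -> qdefect (joins l) = qdefect_seq l.
Proof.
by case/andP=> l0 /eqP ln; rewrite qdefectE -[in LHS]ln block_sizes_joins.
Qed.

Lemma gens_sup l l' : is_composition l -> is_composition l' -> {subset cuts l <= cuts l'} ->
  qdefect_seq l = qdefect_seq l' -> gens l' l.
Proof.
move=> ln l'n sub ell'; apply: gen_sup; last by rewrite !qdefect_joins.
by move=> k _; apply/contra/sub.
Qed.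

Lemma cuts_merge l1 l2 a b :
  {subset cuts (l1 ++ a + b :: l2) <= cuts (l1 ++ [:: a, b & l2])}.
Proof.
move=> k; rewrite !cuts_cat /= addnA !mem_cat => /orP[->//|].
by rewrite !inE => /orP[]->; rewrite !orbT.
Qed.

(** The composition condition on l' rides along, so that chains of moves never
    have to reprove it. *)
Definition gens_equiv l l' := [/\ is_composition l', gens l l' & gens l' l].

Lemma gens_equiv_refl l : is_composition l -> gens_equiv l l.
Proof. by move=> lc; split=> //; apply: gens_sub. Qed.

Lemma gens_equiv_trans l1 l2 l3 : gens_equiv l1 l2 -> gens_equiv l2 l3 -> gens_equiv l1 l3.
Proof.
case=> _ g12 g21 [c3 g23 g32]; split=> //; first exact: gen_trans g12 g23.
exact: gen_trans g32 g21.
Qed.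

(** A part 1 passes a part e because both orders refine a part e + 1 at no cost
    in valuation: the only q-integer distinguishing them is [e+1], which is
    prime to ell. *)
Lemma gens_equiv_swap l1 l2 : is_composition (l1 ++ [:: 1, e & l2]) ->
  gens_equiv (l1 ++ [:: 1, e & l2]) (l1 ++ [:: e, 1 & l2]).
Proof.
have fE : qfval e.+1 = qfval e.
  rewrite !qfvalE divnS // -[in X in X + _]addn1 dvdn_addr // dvdn1.
  by rewrite (_ : e == 1 = false) //; apply/eqP; lia.
have f1 : qfval 1 = 0 by rewrite qfvalE divn_small // /qfval_mul big_ord0.
move=> c1e; have ce1 : is_composition (l1 ++ [:: e, 1 & l2]).
  move: c1e; rewrite /is_composition !all_cat !sumn_cat /= e0 => /andP[-> /eqP <-].
  by rewrite [1 + (e + _)]addnCA eqxx.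
have cE : is_composition (l1 ++ e + 1 :: l2).
  move: ce1; rewrite /is_composition !all_cat !sumn_cat /= e0 addn1 => /andP[-> /eqP <-].
  by rewrite ?addSn ?addnS /=; apply/eqP; lia.
split=> //.
  apply: (@gen_trans _ (joins (l1 ++ 1 + e :: l2))); last first.
    by rewrite addnC; apply: gens_sub; apply: cuts_merge.
  apply: gens_sup => //; first by rewrite addnC.
    exact: cuts_merge.
  by rewrite /qdefect_seq !big_cat !big_cons /= f1 add1n fE.
apply: (@gen_trans _ (joins (l1 ++ e + 1 :: l2))).
  apply: gens_sup => //; first exact: cuts_merge.
  by rewrite /qdefect_seq !big_cat !big_cons /= f1 addn1 fE.
by rewrite addnC; apply: gens_sub; apply: cuts_merge.
Qed.

(** The normal form of a composition with parts e and 1; its number of parts e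
    determines its valuation. *)
Definition sorted_comp s r := nseq s e ++ nseq r 1.

Lemma gens_equiv_pass l1 s r : is_composition (l1 ++ 1 :: sorted_comp s r) ->
  gens_equiv (l1 ++ 1 :: sorted_comp s r) (l1 ++ sorted_comp s r.+1).
Proof.
elim: s l1 => [|s IHs] l1 cl; first exact: gens_equiv_refl.
have swap := gens_equiv_swap cl; apply: (gens_equiv_trans swap).
case: swap => c _ _; have := IHs (rcons l1 e).
by rewrite !cat_rcons => /(_ c).
Qed.

Lemma gens_equiv_sort l1 l :
  is_composition (l1 ++ l) -> all (fun m => (m == e) || (m == 1)) l ->
  exists r, gens_equiv (l1 ++ l) (l1 ++ sorted_comp (eweight l) r).
Proof.
elim: l l1 => [|m l IHl] l1 cl.
  by exists 0; rewrite /eweight big_nil; apply: gens_equiv_refl.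
move=> /= /andP[m_e1 /(fun h => IHl (rcons l1 m) ^~ h)]; rewrite cat_rcons => /(_ cl)[r geq1].
move: geq1; rewrite !cat_rcons eweight_cons.
case/orP: m_e1 => /eqP-> geq1.
  by exists r; rewrite divnn e0.
exists r.+1; rewrite divn_small // add0n.
by apply: (gens_equiv_trans geq1); apply: gens_equiv_pass; case: geq1.
Qed.

Definition break_part m := nseq (m %/ e) e ++ nseq (m %% e) 1.

Lemma sumn_break m : sumn (break_part m) = m.
Proof. by rewrite sumn_cat !sumn_nseq mul1n mulnC -divn_eq. Qed.

Lemma eweight_break l : eweight (flatten (map break_part l)) = eweight l.
Proof.
elim: l => //= m l IHl; rewrite eweight_cons -IHl /eweight big_cat /=.
congr addn; rewrite big_cat !big_nseq /=.
rewrite divnn e0 [1 %/ e]divn_small // !iter_addn.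
by rewrite mul1n mul0n !addn0.
Qed.

(** Refining a composition is a generation, and sorting the parts e and 1 is an
    equivalence.  If no part reaches e ell, breaking it preserves the valuation,
    so that the refinement can be undone. *)
Lemma gens_break l : is_composition l ->
  exists r, [/\ is_composition (sorted_comp (eweight l) r),
    gens l (sorted_comp (eweight l) r) &
    {in l, forall m, m %/ e < ell} -> gens (sorted_comp (eweight l) r) l].
Proof.
move=> cl; set l' := flatten (map break_part l).
have l'E : map sumn (map break_part l) = l.
  by rewrite -map_comp -[RHS]map_id; apply: eq_map => m /=; rewrite sumn_break.
have e1 m : m \in l' -> (m == e) || (m == 1).
  case/flattenP=> _ /mapP[k _ ->]; rewrite mem_cat !mem_nseq.
  by case/orP=> /andP[_ /eqP->]; rewrite eqxx ?orbT.
have cl' : is_composition l'.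
  case/andP: cl => l0 /eqP ln; rewrite /is_composition sumn_flatten l'E ln eqxx andbT.
  by apply/allP => m /e1 /orP[]/eqP->.
have sub : {subset cuts l <= cuts l'}.
  rewrite -[X in cuts X]l'E; apply: cuts_flatten; apply/allP => _ /mapP[m ml ->].
  apply/eqP => br0; have := sumn_break m; rewrite br0 /= => m0.
  by case/andP: cl => /allP/(_ m ml); rewrite -m0.
have [|r] := @gens_equiv_sort [::] l' cl'; first exact/allP.
rewrite !cat0s eweight_break => -[c g g']; exists r; split=> //.
  by apply: (gen_trans _ g); apply: gens_sub.
move=> small; apply: (gen_trans g'); apply: gens_sup => //.
rewrite qdefect_seq_small // (@qdefect_seq_small l') ?eweight_break // => m.
case/e1/orP=> /eqP->; first by rewrite divnn e0 prime_gt1.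
by rewrite divn_small ?prime_gt0.
Qed.

(** Replacing the last parts e by parts 1 is a refinement. *)
Lemma gens_sorted s s' r r' : s' <= s -> is_composition (sorted_comp s r) ->
  is_composition (sorted_comp s' r') -> gens (sorted_comp s r) (sorted_comp s' r').
Proof.
move=> ss' /andP[_ /eqP c] /andP[_ /eqP c'].
have sum : sumn (nseq (s - s') e ++ nseq r 1) = r'.
  move: c c'; rewrite !sumn_cat !sumn_nseq mulnBr.
  have := leq_mul (leqnn e) ss'; lia.
apply: gens_sub => k; rewrite /sorted_comp -(subnKC ss') nseqD -catA !cuts_cat.
rewrite -cuts_cat sum sumn_nseq mul1n !mem_cat cuts_ones => /orP[->//|kc].
rewrite -sum (cuts_lt _ kc) ?orbT // all_cat !all_nseq.
by rewrite e0 !orbT.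
Qed.

(** J and J' are compared through their refinements into parts e and 1, which
    are ordered by the number of parts e.  Only the way back from the refinement
    of J' can fail, when J' has a part of size at least e ell.  If n / e <= ell,
    that part has the same quotient by e as n, so that J' has the same defect as
    a single block; then so has J, which therefore generates the single block. *)
Lemma gens_of_qdefect J J' : qdefect J' <= qdefect J ->
  n %/ e <= ell \/ qdefect J' <= qval e * ell -> gen J J'.
Proof.
set l := block_sizes J n; set l' := block_sizes J' n.
have to_l K : gen K (joins (block_sizes K n)).
  by apply: gen_sub => k kn; rewrite /joins cuts_block_sizes // negbK.
have of_l K : gen (joins (block_sizes K n)) K.
  by apply: gen_sub => k kn; rewrite /joins cuts_block_sizes // negbK.
have comp_l K : is_composition (block_sizes K n).
  by rewrite /is_composition block_sizes_gt0 sumn_block_sizes eqxx.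
rewrite !qdefectE -/l -/l' => ll' ok.
apply: (gen_trans (to_l J)); apply: (gen_trans _ (of_l J')); rewrite -/(gens l l').
have [/andP[l0 /eqP ln] /andP[l'0 /eqP l'n]] := (comp_l J, comp_l J').
have wn : eweight l' <= n %/ e.
  by rewrite -[X in X %/ e]l'n eweight_le.
case: (boolP (all (fun m => m %/ e < ell) l')) => [/allP small|].
  have l'E := qdefect_seq_small small.
  have [r [c g _]] := gens_break (comp_l J).
  have [r' [c' _ /(_ small) g']] := gens_break (comp_l J').
  apply: (gen_trans g); apply: (gen_trans _ g'); apply: gens_sorted => //.
  case: (boolP (all (fun m => m %/ e < ell) l)) => [/allP smalll|].
    by move: ll'; rewrite l'E qdefect_seq_small // leq_pmul2l ?qval_e_gt0.
  case/allPn=> m ml; rewrite -leqNgt => /leq_trans/(_ (large_eweight ml)).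
  apply: leq_trans; case: ok => [/(leq_trans wn)//|].
  by rewrite l'E leq_pmul2l ?qval_e_gt0.
case/allPn=> m ml'; rewrite -leqNgt => big.
have [ne|] := ok; last by rewrite leqNgt (large_qdefect ml' big).
have mn : m %/ e = n %/ e.
  apply/eqP; rewrite eqn_leq (leq_trans ne big) andbT.
  exact: leq_trans (large_eweight ml') wn.
have n0 : 0 < n.
  case: posnP mn big => // ->; rewrite div0n => ->.
  by rewrite leqNgt prime_gt0.
have cn : is_composition [:: n] by rewrite /is_composition /= n0 addn0 eqxx.
have sub K : {subset cuts [:: n] <= cuts (block_sizes K n)}.
  have := @cuts_single (block_sizes K n); rewrite sumn_block_sizes; apply.
  by apply/eqP => bs0; have := sumn_block_sizes K n; rewrite bs0 /=; lia.
apply: (@gen_trans _ (joins [:: n])); last by apply: gens_sub; apply: sub.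
apply: (gens_sup cn (comp_l J) (sub J)).
have single : qdefect_seq [:: n] = qfval n by rewrite /qdefect_seq big_seq1.
have := qdefect_max J; rewrite qdefectE -/l => lmax.
apply/eqP; rewrite eqn_leq single lmax andbT.
apply: leq_trans ll'.
by rewrite /qdefect_seq (big_rem m) //= qfvalE -mn -qfvalE leq_addr.
Qed.
End Generation.

(** A part of size at least e ell alone already has a larger defect. *)
Lemma qdefect_low n (J : pred nat) : qdefect n J <= qval e * ell ->
  exists2 s, s <= ell & qdefect n J = qval e * s.
Proof.
rewrite qdefectE => low; exists (eweight (block_sizes J n)).
  rewrite -(leq_pmul2l qval_e_gt0); apply: leq_trans low.
  exact: qdefect_seq_ge.
apply: qdefect_seq_small => m ml; rewrite ltnNge; apply/negP => big.
by have := large_qdefect ml big; rewrite ltnNge low.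
Qed.

Lemma qdefect_attained n s : s * e <= n ->
  exists J : pred nat, qdefect n J = qval e * s.
Proof.
move=> sn; pose l := sorted_comp s (n - s * e); exists (joins l).
have e1 m : m \in l -> (m == e) || (m == 1).
  by rewrite mem_cat !mem_nseq => /orP[]/andP[_ ->]; rewrite ?orbT.
have cl : is_composition n l.
  rewrite /is_composition sumn_cat !sumn_nseq mul1n [e * s]mulnC subnKC // eqxx andbT.
  by apply/allP => m /e1 /orP[]/eqP->.
rewrite (qdefect_joins cl) qdefect_seq_small => [|m /e1 /orP[]/eqP->].
- congr (_ * _); rewrite /eweight big_cat !big_nseq /= divnn e0 [1 %/ e]divn_small //.
  by rewrite !iter_addn mul1n mul0n !addn0.
- by rewrite divnn e0 prime_gt1.
by rewrite divn_small ?prime_gt0.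
Qed.

End Valuation.

(** * Young subgroups and their minimal coset representatives *)

Import GroupScope.

(** The number of the block containing k. *)
Fixpoint blk (J : pred nat) k : nat :=
  if k is i.+1 then blk J i + ~~ J i.+1 else 0.

Section Blocks.
Variable J : pred nat.

Lemma blk_mono i j : i <= j -> blk J i <= blk J j.
Proof.
move/subnKC<-; elim: (j - i) => [|k IHk]; first by rewrite addn0.
by rewrite addnS /= (leq_trans IHk) ?leq_addr.
Qed.

Lemma ltn_of_blk i j : blk J i < blk J j -> i < j.
Proof. by rewrite !ltnNge; apply/contra/blk_mono. Qed.

Lemma blkS i : (blk J i == blk J i.+1) = J i.+1.
Proof. by rewrite /= -{1}[blk J i]addn0 eqn_add2l; case: (J i.+1). Qed.

Lemma blk_between i j k : i <= j <= k -> blk J i = blk J k -> blk J i = blk J j.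
Proof.
case/andP=> /blk_mono ij /blk_mono jk ik.
by apply/eqP; rewrite eqn_leq ij ik jk.
Qed.

Lemma blk_pos j k : j <= k -> (blk J j == blk J k) = (k - j < block_pos J k).
Proof.
elim: k => [|k IHk]; first by rewrite leqn0 => /eqP->; rewrite eqxx; case: (J 0).
rewrite leq_eqVlt => /orP[/eqP->|jk]; first by rewrite eqxx subnn /=; case: (J k.+1).
rewrite [block_pos _ _]/=; case: (boolP (J k.+1)) => Jk.
  by rewrite -(eqP (etrans (blkS k) Jk)) IHk // subSn.
have := blk_mono (jk : j <= k).
by rewrite /= Jk; case: eqP; lia.
Qed.

Lemma block_pos_le k : block_pos J k <= k.+1.
Proof. by elim: k => //= k IHk; case: (J _). Qed.

End Blocks.

Lemma blk_sub (J J' : pred nat) n : (forall k, 0 < k < n -> J' k -> J k) ->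
  forall i j, i <= j < n -> blk J' i = blk J' j -> blk J i = blk J j.
Proof.
move=> sub i j /andP[/subnKC <-]; elim: (j - i) => [|k IHk]; first by rewrite addn0.
rewrite addnS => kn bij.
have bik : blk J' i = blk J' (i + k).
  by apply: (blk_between (k := (i + k).+1)) => //; rewrite leq_addr leqnSn.
have /eqP := bij; rewrite bik blkS => /sub Jk.
by rewrite IHk // ?(ltnW kn) //; apply/eqP; rewrite blkS Jk //= kn.
Qed.

Lemma blk_predT i : blk predT i = 0.
Proof. by elim: i => //= i ->. Qed.

Section Perms.
Variable n : nat.
Implicit Types (J : pred nat) (w v u : 'S_n) (i j : 'I_n).

(** The representatives of minimal length of the right cosets of the Young
    subgroup. *)
Definition incr J : pred 'S_n :=
  [pred w : 'S_n | [forall i : 'I_n, forall j : 'I_n,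
    (j == i.+1 :> nat) && J j ==> (w i < w j)]].

Lemma incrP J w : reflect (forall i j, j = i.+1 :> nat -> J j -> w i < w j) (incr J w).
Proof.
apply: (iffP forallP) => [h i j ji Jj | h i].
  by have /forallP/(_ j) := h i; rewrite ji eqxx -ji Jj.
by apply/forallP => j; apply/implyP => /andP[/eqP ji Jj]; apply: h.
Qed.

Lemma incr_blk J w i j : incr J w -> i < j -> blk J i = blk J j -> w i < w j.
Proof.
move/incrP=> h; case: j => j jn /=; elim: j jn => // j IHj jn ij bij.
have bj : blk J i = blk J j by apply: (blk_between (k := j.+1)); rewrite ?leqnSn ?andbT.
have Jj : J j.+1 by rewrite -blkS -bj bij.
have lt_j : w (Ordinal (ltnW jn)) < w (Ordinal jn) by apply: h.
move: ij; rewrite ltnS leq_eqVlt => /orP[/eqP ij|ij].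
  by have -> : i = Ordinal (ltnW jn) by apply: val_inj.
exact: ltn_trans (IHj _ ij bj) lt_j.
Qed.

(** Sorting by adjacent transpositions terminates because the rearrangement sum
    of the i * w i increases at each exchange. *)
Lemma perm_sort_ind J (Q : 'S_n -> Prop) :
  (forall w, incr J w -> Q w) ->
  (forall w i j, j = i.+1 :> nat -> J j -> w j < w i -> Q (tperm i j * w) -> Q w) ->
  forall w, Q w.
Proof.
move=> Qincr Qstep w; pose stat w := (\sum_(i < n) i * w i)%N.
have [k] := ubnP ((\sum_(i < n) i * n)%N - stat w); elim: k w => // k IHk w wk.
case: (boolP (incr J w)) => [/Qincr//|].
case/forallPn=> i /forallPn[j]; rewrite negb_imply -leqNgt => /andP[/andP[/eqP ji Jj]].
have ij : i != j by apply/eqP => /(congr1 val) /=; lia.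
rewrite leq_eqVlt => /orP[/eqP/val_inj/perm_inj/eqP|wji].
  by rewrite eq_sym (negbTE ij).
apply: (Qstep _ _ _ ji Jj wji); apply: IHk.
have stat_le v : stat v <= (\sum_(i < n) i * n)%N.
  by apply: leq_sum => l _; rewrite leq_mul2l ltnW ?orbT.
suff : stat w < stat (tperm i j * w) by have := stat_le (tperm i j * w); lia.
rewrite /stat (bigD1 i) //= (bigD1 j) 1?eq_sym //=.
rewrite [X in _ < X](bigD1 i) //= [X in _ < _ + X](bigD1 j) 1?eq_sym //=.
rewrite !permM tpermL tpermR !addnA -addSn; apply: leq_add.
  by rewrite ji !mulSn; lia.
apply/eq_leq/eq_bigr => l /andP[li lj]; rewrite permM tpermD // eq_sym //.
Qed.

(** The values of v and of w have the same sum. *)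
Lemma perm_le_eq v w : (forall i, v i <= w i) -> v = w.
Proof.
move=> le_vw; apply/permP => i; apply/val_inj/eqP; rewrite eqn_leq le_vw /=.
have le_sum : (\sum_(j < n | j != i) v j <= \sum_(j < n | j != i) w j)%N.
  exact: leq_sum.
have : (\sum_(j < n) v j = \sum_(j < n) w j)%N.
  have sumE (x : 'S_n) : (\sum_(j < n) x j = \sum_(j < n) j)%N.
    by rewrite [RHS](reindex_inj (@perm_inj _ x)).
  by rewrite !sumE.
rewrite (bigD1 i) //= [X in _ = X -> _](bigD1 i) //=.
by move=> e; rewrite -(leq_add2r (\sum_(j < n | j != i) w j)%N) -e leq_add2l.
Qed.

Lemma incr_predT w : incr predT w -> w = 1.
Proof.
move=> h; have lt_w i j : i < j -> w i < w j.
  by move=> ij; apply: (incr_blk h ij); rewrite !blk_predT.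
have ge_w i : i <= w i.
  case: i => i; elim: i => // i IHi lti; have lti' := ltnW lti.
  by apply: leq_ltn_trans (IHi lti') (lt_w (Ordinal lti') (Ordinal lti) (ltnSn i)).
by apply/esym/perm_le_eq => i; rewrite perm1.
Qed.

Definition young J : {set 'S_n} := [set w : 'S_n | [forall i, blk J (w i) == blk J i]].

Lemma youngP J w : reflect (forall i, blk J (w i) = blk J i) (w \in young J).
Proof. by rewrite inE; apply: (iffP forallP) => h i; apply/eqP. Qed.

Lemma young_group_set J : group_set (young J).
Proof.
apply/group_setP; split=> [|v w /youngP hv /youngP hw]; apply/youngP => i.
  by rewrite perm1.
by rewrite permM hw.
Qed.
Canonical young_group J := Group (young_group_set J).

Lemma tperm_young J i j : j = i.+1 :> nat -> (tperm i j \in young J) = J j.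
Proof.
move=> ji; have Jj : J j = (blk J i == blk J j) by rewrite ji blkS.
apply/youngP/idP => [/(_ j)|]; first by rewrite tpermR Jj => ->.
by rewrite Jj => /eqP e k; case: tpermP => // ->.
Qed.

Lemma young_incr J w : w \in young J -> incr J w -> w = 1.
Proof.
move=> /youngP wJ h; apply: incr_predT; apply/incrP => i j ji _.
have [bij|bij] := eqVneq (blk J i) (blk J j).
  by apply: incr_blk h _ bij; rewrite ji.
apply: (@ltn_of_blk J); rewrite !wJ ltn_neqAle bij blk_mono // ji leqnSn //.
Qed.

(** Sorting inside the blocks reduces a member of the Young subgroup to the
    identity, so the adjacent transpositions inside the blocks generate it. *)
Lemma young_ind J (Q : 'S_n -> Prop) : Q 1 ->
  (forall w i j, j = i.+1 :> nat -> J j -> Q w -> Q (tperm i j * w)) ->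
  {in young J, forall w, Q w}.
Proof.
move=> Q1 Qs; apply: (@perm_sort_ind J) => [w h wJ|w i j ji Jj _ IHw wJ].
  by rewrite (young_incr wJ h).
have tJ : tperm i j \in young J by rewrite tperm_young.
by rewrite -(mulKg (tperm i j) w) tpermV; apply: Qs => //; apply/IHw/groupM.
Qed.

Definition inversions w := (\sum_(i < n) \sum_(j < n) ((i < j) && (w j < w i)))%N.

Lemma young_lt J v i j : v \in young J -> blk J i != blk J j ->
  (v i < v j) = (i < j).
Proof.
move=> /youngP vJ; rewrite neq_ltn => /orP[] bij.
  by rewrite (ltn_of_blk bij) (@ltn_of_blk J) ?vJ.
have := @ltn_of_blk J (v j) (v i); rewrite !vJ => /(_ bij) /ltnW.
by rewrite leqNgt => /negbTE->; have /ltnW := ltn_of_blk bij; rewrite leqNgt => /negbTE->.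
Qed.

(** A pair inside a block is reordered by v only, and a pair from different
    blocks by u only. *)
Lemma inversions_mul J v u : v \in young J -> incr J u ->
  inversions (v * u) = inversions v + inversions u.
Proof.
move=> vJ uJ.
have -> : inversions u = (\sum_(i < n) \sum_(j < n) ((v i < v j) && (u (v j) < u (v i))))%N.
  rewrite /inversions (reindex_inj (@perm_inj _ v)); apply: eq_bigr => i _.
  by rewrite (reindex_inj (@perm_inj _ v)).
rewrite -big_split; apply: eq_bigr => i _; rewrite -big_split; apply: eq_bigr => j _ /=.
rewrite !permM; have vb k : blk J (v k) = blk J k by move/youngP: vJ.
have [bij|bij] := eqVneq (blk J i) (blk J j); last first.
  by rewrite !(young_lt vJ) // 1?eq_sym //; case: ltngtP.
have uv (k l : 'I_n) : blk J k = blk J l -> v k < v l -> u (v k) < u (v l).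
  by move=> bkl kl; apply: incr_blk uJ kl _; rewrite !vb.
case: (ltngtP (v i) (v j)) => [lt_v|lt_v|/val_inj/perm_inj->].
- by rewrite andbF (ltnNge (u (v j))) (ltnW (uv _ _ bij lt_v)) andbF.
- by rewrite (uv _ _ (esym bij) lt_v) addn0.
by rewrite !ltnn andbF.
Qed.

Lemma young_factor J w : exists v u, [/\ v \in young J, incr J u & w = v * u].
Proof.
elim/(@perm_sort_ind J): w => [w wJ|w i j ji Jj _ [v [u [vJ uJ w_eq]]]].
  by exists 1, w; rewrite group1 mul1g.
exists (tperm i j * v), u; split=> //; first by rewrite groupM // tperm_young.
by rewrite -mulgA -w_eq mulgA tperm2 mul1g.
Qed.

Lemma incr_unique J v u u' : v \in young J -> incr J u -> incr J u' ->
  u' = v * u -> v = 1.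
Proof.
move=> vJ uJ u'J e; apply: (young_incr vJ); apply/incrP => i j ji Jj.
have bij : blk J i = blk J j by apply/eqP; rewrite ji blkS -ji.
have /incrP/(_ i j ji Jj) := u'J; rewrite e !permM.
apply: contraTltn; rewrite -leqNgt leq_eqVlt.
case/orP=> [/eqP/val_inj->//|lt_v]; apply/ltnW/(incr_blk uJ lt_v).
by move/youngP: vJ => vJ; rewrite !vJ.
Qed.

(** Every permutation factors uniquely as v * u, and inversions add up. *)
Lemma sum_young_incr J (q : nat) :
  (\sum_(w : 'S_n) q ^ inversions w =
   (\sum_(v in young J) q ^ inversions v) * \sum_(u | incr J u) q ^ inversions u)%N.
Proof.
pose A := setX (young J) [set u | incr J u].
rewrite big_distrlr pair_big_dep /=.
transitivity (\sum_(p in A) q ^ inversions (p.1 * p.2)%g)%N; last first.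
  rewrite (eq_bigl (fun p => (p.1 \in young J) && incr J p.2)); last first.
    by move=> p; rewrite !inE.
  by apply: eq_bigr => p /andP[p1 p2]; rewrite (inversions_mul p1 p2) expnD.
rewrite -(big_imset (fun w => q ^ inversions w)%N (h := fun p => p.1 * p.2)) /=; last first.
  move=> [v u] [v' u']; rewrite !in_setX /= [u \in _]inE [u' \in _]inE.
  move=> /andP[vJ uJ] /andP[v'J u'J] e.
  have e' : u' = (v'^-1 * v) * u by rewrite -mulgA e mulKg.
  have v1 : v'^-1 * v = 1.
    by apply: (incr_unique _ uJ u'J e'); rewrite groupM ?groupV.
  have -> : v' = v by rewrite -(mulKVg v' v) v1 mulg1.
  by rewrite e' v1 mul1g.
apply: eq_bigl => w; symmetry; apply/imsetP.
have [v [u [vJ uJ ->]]] := young_factor J w.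
by exists (v, u); rewrite // in_setX vJ inE.
Qed.

End Perms.

(** * Counting a Young subgroup by inversions *)

Import GroupScope.

Section Lehmer.
Variables (J : pred nat) (q : nat).

(** The permutation sending the last point to p.1 and ordering the others as
    p.2 does; iterating this gives the Lehmer code. *)
Definition lehmer n (p : 'I_n.+1 * 'S_n) := lift_perm ord_max p.1 p.2.

Lemma lehmer_bij n : bijective (@lehmer n).
Proof.
apply: inj_card_bij; last by rewrite card_prod card_ord !card_Sn factS.
move=> [j s] [j' s'] /permP e; have /= ejj := e ord_max.
move: ejj e; rewrite /lehmer /= !lift_perm_id => -> e; congr (_, _).
by apply/permP => k; have := e (lift ord_max k); rewrite !lift_perm_lift => /lift_inj.
Qed.

Lemma inversions_lehmer n (j : 'I_n.+1) (s : 'S_n) :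
  inversions (lehmer (j, s)) = (inversions s + (n - j))%N.
Proof.
have widenE (k : 'I_n) : widen_ord (leqnSn n) k = lift ord_max k.
  by apply: val_inj; apply/esym/lift_max.
rewrite /inversions big_ord_recr /= [X in (_ + X)%N]big1 ?addn0 => [|k _]; last first.
  by rewrite ltnNge -ltnS ltn_ord.
under eq_bigr => i _.
  rewrite big_ord_recr /= widenE /lehmer lift_perm_lift lift_perm_id ltn_ord /=.
  under eq_bigr => k _.
    rewrite widenE lift_perm_lift /= [X in _ && X]ltnNge leq_bump2 -ltnNge.
    over.
  over.
rewrite big_split /=; congr addn.
rewrite (reindex_inj (@perm_inj _ s^-1)) /=.
under eq_bigr => i _ do rewrite permKV.
have <- : \sum_(i < n) (j <= i) = (n - j)%N.
  have jn : j <= n by rewrite -ltnS.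
  rewrite -(big_mkord xpredT (fun i => (j <= i) : nat)) (big_cat_nat (leq0n j) jn) /=.
  rewrite big_nat big1 => [|i /andP[_]]; last by rewrite ltnNge => /negbTE->.
  rewrite big_nat (eq_bigr (fun=> 1%N)) => [|i /andP[->]//].
  by rewrite -big_nat sum_nat_const_nat muln1.
apply: eq_bigr => i _; rewrite /bump; case: (leqP j i) => ji /=; lia.
Qed.

Lemma young_lehmer n (j : 'I_n.+1) (s : 'S_n) :
  (lehmer (j, s) \in young n.+1 J) = (blk J j == blk J n) && (s \in young n J).
Proof.
have same (k : 'I_n) : blk J j = blk J n -> blk J (lift j k) = blk J k.
  move=> jn; rewrite /= /bump; case: leqP => //= jk.
  have kn : blk J k = blk J n.
    by rewrite -jn (@blk_between J j k n) // jk ltnW.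
  by apply/esym/(@blk_between J k k.+1 n); rewrite // leqnSn ltn_ord.
apply/youngP/andP => [h|[/eqP jn /youngP h] i].
  have jn : blk J j = blk J n by have := h ord_max; rewrite lift_perm_id.
  split; first exact/eqP.
  by apply/youngP => k; have := h (lift ord_max k); rewrite lift_perm_lift same // lift_max.
case: (unliftP ord_max i) => [k|] ->; last by rewrite lift_perm_id jn.
by rewrite lift_perm_lift same // lift_max.
Qed.

(** The image of the last point ranges over its block and contributes the
    q-integer of the size that this block has so far. *)
Lemma sum_young n :
  (\sum_(w in young n J) q ^ inversions w = \prod_(i < n) qint q (block_pos J i))%N.
Proof.
elim: n => [|n IHn].
  rewrite big_ord0 (big_pred1 1) => [|w]; first by rewrite /inversions big_ord0.
  by have -> : w = 1 by [apply/permP => -[]]; rewrite group1 /= eqxx.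
rewrite big_ord_recr -IHn (reindex (@lehmer n)) /=; last exact/onW_bij/lehmer_bij.
rewrite (eq_bigl (fun p : 'I_n.+1 * 'S_n =>
  (blk J p.1 == blk J n) && (p.2 \in young n J))); last first.
  by case=> j s; rewrite young_lehmer.
rewrite -(pair_big_dep (fun j : 'I_n.+1 => blk J j == blk J n)
  (fun _ s => s \in young n J) (fun j s => q ^ inversions (lehmer (j, s)))%N) /=.
rewrite mulnC (reindex_inj rev_ord_inj) /=.
have -> : qint q (block_pos J n) = (\sum_(i < n.+1 | i < block_pos J n) q ^ i)%N.
  by rewrite /qint (big_ord_widen _ (fun i => q ^ i)%N (block_pos_le J n)).
rewrite big_distrl; apply: eq_big => [i|i _] /=.
  by rewrite subSS blk_pos ?leq_subr // subKn // -ltnS.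
rewrite big_distrr; apply: eq_bigr => s _.
by rewrite inversions_lehmer /= subSS subKn -1?ltnS // expnD mulnC.
Qed.

End Lehmer.

(** Factoring the order-reversing permutation through the Young subgroup gives
    the permutation reversing each block. *)
Lemma block_reversal (J : pred nat) n : exists r : 'S_n,
  r \in young n J /\
  forall i j : 'I_n, blk J i = blk J j -> (r i + i = r j + j)%N.
Proof.
have [r [u [rJ uJ ru]]] := young_factor J (perm (@rev_ord_inj n)).
have rlt (i j : 'I_n) : i < j -> blk J i = blk J j -> r j < r i.
  move=> ij bij; rewrite ltnNge leq_eqVlt; apply/negP => /orP[/eqP/val_inj/perm_inj|].
    by move=> ji; rewrite ji ltnn in ij.
  move/(incr_blk uJ)=> lt_u; move/youngP: (rJ) => rb; move: lt_u; rewrite !rb => /(_ bij).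
  by rewrite -!permM -ru !permE /= ltnNge leq_sub2l // ltnW.
have radj (i j : 'I_n) : j = i.+1 :> nat -> blk J i = blk J j -> (r i + i = r j + j)%N.
  move=> ji bij; have lt_ij : i < j by rewrite ji.
  suff : r i <= (r j).+1 by have := rlt i j lt_ij bij; lia.
  rewrite leqNgt; apply/negP => gap.
  have midn : (r j).+1 < n by apply: ltn_trans gap _.
  pose k := r^-1 (Ordinal midn).
  have rk : r k = (r j).+1 :> nat by rewrite /k permKV.
  move/youngP: (rJ) => rb.
  have bk : blk J k = blk J j.
    rewrite -rb -[RHS]rb rk; apply/esym/(@blk_between _ _ _ (r i)).
      by rewrite leqnSn ltnW.
    by rewrite !rb.
  case: (ltngtP k i) => [ki|ik|/val_inj ki].
  - by have := rlt k i ki (etrans bk (esym bij)); lia.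
  - case: (ltngtP k j) => [kj|jk|/val_inj kj]; first by lia.
      by have := rlt j k jk (esym bk); lia.
    by move: rk; rewrite kj; lia.
  by move: rk; rewrite ki; lia.
exists r; split=> //.
suff wlog_le (i j : 'I_n) : i <= j -> blk J i = blk J j -> (r i + i = r j + j)%N.
  move=> i j bij; case/orP: (leq_total i j) => ij; first exact: wlog_le.
  by apply/esym/wlog_le.
case: j => j jn /=; elim: j jn => [|j IHj] jn.
  by rewrite leqn0 => /eqP i0 _; rewrite (_ : i = Ordinal jn) //; apply: val_inj.
rewrite leq_eqVlt => /orP[/eqP ij _|ij bij].
  by rewrite (_ : i = Ordinal jn) //; apply: val_inj.
have bj : blk J i = blk J j by apply: (@blk_between _ _ _ j.+1); rewrite ?leqnSn ?andbT.
rewrite (IHj (ltnW jn) ij bj) (radj (Ordinal (ltnW jn)) (Ordinal jn)) //=.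
exact: etrans (esym bj) bij.
Qed.

Import GRing.Theory.
Local Open Scope ring_scope.

(** * Subgroups of the general linear group *)

(** Naming the finite group keeps its structure from being unfolded to the unit
    group of a matrix ring. *)
Definition GLfin (m : nat) (F : finFieldType) : finGroupType := {'GL_m.+1[F]}.

Section GL.
Variables (m : nat) (F : finFieldType).
Local Notation n := m.+1.
Local Notation G := (GLfin m F).
Implicit Types (g h b u t : G) (s w : 'S_n) (i j k : 'I_n) (f : 'I_n -> 'I_n -> F).

Lemma ltn_ordF i j : (i < j)%N -> (i == j) = false.
Proof. by move=> ij; rewrite -val_eqE ltn_eqF. Qed.

Definition ent g i j : F := GLval (g : {'GL_n[F]}) i j.

Definition borelg : {set G} := borel n F.
Local Notation B := borelg.

Definition permg s : G := @perm_elt n F s.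
Local Notation pe := permg.

Lemma entP g h : (forall i j, ent g i j = ent h i j) -> g = h.
Proof. by move=> gh; apply: (val_inj : injective (@GLval n F)); apply/matrixP. Qed.

Lemma ent1 i j : ent 1%g i j = (i == j)%:R.
Proof. by rewrite [LHS]mxE. Qed.

Lemma entM g h i j : ent (g * h)%g i j = \sum_k ent g i k * ent h k j.
Proof. by rewrite [LHS]mxE. Qed.

(** For a reflexive and transitive r these are groups: the Borel subgroup, the
    torus and the standard parabolic subgroups are of this form. *)
Definition pattern (r : rel 'I_n) : {set G} :=
  [set g | [forall i, forall j, ~~ r i j ==> (ent g i j == 0)]].

Lemma patternP (r : rel 'I_n) g :
  reflect (forall i j, ~~ r i j -> ent g i j = 0) (g \in pattern r).
Proof.
rewrite inE; apply: (iffP forallP) => [h i j rij|h i].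
  by have /forallP/(_ j)/implyP/(_ rij)/eqP := h i.
by apply/forallP => j; apply/implyP => rij; apply/eqP/h.
Qed.

Lemma pattern_group_set (r : rel 'I_n) :
  reflexive r -> transitive r -> group_set (pattern r).
Proof.
move=> rr tr; apply/group_setP; split=> [|g h /patternP gr /patternP hr].
  by apply/patternP => i j; rewrite ent1; case: eqP => // ->; rewrite rr.
apply/patternP => i j rij; rewrite entM big1 // => k _.
case: (boolP (r i k)) => [rik|/gr->]; last by rewrite mul0r.
case: (boolP (r k j)) => [rkj|/hr->]; last by rewrite mulr0.
by rewrite (tr _ _ _ rik rkj) in rij.
Qed.

Lemma borel_pattern : B = pattern (fun i j => (i <= j)%N).
Proof.
by apply/setP => g; rewrite !inE; do 2 apply: eq_forallb => ?; rewrite -ltnNge.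
Qed.

Lemma borelP g : reflect (forall i j, (j < i)%N -> ent g i j = 0) (g \in B).
Proof.
by rewrite borel_pattern; apply: (iffP (patternP _ _)) => h i j ij;
  apply: h; rewrite -?ltnNge // ltnNge.
Qed.

Lemma borel_group_set : group_set B.
Proof.
by rewrite borel_pattern; apply: pattern_group_set => // i j k; apply: leq_trans.
Qed.
Canonical borel_group := Group borel_group_set.

Lemma borelM_diag b b' i : b \in B -> b' \in B ->
  ent (b * b')%g i i = ent b i i * ent b' i i.
Proof.
move=> /borelP hb /borelP hb'; rewrite entM (bigD1 i) //= big1 ?addr0 // => k.
by rewrite neq_ltn => /orP[ki|ik]; [rewrite hb // mul0r|rewrite hb' // mulr0].
Qed.

(** The unipotent radical of the Borel subgroup. *)
Definition unip : {set G} := [set g in B | [forall i, ent g i i == 1]].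
Local Notation U := unip.

Lemma unipP g : reflect (forall i j, (j <= i)%N -> ent g i j = (i == j)%:R) (g \in U).
Proof.
rewrite inE; apply: (iffP andP) => [[/borelP gB /forallP g1] i j|h].
  rewrite leq_eqVlt => /orP[/eqP/val_inj->|ji]; first by rewrite eqxx (eqP (g1 i)).
  by rewrite gB // -val_eqE eqn_leq [(i <= _)%N]leqNgt ji.
split; last by apply/forallP => i; rewrite h // eqxx.
by apply/borelP => i j ji; rewrite h ?(ltnW ji) // -val_eqE eqn_leq [(i <= _)%N]leqNgt ji.
Qed.

Lemma in_unip g : (g \in U) = (g \in B) && [forall i, ent g i i == 1].
Proof. exact: in_set. Qed.

Lemma unip_borel : U \subset B.
Proof. by apply/subsetP => g; rewrite in_unip => /andP[]. Qed.

Lemma unip_group_set : group_set U.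
Proof.
apply/group_setP; split=> [|g h]; first by apply/unipP => i j _; rewrite ent1.
rewrite !in_unip => /andP[gB /forallP g1] /andP[hB /forallP h1].
rewrite groupM //; apply/forallP => i.
by rewrite borelM_diag // (eqP (g1 i)) (eqP (h1 i)) mulr1.
Qed.
Canonical unip_group := Group unip_group_set.

Definition mkGL (A : 'M[F]_n) : G := insubd (1%g : G) A.

Lemma mkGLE (A : 'M[F]_n) : A \in unitmx -> GLval (mkGL A) = A.
Proof. by move=> Au; apply: (insubdK (1%g : G)). Qed.

Definition upper f : G :=
  mkGL (\matrix_(i, j) if (i < j)%N then f i j else (i == j)%:R).

Lemma ent_upper f i j : ent (upper f) i j = if (i < j)%N then f i j else (i == j)%:R.
Proof.
rewrite /ent mkGLE ?mxE // unitmxE -det_tr det_trig; last first.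
  apply/is_trig_mxP => a b ab; rewrite !mxE ltnNge (ltnW ab) /=.
  by rewrite -val_eqE eqn_leq [(b <= _)%N]leqNgt ab.
by rewrite big1 ?unitr1 // => a _; rewrite !mxE ltnn eqxx.
Qed.

Lemma upper_unip f : upper f \in U.
Proof. by apply/unipP => i j ji; rewrite ent_upper ltnNge ji. Qed.

Definition torus : {set G} := pattern (fun i j => i == j).
Local Notation T := torus.

Lemma torus_group_set : group_set T.
Proof. by apply: pattern_group_set => [i|i j k /eqP-> //]; rewrite eqxx. Qed.
Canonical torus_group := Group torus_group_set.

Lemma torus_borel : T \subset B.
Proof.
apply/subsetP => t /patternP tT; apply/borelP => i j ji; apply: tT.
by rewrite -val_eqE eqn_leq [(i <= _)%N]leqNgt ji.
Qed.

Definition diag (d : 'I_n -> F) : G := mkGL (diag_mx (\row_i d i)).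

Lemma ent_diag d i j : (forall k, d k != 0) -> ent (diag d) i j = d i *+ (i == j).
Proof.
move=> d0; rewrite /ent mkGLE ?mxE // unitmxE det_diag unitfE.
by apply/prodf_neq0 => k _; rewrite mxE.
Qed.

Lemma diag_torus d : (forall k, d k != 0) -> diag d \in T.
Proof.
by move=> d0; apply/patternP => i j /negbTE ij; rewrite ent_diag // ij mulr0n.
Qed.

Lemma borel_diag_neq0 b i : b \in B -> ent b i i != 0.
Proof.
move=> bB; apply/eqP => bi; have := @borelM_diag b b^-1%g i bB.
rewrite groupV => /(_ bB) /eqP.
by rewrite mulgV ent1 eqxx bi mul0r oner_eq0.
Qed.

Lemma borel_factor b : b \in B -> exists u t, [/\ u \in U, t \in T & b = (u * t)%g].
Proof.
move=> bB; pose d i := ent b i i; have d0 i : d i != 0 := borel_diag_neq0 i bB.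
pose d' i := (d i)^-1; have d'0 i : d' i != 0 by rewrite invr_eq0.
have dT' := diag_torus d'0; have dB' := subsetP torus_borel _ dT'.
exists (b * diag d')%g, (diag d')^-1%g; split; rewrite ?groupV ?mulgK //.
rewrite in_unip groupM //=; apply/forallP => i.
by rewrite borelM_diag // ent_diag // eqxx mulr1n mulfV ?d0.
Qed.

Lemma ent_perm (s : 'S_n) i j : ent (pe s) i j = (s i == j)%:R.
Proof. by rewrite /ent /= !mxE. Qed.

Lemma perm_eltM s w : pe (s * w)%g = (pe s * pe w)%g.
Proof. by apply: val_inj; rewrite /= perm_mxM. Qed.

Lemma perm_elt1 : pe 1%g = 1%g.
Proof. by apply: val_inj; rewrite /= perm_mx1. Qed.

Lemma perm_eltV s : pe s^-1%g = (pe s)^-1%g.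
Proof. by apply: (mulgI (pe s)); rewrite -perm_eltM !mulgV perm_elt1. Qed.

Lemma ent_perm_mul s g i j : ent (pe s * g)%g i j = ent g (s i) j.
Proof.
rewrite entM (bigD1 (s i)) //= big1 ?addr0 => [|k /negbTE ki]; rewrite ent_perm.
  by rewrite eqxx mul1r.
by rewrite eq_sym ki mul0r.
Qed.

Lemma ent_mul_perm s g i j : ent (g * pe s)%g i j = ent g i (s^-1%g j).
Proof.
rewrite entM (bigD1 (s^-1%g j)) //= big1 ?addr0 => [|k ki]; rewrite ent_perm.
  by rewrite permKV eqxx mulr1.
by rewrite (_ : s k == j = false) ?mulr0 //; apply: contraNF ki => /eqP<-; rewrite permK.
Qed.

Lemma ent_perm_conj s g i j : ent (pe s * g * (pe s)^-1)%g i j = ent g (s i) (s j).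
Proof. by rewrite -perm_eltV ent_mul_perm invgK ent_perm_mul. Qed.

Lemma torus_perm s t : t \in T -> (pe s * t * (pe s)^-1)%g \in T.
Proof.
move/patternP => tT; apply/patternP => i j ij; rewrite ent_perm_conj tT //.
by rewrite (inj_eq perm_inj).
Qed.

Definition xroot i j (c : F) : G := upper (fun k l => c *+ ((k == i) && (l == j))).

Lemma ent_xroot i j c (a b : 'I_n) : (i < j)%N ->
  ent (xroot i j c) a b = (a == b)%:R + c *+ ((a == i) && (b == j)).
Proof.
move=> ij; rewrite ent_upper; case: ltngtP => [ab|ba|/val_inj<-].
- by rewrite (ltn_ordF ab) add0r.
- rewrite (_ : _ && _ = false) ?addr0 //; apply/negP => /andP[/eqP ai /eqP bj].
  by move: ba; rewrite ai bj ltnNge ltnW.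
rewrite (_ : _ && _ = false) ?addr0 //; apply/negP => /andP[/eqP ai /eqP bj].
by move: ij; rewrite -ai -bj ltnn.
Qed.

Lemma ent_xroot_mul i j c g (a b : 'I_n) : (i < j)%N ->
  ent (xroot i j c * g)%g a b = ent g a b + (a == i)%:R * c * ent g j b.
Proof.
move=> ij; rewrite entM; under eq_bigr => k _ do rewrite ent_xroot // mulrDl.
rewrite big_split /=; congr (_ + _).
  rewrite (bigD1 a) //= eqxx mul1r big1 ?addr0 // => k /negbTE ka.
  by rewrite eq_sym ka mul0r.
rewrite (bigD1 j) //= eqxx andbT big1 ?addr0 => [|k /negbTE->]; last first.
  by rewrite andbF mulr0n mul0r.
by rewrite mulr_natl.
Qed.

Lemma ent_mul_xroot i j c g (a b : 'I_n) : (i < j)%N ->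
  ent (g * xroot i j c)%g a b = ent g a b + ent g a i * c * (b == j)%:R.
Proof.
move=> ij; rewrite entM; under eq_bigr => k _ do rewrite ent_xroot // mulrDr.
rewrite big_split /=; congr (_ + _).
  rewrite (bigD1 b) //= eqxx mulr1 big1 ?addr0 // => k /negbTE kb.
  by rewrite kb mulr0.
rewrite (bigD1 i) //= eqxx big1 ?addr0 => [|k /negbTE->]; last by rewrite mulr0n mulr0.
by rewrite -mulrA mulr_natr.
Qed.

Lemma xroot0 i j : (i < j)%N -> xroot i j 0 = 1%g.
Proof. by move=> ij; apply: entP => a b; rewrite ent_xroot // mul0rn addr0 ent1. Qed.

(** The identity in SL_2 from which all relations between simple reflections
    and the unipotent group are derived. *)
Lemma rank_one i j c : (i < j)%N -> c != 0 -> exists2 t, t \in T &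
  (pe (tperm i j) * xroot i j c =
   xroot i j c^-1%R * t * pe (tperm i j) * xroot i j c^-1%R * pe (tperm i j))%g.
Proof.
move=> ij c0; have nij : i != j by rewrite ltn_ordF.
pose d k := if k == i then - c^-1 else if k == j then c else 1.
have d0 k : d k != 0.
  by rewrite /d; case: ifP => _; rewrite ?oppr_eq0 ?invr_eq0 //; case: ifP; rewrite ?oner_eq0.
exists (diag d); first exact: diag_torus.
have ed (g : G) (a b : 'I_n) : ent (diag d * g)%g a b = d a * ent g a b.
  rewrite entM (bigD1 a) //= big1 ?addr0 => [|k /negbTE ka]; rewrite ent_diag //.
    by rewrite eqxx.
  by rewrite eq_sym ka mul0r.
apply: entP => a b; rewrite -!mulgA !ent_xroot_mul // !ed !ent_perm_mul.
rewrite !ent_mul_perm tpermV !ent_xroot // !(inj_eq perm_inj) /d eqxx.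
rewrite [j == i]eq_sym (negbTE nij) tpermR.
rewrite [tperm i j b == j](canF_eq (@tpermK _ i j)) tpermR.
rewrite ![tperm i j a == i](canF_eq (@tpermK _ i j)) tpermL eqxx /=.
rewrite ![tperm i j a == b](canF_eq (@tpermK _ i j)).
have nji : (j == i) = false by rewrite eq_sym (negbTE nij).
have [->|ai] := eqVneq a i.
  case: (tpermP i j b) => [->|->|/eqP/negbTE bi /eqP/negbTE bj].
  - by rewrite ?eqxx ?(negbTE nij) ?nji /= ?mulr0n ?mulr1n; field.
  - by rewrite ?eqxx ?(negbTE nij) ?nji /= ?mulr0n ?mulr1n; field.
  by rewrite [i == b]eq_sym [j == b]eq_sym ?bi ?bj ?eqxx ?(negbTE nij) ?nji /= ?mulr0n; field.
have [->|aj] := eqVneq a j.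
  case: (tpermP i j b) => [->|->|/eqP/negbTE bi /eqP/negbTE bj].
  - by rewrite ?eqxx ?(negbTE nij) ?nji /= ?mulr0n ?mulr1n; field.
  - by rewrite ?eqxx ?(negbTE nij) ?nji /= ?mulr0n ?mulr1n; field.
  by rewrite [j == b]eq_sym ?bi ?bj ?eqxx /= ?mulr0n; field.
by case: (tpermP i j b) => [->|->|_ _]; rewrite ?(negbTE ai) ?(negbTE aj) /= ?mulr0n; ring.
Qed.
End GL.

(** * The Bruhat decomposition *)

(** The case of the Bruhat decomposition in which the simple reflection s
    shortens w, as an identity between elements of an arbitrary group. *)
Lemma rank_one_step (gT : finGroupType) (s u x t w x' b : gT) :
  (s * s = 1)%g -> (s * x = x' * t * s * x' * s)%g ->
  (s * (u * x * w * b) =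
   s * u * s * x' * w * (w^-1 * t * w * ((s * w)^-1 * x' * (s * w)) * b))%g.
Proof.
move=> ss rk; have sV : (s^-1 = s)%g by apply: (mulgI s); rewrite mulgV ss.
have ssK h : (s * (s * h) = h)%g by rewrite mulgA ss mul1g.
rewrite !invMg sV -!mulgA !mulKVg; congr (_ * (_ * _))%g.
by rewrite -[LHS]ssK [(s * (x * _))%g]mulgA rk -!mulgA.
Qed.

Section GL.
Variables (m : nat) (F : finFieldType).
Local Notation n := m.+1.
Local Notation G := (GLfin m F).
Local Notation B := (borelg m F).
Local Notation U := (unip m F).
Local Notation T := (torus m F).
Local Notation pe := (@permg m F).
Implicit Types (g h b u t : G) (s w : 'S_n) (i j k : 'I_n) (f : 'I_n -> 'I_n -> F).

Lemma ent_perm_conjV w g i j :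
  ent ((pe w)^-1 * g * pe w)%g i j = ent g (w^-1%g i) (w^-1%g j).
Proof. by rewrite ent_mul_perm -perm_eltV ent_perm_mul. Qed.

Lemma torus_permV w t : t \in T -> ((pe w)^-1 * t * pe w)%g \in T.
Proof. by move/(torus_perm w^-1); rewrite perm_eltV invgK. Qed.

(** U is the product of the simple root subgroup and its complement, which the
    simple reflection normalizes. *)
Lemma unip_split u i j : u \in U -> j = i.+1 :> nat ->
  exists u' c, [/\ u' \in U, (pe (tperm i j) * u' * pe (tperm i j))%g \in U &
                   u = (u' * xroot i j c)%g].
Proof.
move=> uU ji; have ij : (i < j)%N by rewrite ji.
have xU c : xroot i j c \in U := upper_unip _.
have xN c : (xroot i j (- c) * xroot i j c = 1)%g.
  apply: entP => a b; rewrite ent_xroot_mul // !ent_xroot // ent1.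
  rewrite [j == i]eq_sym (ltn_ordF ij) andFb mulr0n addr0.
  have [->|] := eqVneq a i; last by rewrite andFb mulr0n !mul0r !addr0.
  by rewrite [j == b]eq_sym; case: (b == j); rewrite ?andbT ?mulr0n ?mulr1n; ring.
pose c := ent u i j; exists (u * xroot i j (- c))%g, c.
have u'U : (u * xroot i j (- c))%g \in U by rewrite groupM.
split=> //; last by rewrite -mulgA xN mulg1.
apply/unipP => a b ba; rewrite -{2}[tperm i j]tpermV perm_eltV ent_perm_conj.
have u'ij : ent (u * xroot i j (- c))%g i j = 0.
  by rewrite ent_mul_xroot // eqxx mulr1 (unipP _ uU i i) // eqxx mul1r subrr.
move/unipP: u'U => u'U.
have [le_ba|lt_ab] := leqP (tperm i j b) (tperm i j a).
  by rewrite u'U // (inj_eq perm_inj).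
have [ai bj] : tperm i j a = i /\ tperm i j b = j.
  have neq k l : k <> l -> (k : nat) <> l by move=> kl /val_inj.
  move: lt_ab ba; case: (tpermP i j a) => [->|->|/neq ai /neq aj];
    case: (tpermP i j b) => [->|->|/neq bi /neq bj] // ? ?; exfalso; lia.
rewrite ai bj u'ij -[a](tpermK i j) ai -[b](tpermK i j) bj tpermL tpermR.
by rewrite eq_sym (ltn_ordF ij).
Qed.

(** GL_n is generated by B and the simple reflections: in an LUP decomposition
    the lower triangular factor is conjugate to an upper triangular one under
    the order-reversing permutation. *)
Lemma GL_ind (Q : G -> Prop) : Q 1%g ->
  (forall b g, b \in B -> Q g -> Q (b * g)%g) ->
  (forall i j g, j = i.+1 :> nat -> Q g -> Q (pe (tperm i j) * g)%g) ->
  forall g, Q g.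
Proof.
move=> Q1 QB Qs g; pose A : 'M[F]_n := GLval g.
have Qp w h : Q h -> Q (pe w * h)%g.
  move=> Qh; elim/(@perm_sort_ind n predT): w => [w /incr_predT->|w i j ji _ _ Qw].
    by rewrite perm_elt1 mul1g.
  by rewrite -[w](mulKg (tperm i j)) tpermV perm_eltM -mulgA; apply: Qs.
have /is_perm_mxP[s Ps] := cormen_lup_perm A.
have := cormen_lup_correct A; case lupE: (cormen_lup A) Ps => [[P L] V] /= Ps.
have L1 := cormen_lup_detL A; have Ll := @cormen_lup_lower _ _ A.
have Vu := @cormen_lup_upper _ _ A; rewrite lupE /= in L1 Ll Vu.
rewrite Ps => LUP; have Lu : L \in unitmx by rewrite unitmxE L1 unitr1.
have Vunit : V \in unitmx.
  have := unitmx_mul L V; rewrite -[L *m V]/(L * V) -LUP.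
  by rewrite -[_ * A]/(_ *m A) unitmx_mul unitmx_perm (GL_unitmx g : A \in unitmx) Lu.
have gE : (pe s * g = mkGL L * mkGL V)%g.
  apply: val_inj; change (perm_mx s * A = GLval (mkGL L) * GLval (mkGL V)).
  by rewrite !mkGLE.
(* Conjugation by w0 turns the lower triangular factor into an upper triangular
   one. *)
pose w0 : 'S_n := perm (@rev_ord_inj n).
have -> : g = ((pe s^-1) * (pe w0^-1 * (pe w0 * mkGL L * (pe w0)^-1) * pe w0 * mkGL V))%g.
  by rewrite !perm_eltV !mulgA !mulgKV -mulgA -gE mulKg.
have VB : mkGL V \in B by apply/borelP => i j ji; rewrite /ent mkGLE // Vu.
apply: (Qp); rewrite -!mulgA; apply: (Qp).
rewrite (_ : _ * _ = pe w0 * mkGL L * (pe w0)^-1 * (pe w0 * (mkGL V * 1)))%g; last first.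
  by rewrite mulg1 !mulgA.
apply: (QB); last by apply: (Qp); apply: (QB).
apply/borelP => i j ji; rewrite ent_perm_conj /ent mkGLE // Ll.
  by rewrite (inj_eq perm_inj) -val_eqE gtn_eqF.
by rewrite !permE /= leq_sub2l // ltnW.
Qed.

Lemma xroot_perm w i j c : (i < j)%N -> (w i < w j)%N ->
  ((pe w)^-1 * xroot i j c * pe w)%g \in B.
Proof.
move=> ij wij; apply/borelP => a b ba; rewrite ent_perm_conjV ent_xroot // (inj_eq perm_inj).
rewrite eq_sym (ltn_ordF ba) add0r; case: eqP => [ai|//]; case: eqP => [bj|//].
by move: ba; rewrite -[a](permKV w) -[b](permKV w) ai bj ltnNge ltnW.
Qed.

(** The set of all products u w b is stable under a simple reflection s.  It
    passes the part of u complementary to the simple root subgroup; the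
    remaining root element is absorbed by B if w keeps the root positive, and
    is treated by the rank one identity otherwise. *)
Lemma bruhat g : exists u w b, [/\ u \in U, b \in B & g = (u * pe w * b)%g].
Proof.
elim/GL_ind: g => [|b g bB [u [w [b' [uU b'B ->]]]]|i j g ji [u [w [b [uU bB ->]]]]].
- by exists 1%g, 1%g, 1%g; rewrite !group1 perm_elt1 !mulg1.
- have buB : (b * u)%g \in B by rewrite groupM // (subsetP (unip_borel _ _)).
  have [u' [t [u'U tT e]]] := borel_factor buB.
  exists u', w, ((pe w)^-1 * t * pe w * b')%g.
  rewrite u'U groupM // ?(subsetP (torus_borel _ _)) ?torus_permV //; split=> //.
  by rewrite !mulgA e mulgK.
have [u' [c [u'U su'U ->]]] := unip_split uU ji.
set s := tperm i j in su'U *; have ij : (i < j)%N by rewrite ji.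
have ss : (pe s * pe s = 1)%g by rewrite -perm_eltM tperm2 perm_elt1.
have ssK h : (pe s * (pe s * h) = h)%g by rewrite mulgA ss mul1g.
have [wij|wji] := ltnP (w i) (w j).
  exists (pe s * u' * pe s)%g, (s * w)%g, ((pe w)^-1 * xroot i j c * pe w * b)%g.
  rewrite su'U groupM ?xroot_perm //; split=> //.
  by rewrite perm_eltM -!mulgA !ssK mulKVg.
have [->|c0] := eqVneq c 0.
  exists (pe s * u' * pe s)%g, (s * w)%g, b; split=> //.
  by rewrite xroot0 // mulg1 perm_eltM -!mulgA ssK.
have swij : ((s * w)%g i < (s * w)%g j)%N.
  rewrite !permM tpermL tpermR ltn_neqAle wji andbT val_eqE (inj_eq perm_inj).
  by rewrite eq_sym (ltn_ordF ij).
have [t tT rk] := rank_one ij c0; rewrite -/s in rk.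
pose b1 := ((pe (s * w))^-1 * xroot i j c^-1%R * pe (s * w))%g.
have b1B : b1 \in B by apply: xroot_perm.
exists (pe s * u' * pe s * xroot i j c^-1%R)%g, w, ((pe w)^-1 * t * pe w * b1 * b)%g.
have tB : ((pe w)^-1 * t * pe w)%g \in B.
  by rewrite (subsetP (torus_borel _ _)) ?torus_permV.
split; [by rewrite (groupM su'U) ?upper_unip | by rewrite groupM // (groupM tB) |].
by rewrite /b1 perm_eltM; apply: rank_one_step.
Qed.

(** The diagonal entry 1 of u in row k becomes the entry in row s k and column
    w k of an upper triangular matrix, so that s k <= w k. *)
Lemma bruhat_unique s w u : u \in U -> ((pe s)^-1 * u * pe w)%g \in B -> s = w.
Proof.
move=> /unipP uU /borelP sw; apply: perm_le_eq => k; rewrite leqNgt.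
apply/negP => wsk; have := sw _ _ wsk.
rewrite ent_mul_perm -perm_eltV ent_perm_mul !permK uU // eqxx => /eqP.
by rewrite oner_eq0.
Qed.

End GL.

(** * Indices of parabolic subgroups *)

Section GL.
Variables (m : nat) (F : finFieldType).
Local Notation n := m.+1.
Local Notation G := (GLfin m F).
Local Notation B := (borelg m F).
Local Notation U := (unip m F).
Local Notation pe := (@permg m F).
Local Notation q := #|F|.
Implicit Types (g h b u t : G) (s w : 'S_n) (i j k : 'I_n) (f : 'I_n -> 'I_n -> F).

(** The stabilizer in U of the coset of B represented by w. *)
Definition unip_stab w : {set G} := [set u in U | ((pe w)^-1 * u * pe w)%g \in B].

Lemma in_unip_stab w u :
  (u \in unip_stab w) = (u \in U) && (((pe w)^-1 * u * pe w)%g \in B).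
Proof. exact: in_set. Qed.

Lemma unip_stabP w u : reflect
  (u \in U /\ forall i j, (i < j)%N -> (w j < w i)%N -> ent u i j = 0)
  (u \in unip_stab w).
Proof.
rewrite [X in reflect _ X]in_set; apply: (iffP andP) => -[uU h]; split=> //.
  move/borelP: h => h i j ij wji; have := h _ _ wji.
  by rewrite ent_perm_conjV !permK.
apply/borelP => i j ji; rewrite ent_perm_conjV.
case: (ltngtP (w^-1%g i) (w^-1%g j)) => [lt_ij|lt_ji|/val_inj eq_ij].
- by apply: h => //; rewrite !permKV.
- by rewrite (unipP _ uU) ?(ltnW lt_ji) // eq_sym (ltn_ordF lt_ji).
by move: ji; rewrite -[i](permKV w) eq_ij permKV ltnn.
Qed.

Definition coinversions w := (\sum_(i < n) \sum_(j < n) ((i < j) && (w i < w j)))%N.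

Lemma inversions_coinversions w : (inversions w + coinversions w = coinversions 1)%N.
Proof.
rewrite /inversions /coinversions -big_split; apply: eq_bigr => i _; rewrite -big_split.
apply: eq_bigr => j _ /=; rewrite !perm1; case: ltngtP => //= ij.
case: ltngtP => // /val_inj/perm_inj e; by rewrite e ltnn in ij.
Qed.

Lemma card_unip_stab w : #|unip_stab w| = (q ^ coinversions w)%N.
Proof.
pose D := [set p : 'I_n * 'I_n | (p.1 < p.2)%N && (w p.1 < w p.2)%N].
have -> : coinversions w = #|D|.
  rewrite /coinversions pair_bigA /= -sum1_card [RHS]big_mkcond /=.
  by apply: eq_bigr => p _; rewrite inE; case: andP.
rewrite -(card_pffun_on (0 : F) D (predT : pred F)).
have -> : unip_stab w = [set upper (fun i j => f (i, j)) |
                          f : {ffun 'I_n * 'I_n -> F} in pffun_on 0 D predT].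
  apply/setP => u; apply/unip_stabP/imsetP => [[uU u0]|[f fD ->]].
    exists [ffun p => if p \in D then ent u p.1 p.2 else 0].
      apply/pffun_onP; split=> //; apply/supportP => p pD.
      by rewrite ffunE (negbTE pD).
    apply: entP => i j; rewrite ent_upper ffunE inE /=; case: leqP => ij.
      exact: (unipP _ uU).
    case: ltnP => // wji; apply: u0 => //; rewrite ltn_neqAle wji andbT val_eqE.
    by rewrite (inj_eq perm_inj) eq_sym (ltn_ordF ij).
  split=> [|i j ij wji]; first exact: upper_unip.
  rewrite ent_upper ij; have [/supportP/(_ (i, j)) -> //] := pffun_onP fD.
  by rewrite inE /= ij ltnNge ltnW.
rewrite card_in_imset // => f f' /pffun_onP[/supportP f0 _] /pffun_onP[/supportP f'0 _] e.
apply/ffunP => -[i j]; case: (boolP ((i, j) \in D)) => [|ijD]; last by rewrite f0 ?f'0.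
rewrite inE /= => /andP[ij _]; have := congr1 (fun g => ent g i j) e.
by rewrite !ent_upper ij.
Qed.

Lemma card_unip : #|U| = (q ^ coinversions 1)%N.
Proof.
rewrite -card_unip_stab; apply: eq_card => u; apply/idP/unip_stabP => [|[]//] uU.
by split=> // i j ij; rewrite !perm1 ltnNge ltnW.
Qed.

Definition cell w : {set G} := (U * [set pe w] * B)%g.

Lemma cellP w g : reflect (exists u b, [/\ u \in U, b \in B & g = (u * pe w * b)%g])
  (g \in cell w).
Proof.
apply: (iffP mulsgP) => [[_ b /mulsgP[u _ uU /set1P-> ->] bB ->]|[u [b [uU bB ->]]]].
  by exists u, b.
by exists (u * pe w)%g b => //; apply/mulsgP; exists u (pe w); rewrite ?set11.
Qed.

(** U acts transitively on the cosets of B in the cell. *)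
Lemma card_cell w : #|cell w| = (#|B| * q ^ inversions w)%N.
Proof.
have q0 : (0 < q)%N by apply/card_gt0P; exists 0.
have := mul_cardG (unip_group m F) (borel_group m F :^ (pe w)^-1)%G.
rewrite cardJg /=.
have -> : U :&: (B :^ (pe w)^-1)%g = unip_stab w.
  by apply/setP => u; rewrite in_setI [RHS]in_set mem_conjg invgK conjgE mulgA.
have -> : (U * B :^ (pe w)^-1)%g = (cell w :* (pe w)^-1)%g.
  by rewrite conjsgE invgK /cell !mulgA.
rewrite card_rcoset card_unip card_unip_stab -(inversions_coinversions w) expnD mulnC => e.
by apply/eqP; rewrite -(eqn_pmul2r (_ : 0 < q ^ coinversions w)%N) ?expn_gt0 ?q0 // -e mulnA.
Qed.

(** P is the disjoint union of the Bruhat cells of its permutation matrices. *)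
Lemma card_parabolic (P : {group G}) : B \subset P ->
  #|P| = (#|B| * \sum_(w | pe w \in P) q ^ inversions w)%N.
Proof.
move=> /subsetP BP; have UP := subset_trans (unip_borel m F) (introT subsetP BP).
have cell_unique s w g : g \in cell s -> g \in cell w -> s = w.
  move=> /cellP[u [b [uU bB ->]]] /cellP[u' [b' [u'U b'B e]]].
  apply: (@bruhat_unique m F s w (u^-1 * u')%g); first by rewrite groupM ?groupV.
  rewrite (_ : (_ * _ * _)%g = (b * b'^-1)%g) ?groupM ?groupV //.
  apply: (mulIg b'); rewrite mulgKV -!mulgA [(u' * _)%g]mulgA -e.
  by rewrite -!mulgA mulKg mulKg.
have cellP_in w g : g \in cell w -> (g \in P) = (pe w \in P).
  case/cellP=> u [b [uU bB ->]].
  by rewrite (groupMr _ (BP _ bB)) (groupMl _ (subsetP UP _ uU)).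
rewrite big_distrr -sum1_card /=.
transitivity (\sum_(g in P) \sum_(w | pe w \in P) (g \in cell w : nat))%N.
  apply: eq_bigr => g gP; have [u [w [b [uU bB e]]]] := bruhat g.
  have gw : g \in cell w by apply/cellP; exists u, b.
  rewrite (bigD1 w) -?(cellP_in w g) //= gw big1 // => s /andP[_ sw].
  by case: (boolP (g \in cell s)) => // gs; rewrite (cell_unique _ _ _ gs gw) eqxx in sw.
rewrite exchange_big /=; apply: eq_bigr => w wP; rewrite -card_cell -sum1_card.
rewrite -big_mkcondr; apply: eq_bigl => g; apply: andb_idl => gw.
by rewrite (cellP_in w).
Qed.

(** The simple reflections in P, as a set of positions. *)
Definition parabolic_joins (P : {set G}) : pred nat := fun l =>
  [exists i : 'I_n, exists j : 'I_n,
    [&& j == l :> nat, j == i.+1 :> nat & pe (tperm i j) \in P]].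

Lemma parabolic_joinsE (P : {set G}) i j : j = i.+1 :> nat ->
  parabolic_joins P j = (pe (tperm i j) \in P).
Proof.
move=> ji; apply/existsP/idP => [[i' /existsP[j' /and3P[/eqP/val_inj-> /eqP ji' +]]]|sP].
  by have -> : i' = i by apply: val_inj; move: ji'; rewrite /= ji => -[].
by exists i; apply/existsP; exists j; rewrite eqxx ji eqxx.
Qed.

(** For a simple root element x, the rank one identity writes s x w as a product
    of elements of P, because s w keeps the simple root positive. *)
Lemma parabolic_descent (P : {group G}) w i j : B \subset P -> pe w \in P ->
  j = i.+1 :> nat -> (w j < w i)%N -> pe (tperm i j) \in P.
Proof.
move=> /subsetP BP wP ji wji; have ij : (i < j)%N by rewrite ji.
have [t tT] := rank_one ij (oner_neq0 F); rewrite invr1 => rk.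
set s := tperm i j in rk *; set x := xroot i j 1 in rk *.
have ss : (pe s * pe s = 1)%g by rewrite -perm_eltM tperm2 perm_elt1.
have xP : x \in P by apply/(BP x)/(subsetP (unip_borel m F))/upper_unip.
have tP : t \in P by apply/(BP t)/(subsetP (torus_borel m F)).
have swij : ((s * w)%g i < (s * w)%g j)%N by rewrite !permM tpermL tpermR.
have := BP _ (xroot_perm 1 ij swij); rewrite -/x perm_eltM invMg => cP.
suff : (pe s * x * pe w)%g \in P by rewrite groupMr // groupMr.
rewrite rk (_ : (_ * _)%g =
  (x * t * pe w * ((pe w)^-1 * (pe s)^-1 * x * (pe s * pe w)))%g).
  by rewrite (groupM _ cP) // (groupM _ wP) // groupM.
rewrite -!mulgA mulKVg; do 2 congr (_ * _)%g.
rewrite (_ : (pe s)^-1 = pe s)%g //.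
by apply: (mulgI (pe s)); rewrite mulgV ss.
Qed.

(** Sorting a permutation of P uses simple reflections of P only, by
    parabolic_descent. *)
Lemma parabolic_perm (P : {group G}) w : B \subset P ->
  (pe w \in P) = (w \in young n (parabolic_joins P)).
Proof.
move=> BP; set J := parabolic_joins P; apply/idP/idP.
  elim/(@perm_sort_ind n predT): w => [w /incr_predT-> _|w i j ji _ wji IH wP].
    exact: group1.
  have sP := parabolic_descent BP wP ji wji.
  have sJ : tperm i j \in young n J by rewrite tperm_young // /J (parabolic_joinsE _ ji).
  rewrite -[w](mulKg (tperm i j)) tpermV groupM // IH //.
  by rewrite perm_eltM groupM.
move: w; apply: young_ind => [|w i j ji Jj wP]; first by rewrite perm_elt1 group1.
by rewrite perm_eltM groupM // -(parabolic_joinsE _ ji).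
Qed.

(** The index of the standard parabolic subgroup with blocks J, see
    parabolic_index. *)
Definition pindex (J : pred nat) := (\sum_(w : 'S_n | incr J w) q ^ inversions w)%N.

Lemma pindexE (J : pred nat) :
  (pindex J * \prod_(i < n) qint q (block_pos J i) = \prod_(i < n) qint q i.+1)%N.
Proof.
rewrite mulnC -sum_young -sum_young_incr.
have pos_all (l : nat) : block_pos predT l = l.+1 by elim: l => //= l ->.
under [RHS]eq_bigr => i _ do rewrite -pos_all.
rewrite -sum_young; apply: eq_bigl => w; symmetry; apply/youngP => i.
by rewrite !blk_predT.
Qed.

Lemma parabolic_index (P : {group G}) : B \subset P ->
  #|[set: G] : P|%g = pindex (parabolic_joins P).
Proof.
move=> BP; have q0 : (0 < q)%N by apply/card_gt0P; exists 0.
have GE := card_parabolic (subsetT B : B \subset [set: G]%G).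
rewrite -divgS ?subsetT // GE (card_parabolic BP).
have -> : (\sum_(w | pe w \in P) q ^ inversions w)%N =
          (\sum_(w in young n (parabolic_joins P)) q ^ inversions w)%N.
  by apply: eq_bigl => w; apply: parabolic_perm.
rewrite (eq_bigl predT) => [|w]; last by rewrite inE.
rewrite (sum_young_incr _ (parabolic_joins P)) mulnA mulKn // muln_gt0 cardG_gt0 /=.
by rewrite (bigD1 1%g) ?group1 // ltn_addr // expn_gt0 q0.
Qed.

Lemma eq_pindex (J J' : pred nat) :
  (forall k : nat, (0 < k < n)%N -> J k = J' k) -> pindex J = pindex J'.
Proof.
move=> JJ'; apply: eq_bigl => w; apply/incrP/incrP => h i j ji Jj;
  by apply: h; rewrite // ?JJ' // -?JJ' // ltn_ord ji.
Qed.

(** The block upper triangular matrices for the blocks of J. *)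
Lemma parabolic_exists (J : pred nat) :
  exists2 P : {group G}, B \subset P & #|[set: G] : P|%g = pindex J.
Proof.
pose r (i j : 'I_n) := (blk J i <= blk J j)%N.
have rr : reflexive r by move=> i; rewrite /r.
have rt : transitive r by move=> i j k; rewrite /r; apply: leq_trans.
pose P := Group (@pattern_group_set m F r rr rt); have BP : B \subset P.
  apply/subsetP => b /borelP bB; apply/patternP => i j.
  by rewrite -ltnNge => /ltn_of_blk /bB.
exists P => //; rewrite parabolic_index //; apply: eq_pindex => k /andP[k0 kn].
have k1n : (k.-1 < n)%N by apply: leq_ltn_trans (leq_pred k) kn.
pose i := Ordinal k1n; pose j := Ordinal kn.
have ji : j = i.+1 :> nat by rewrite /= prednK.
change (parabolic_joins P j = J j); rewrite (parabolic_joinsE _ ji).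
apply/patternP/idP => [/(_ j i)|Jj a c].
  rewrite ent_perm tpermR eqxx => rji; rewrite ji -blkS -ji eqn_leq.
  rewrite blk_mono ?ji ?leqnSn // -ji.
  by apply: contraT => nr; have /eqP := rji nr; rewrite oner_eq0.
move: Jj; rewrite ji -blkS -ji => /eqP bij; rewrite ent_perm /r.
by case: tpermP => [->|->|_ _]; case: eqP => // <-; rewrite ?bij leqnn.
Qed.

End GL.

(** * The group algebra and the Steinberg lattice *)

Section GroupAlgebra.
Variables (R : comPzRingType) (gT : finGroupType).
Local Notation RG := (galg R gT).
Implicit Types (a x y : RG) (g h k : gT) (r : R).

Definition gscale r x : RG := [ffun g => r * x g].

Lemma gmulE a x g : (a * x) g = \sum_h a h * x (h^-1 * g)%g.
Proof. by rewrite ffunE. Qed.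

Lemma gaddE x y g : (x + y) g = x g + y g. Proof. by rewrite ffunE. Qed.
Lemma goppE x g : (- x) g = - x g. Proof. by rewrite ffunE. Qed.
Lemma gsumE (I : Type) (s : seq I) (P : pred I) (f : I -> RG) g :
  (\sum_(i <- s | P i) f i) g = \sum_(i <- s | P i) f i g.
Proof.
by elim/big_rec2: _ => [|i y1 y2 _ <-]; rewrite ffunE.
Qed.

Lemma gelt_mulE g x h : (gelt R g * x) h = x (g^-1 * h)%g.
Proof.
rewrite gmulE (bigD1 g) //= ffunE eqxx mul1r big1 ?addr0 // => k /negbTE kg.
by rewrite ffunE kg mul0r.
Qed.

Lemma mul_geltE g x h : (x * gelt R g) h = x (h * g^-1)%g.
Proof.
rewrite gmulE (bigD1 (h * g^-1)%g) //= ffunE invMg invgK mulgKV eqxx mulr1.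
rewrite big1 ?addr0 // => k kg; rewrite ffunE (_ : _ == g = false) ?mulr0 //.
by apply: contraNF kg => /eqP <-; rewrite invMg invgK mulKVg.
Qed.

Lemma geltM g h : gelt R (g * h)%g = gelt R g * gelt R h.
Proof.
apply/ffunP => k; rewrite gelt_mulE !ffunE -(inj_eq (mulgI g^-1%g)) mulKg //.
Qed.

Lemma gelt_conj g h x :
  gelt R g * (gelt R h * x) = gelt R h * (gelt R (h^-1 * g * h)%g * x).
Proof. by rewrite !mulrA -!geltM !mulgA mulgV mul1g. Qed.

Lemma gelt_mul3 g h k x :
  gelt R g * (gelt R h * (gelt R k * x)) = gelt R (g * h * k)%g * x.
Proof. by rewrite !mulrA -!geltM. Qed.

Lemma gelt_involution g h k x : (g * g = 1)%g ->
  gelt R g * (gelt R (h * k)%g * x) =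
  gelt R (g * h * g)%g * (gelt R g * (gelt R k * x)).
Proof.
move=> gg; rewrite !mulrA -!geltM; congr (gelt R _ * _).
by rewrite -!mulgA [in RHS](mulgA g g) gg mul1g.
Qed.

Lemma gelt1 : gelt R 1%g = 1 :> RG. Proof. by []. Qed.

Lemma gscaleAl r a x : gscale r a * x = gscale r (a * x).
Proof.
apply/ffunP => g; rewrite [LHS]gmulE [RHS]ffunE gmulE mulr_sumr.
apply: eq_bigr => h _.
by rewrite ffunE mulrA.
Qed.

Lemma gscaleAr r a x : a * gscale r x = gscale r (a * x).
Proof.
apply/ffunP => g; rewrite [LHS]gmulE [RHS]ffunE gmulE mulr_sumr.
apply: eq_bigr => h _.
by rewrite ffunE mulrCA.
Qed.

Lemma gscaleA r r' x : gscale r (gscale r' x) = gscale (r * r') x.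
Proof. by apply/ffunP => g; rewrite !ffunE mulrA. Qed.

Lemma gscale1 x : gscale 1 x = x.
Proof. by apply/ffunP => g; rewrite ffunE mul1r. Qed.

Lemma gscale0l x : gscale 0 x = 0.
Proof. by apply/ffunP => g; rewrite [LHS]ffunE mul0r [RHS]ffunE. Qed.

Lemma gscale0r r : gscale r 0 = 0.
Proof. by rewrite -[X in gscale r X](gscale0l 0) gscaleA mulr0 gscale0l. Qed.

Lemma gscaleDr r x y : gscale r (x + y) = gscale r x + gscale r y.
Proof. by apply/ffunP => g; rewrite !ffunE mulrDr. Qed.

Lemma gscale_sumr (I : Type) (s : seq I) (P : pred I) r (f : I -> RG) :
  gscale r (\sum_(i <- s | P i) f i) = \sum_(i <- s | P i) gscale r (f i).
Proof.
apply/ffunP => g; rewrite ffunE !gsumE mulr_sumr; apply: eq_bigr => i _.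
by rewrite ffunE.
Qed.

Lemma gscaleDl r r' x : gscale (r + r') x = gscale r x + gscale r' x.
Proof. by apply/ffunP => g; rewrite !ffunE mulrDl. Qed.

Lemma gscale_suml (I : Type) (s : seq I) (P : pred I) (f : I -> R) x :
  gscale (\sum_(i <- s | P i) f i) x = \sum_(i <- s | P i) gscale (f i) x.
Proof.
by apply/ffunP => g; rewrite gsumE ffunE mulr_suml; apply: eq_bigr => i _; rewrite ffunE.
Qed.

Lemma gscaleE r x : gscale r x = gscale r 1 * x.
Proof. by rewrite gscaleAl mul1r. Qed.

Lemma galg_sum a : a = \sum_g gscale (a g) (gelt R g).
Proof.
apply/ffunP => h; rewrite gsumE (bigD1 h) //= !ffunE eqxx mulr1 big1 ?addr0 //.
by move=> g /negbTE gh; rewrite !ffunE eq_sym gh mulr0.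
Qed.

Lemma gscale_nat (k : nat) x : gscale k%:R x = x *+ k.
Proof. by apply/ffunP => g; rewrite ffunE ffunMnE mulr_natl. Qed.

(** The bilinear form for which the group elements are orthonormal. *)
Definition gform x y : R := \sum_g x g * y g.

Lemma gformC x y : gform x y = gform y x.
Proof. by apply: eq_bigr => g _; rewrite mulrC. Qed.

Lemma gform_scale r x y : gform (gscale r x) y = r * gform x y.
Proof. by rewrite mulr_sumr; apply: eq_bigr => g _; rewrite ffunE mulrA. Qed.

Lemma gform_suml (I : Type) (s : seq I) (P : pred I) (f : I -> RG) y :
  gform (\sum_(i <- s | P i) f i) y = \sum_(i <- s | P i) gform (f i) y.
Proof.
rewrite exchange_big; apply: eq_bigr => g _; rewrite gsumE mulr_suml //.
Qed.

Lemma gform_gelt g x y : gform (gelt R g * x) y = gform x (gelt R g^-1%g * y).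
Proof.
rewrite /gform (reindex_inj (mulgI g)) /=; apply: eq_bigr => h _.
by rewrite !gelt_mulE mulKg invgK.
Qed.

(** The anti-involution adjoint to the form. *)
Definition gadj a : RG := [ffun g => a g^-1%g].

Lemma gform_mul a x y : gform (a * x) y = gform x (gadj a * y).
Proof.
rewrite [a]galg_sum mulr_suml gform_suml.
have -> : gadj (\sum_g gscale (a g) (gelt R g)) =
          \sum_g gscale (a g) (gelt R g^-1%g).
  apply/ffunP => h; rewrite ffunE !gsumE; apply: eq_bigr => g _.
  by rewrite !ffunE -(inj_eq invg_inj) invgK.
rewrite mulr_suml gformC gform_suml; apply: eq_bigr => g _.
by rewrite !gscaleAl gform_scale gform_gelt gform_scale gformC.
Qed.

End GroupAlgebra.

Lemma mul_conj_cancel (gT : finGroupType) (x g h : gT) :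
  (x^-1 * g * x * (x^-1 * (g^-1 * h)) = x^-1 * h)%g.
Proof. by rewrite -!mulgA !mulKVg. Qed.

Lemma invM_mul (gT : finGroupType) (x y g : gT) :
  ((x * y)^-1 * g = y^-1 * (x^-1 * g))%g.
Proof. by rewrite invMg mulgA. Qed.

(** The computation of steinberg_simple_root in an arbitrary ring; y stands for
    the sum over those w that keep the simple root positive. *)
Lemma rank_one_ring (A : pzRingType) (S X X' T y : A) :
  S * S = 1 -> S * X = X' * T * S * X' * S ->
  X * y = y -> X' * y = y -> S * (T * (S * y)) = y ->
  S * (X * (y - S * y)) = X' * (y - S * y) - (y - S * y).
Proof.
move=> SS rk Xy X'y STS; have SSK z : S * (S * z) = z by rewrite mulrA SS mul1r.
have Ty : T * (S * y) = S * y by rewrite -[LHS]SSK STS.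
rewrite !mulrBr Xy X'y [S * (X * (S * y))]mulrA rk -!mulrA SSK X'y Ty.
by rewrite opprB [RHS]addrC addrA subrK.
Qed.

Section Steinberg.
Variables (m : nat) (F : finFieldType) (R : idomainType).
Local Notation n := m.+1.
Local Notation G := (GLfin m F).
Local Notation B := (borelg m F).
Local Notation U := (unip m F).
Local Notation T := (torus m F).
Local Notation pe := (@permg m F).
Local Notation RG := (galg R G).

Definition steinberg_gen : RG := steinberg_elt n F R.
Local Notation eps := steinberg_gen.
Local Notation act g := (gelt R g).
Implicit Types (g h b u t v : G) (s w : 'S_n) (i j k : 'I_n) (x y a : RG).

Lemma gsum_borelE g : gsum R B g = (g \in B)%:R.
Proof.
rewrite gsumE; case: (boolP (g \in B)) => gB.
  rewrite (bigD1 g) //= ffunE eqxx big1 ?addr0 // => h /andP[_ /negbTE hg].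
  by rewrite ffunE eq_sym hg.
rewrite big1 // => h hB; rewrite ffunE; case: eqP => // gh.
by rewrite gh hB in gB.
Qed.

(** The indicator function of the coset of B represented by s. *)
Definition coset_fun s g : R := ((pe s)^-1 * g \in B)%g%:R.

Lemma coset_fun_left s g h : ((pe s)^-1 * g * pe s)%g \in B ->
  coset_fun s (g^-1 * h)%g = coset_fun s h.
Proof.
by move=> gB; rewrite /coset_fun -(groupMl _ gB) mul_conj_cancel.
Qed.

Lemma coset_fun_right s g b : b \in B -> coset_fun s (g * b)%g = coset_fun s g.
Proof. by move=> bB; rewrite /coset_fun mulgA groupMr. Qed.

Lemma coset_fun_mul s w g : coset_fun (s * w)%g g = coset_fun w ((pe s)^-1 * g)%g.
Proof. by rewrite /coset_fun perm_eltM invM_mul. Qed.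

Lemma coset_fun_unip s w u : u \in U -> s != w -> coset_fun s (u * pe w)%g = 0.
Proof.
move=> uU sw; rewrite /coset_fun mulgA; case: (boolP (_ \in B)) => //.
by move/(bruhat_unique uU)/eqP; rewrite (negbTE sw).
Qed.

Lemma coset_fun_stab w u : u \in U ->
  coset_fun w (u * pe w)%g = (u \in unip_stab F w)%:R.
Proof. by move=> uU; rewrite /coset_fun mulgA [in RHS]in_set uU. Qed.

Definition cell_sum (P : pred 'S_n) : RG :=
  [ffun g => \sum_(s : 'S_n | P s) (-1) ^+ s * coset_fun s g].

Lemma cell_sumE P g : cell_sum P g = \sum_(s : 'S_n | P s) (-1) ^+ s * coset_fun s g.
Proof. exact: ffunE. Qed.

Lemma steinberg_eltE : eps = cell_sum predT.
Proof.
apply/ffunP => g; rewrite gsumE cell_sumE; apply: eq_bigr => s _.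
by rewrite !mulr_sign; case: (odd_perm s); rewrite ?goppE gelt_mulE gsum_borelE.
Qed.

Lemma cell_sum_fixed (P : pred 'S_n) g :
  (forall s, P s -> ((pe s)^-1 * g * pe s)%g \in B) -> act g * cell_sum P = cell_sum P.
Proof.
move=> fixP; apply/ffunP => h; rewrite gelt_mulE !cell_sumE; apply: eq_bigr => s Ps.
by rewrite coset_fun_left ?fixP.
Qed.

Lemma steinberg_right g b : b \in B -> eps (g * b)%g = eps g.
Proof.
move=> bB; rewrite steinberg_eltE !cell_sumE; apply: eq_bigr => s _.
by rewrite coset_fun_right.
Qed.

Lemma steinberg_torus t : t \in T -> act t * eps = eps.
Proof.
move=> tT; rewrite steinberg_eltE cell_sum_fixed // => s _.
by rewrite (subsetP (torus_borel _ _)) ?torus_permV.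
Qed.

Lemma steinberg_unip u w : u \in U ->
  eps (u * pe w)%g = (-1) ^+ w * (u \in unip_stab F w)%:R.
Proof.
move=> uU; rewrite steinberg_eltE cell_sumE (bigD1 w) //= coset_fun_stab //.
by rewrite big1 ?addr0 // => s sw; rewrite coset_fun_unip ?mulr0.
Qed.

Section SimpleReflection.
Variables i j : 'I_n.
Hypothesis ij : (i < j)%N.
Let s := tperm i j.
Let y := cell_sum (fun w => (w i < w j)%N).

(** The permutations w and s w come in pairs, exactly one of which keeps the
    root positive. *)
Lemma steinberg_half : eps = y - act (pe s) * y.
Proof.
have sV : ((pe s)^-1 = pe s)%g by rewrite -perm_eltV tpermV.
apply/ffunP => g; rewrite gaddE goppE gelt_mulE steinberg_eltE !cell_sumE.
rewrite (bigID (fun w : 'S_n => w i < w j)%N) /=; congr (_ + _).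
rewrite (reindex_inj (mulgI s)) -sumrN; apply: eq_big => [w|w _].
  rewrite !permM tpermL tpermR -leqNgt leq_eqVlt val_eqE (inj_eq perm_inj).
  by rewrite (ltn_ordF ij).
rewrite odd_permM odd_tperm (ltn_ordF ij) -mulNr signr_addb mulN1r.
by rewrite coset_fun_mul sV.
Qed.

Lemma steinberg_simple : act (pe s) * eps = - eps.
Proof.
have ss : act (pe s) * (act (pe s) * y) = y.
  by rewrite mulrA -geltM -perm_eltM tperm2 perm_elt1 gelt1 mul1r.
by rewrite steinberg_half mulrBr ss opprB.
Qed.

(** The relation by which translates of the generator are rewritten inside
    their U-span. *)
Lemma steinberg_simple_root c : c != 0 ->
  act (pe s) * (act (xroot i j c) * eps) = act (xroot i j c^-1) * eps - eps.
Proof.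
move=> c0; have [t tT rk] := rank_one ij c0; rewrite -/s in rk.
have ss : act (pe s) * act (pe s) = 1.
  by rewrite -geltM -perm_eltM tperm2 perm_elt1.
have yx c' : act (xroot i j c') * y = y.
  by apply: cell_sum_fixed => w wij; apply: xroot_perm.
have yt t' : t' \in T -> act t' * y = y.
  move=> t'T; apply: cell_sum_fixed => w _.
  by rewrite (subsetP (torus_borel _ _)) ?torus_permV.
have rk' : act (pe s) * act (xroot i j c) =
    act (xroot i j c^-1) * act t * act (pe s) * act (xroot i j c^-1) * act (pe s).
  by rewrite -!geltM rk.
have sts : act (pe s) * (act t * (act (pe s) * y)) = y.
  rewrite gelt_mul3; apply: yt; have := torus_perm s tT.
  by rewrite -perm_eltV tpermV.
rewrite steinberg_half.
exact: (@rank_one_ring RG (act (pe s)) (act (xroot i j c)) (act (xroot i j c^-1))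
  (act t) y ss rk' (yx c) (yx c^-1) sts).
Qed.
End SimpleReflection.

Definition unip_supp a := forall g, g \notin U -> a g = 0.
Definition unip_span x := exists2 a, unip_supp a & x = a * eps.

Lemma unip_spanD x y : unip_span x -> unip_span y -> unip_span (x + y).
Proof.
move=> [a aU ->] [b bU ->]; exists (a + b); last by rewrite mulrDl.
by move=> g gU; rewrite gaddE aU // bU // addr0.
Qed.

Lemma unip_spanZ r x : unip_span x -> unip_span (gscale r x).
Proof.
move=> [a aU ->]; exists (gscale r a); last by rewrite gscaleAl.
by move=> g gU; rewrite ffunE aU // mulr0.
Qed.

Lemma unip_span0 : unip_span 0.
Proof. by exists 0; rewrite ?mul0r // => g _; rewrite ffunE. Qed.

Lemma unip_span_act u : u \in U -> unip_span (act u * eps).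
Proof.
move=> uU; exists (act u) => // g gU; rewrite ffunE; case: eqP => // gu.
by rewrite gu uU in gU.
Qed.

Lemma unip_span_sum (I : Type) (r : seq I) (P : pred I) (f : I -> RG) :
  (forall k : I, P k -> unip_span (f k)) -> unip_span (\sum_(i <- r | P i) f i).
Proof. by move=> h; elim/big_ind: _ => //; [apply: unip_span0|apply: unip_spanD]. Qed.

Lemma unip_span_stable h :
  (forall u, u \in U -> unip_span (act h * (act u * eps))) ->
  forall x, unip_span x -> unip_span (act h * x).
Proof.
move=> hU _ [a aU ->]; rewrite [a]galg_sum mulr_suml mulr_sumr.
apply: unip_span_sum => g _; rewrite gscaleAl gscaleAr.
have [gU|gU] := boolP (g \in U); first exact/unip_spanZ/hU.
by rewrite aU // gscale0l; apply: unip_span0.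
Qed.

(** The U-span of the generator is stable under B, because the torus fixes the
    generator, and under a simple reflection by steinberg_simple_root. *)
Lemma steinberg_span a : unip_span (a * eps).
Proof.
suff span_act g : forall x, unip_span x -> unip_span (act g * x).
  rewrite [a]galg_sum mulr_suml; apply: unip_span_sum => g _; rewrite gscaleAl.
  apply/unip_spanZ/span_act; rewrite -[eps]mul1r -gelt1.
  by apply: unip_span_act; rewrite group1.
elim/GL_ind: g => [x|b g bB IH x /IH|i j g ji IH x /IH].
- by rewrite gelt1 mul1r.
- rewrite geltM -mulrA; apply: unip_span_stable => u uU.
  have buB : (b * u)%g \in B by rewrite groupM // (subsetP (unip_borel _ _)).
  have [u' [t [u'U tT e]]] := borel_factor buB.
  by rewrite mulrA -geltM e geltM -mulrA steinberg_torus //; apply: unip_span_act.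
rewrite geltM -mulrA; apply: unip_span_stable => u uU.
have ij : (i < j)%N by rewrite ji.
have [u' [c [u'U su'U ->]]] := unip_split uU ji.
set s := tperm i j in su'U *.
have ss : (pe s * pe s = 1)%g by rewrite -perm_eltM tperm2 perm_elt1.
rewrite (gelt_involution _ _ _ ss).
apply: unip_span_stable => [v vU|].
  by rewrite mulrA -geltM; apply: unip_span_act; rewrite groupM.
have span_eps : unip_span eps.
  by rewrite -[eps]mul1r -gelt1; apply: unip_span_act; rewrite group1.
have opp x' : unip_span x' -> unip_span (- x').
  move=> /(unip_spanZ (-1)); congr unip_span; apply/ffunP => k.
  by rewrite !ffunE mulN1r.
have [->|c0] := eqVneq c 0.
  by rewrite xroot0 // gelt1 mul1r steinberg_simple //; apply: opp.
rewrite steinberg_simple_root //; apply: unip_spanD; last exact: opp.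
exact/unip_span_act/upper_unip.
Qed.
End Steinberg.

(** * Eigenvectors of the unipotent group *)

Lemma mul_conj_mem (gT : finGroupType) (B : {group gT}) (x g h : gT) :
  (x^-1 * g * x \in B -> (x^-1 * (g * h) * x \in B) = (x^-1 * h * x \in B))%g.
Proof. by move=> gB; rewrite -[RHS](groupMl _ gB) -!mulgA mulKVg. Qed.

Lemma mul_conj_memV (gT : finGroupType) (B : {group gT}) (x g : gT) :
  ((x^-1 * g^-1 * x \in B) = (x^-1 * g * x \in B))%g.
Proof. by rewrite -groupV !invMg !invgK mulgA. Qed.

Lemma sum_indicator (T : finType) (R : pzRingType) (A D : {set T}) (f : T -> R) :
  D \subset A -> \sum_(u in A) f u * (u \in D)%:R = \sum_(u in D) f u.
Proof.
move/subsetP=> DA; rewrite [LHS]big_mkcond [RHS]big_mkcond; apply: eq_bigr => u _.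
case: (boolP (u \in D)) => [/DA->|_]; rewrite ?mulr1 // mulr0.
by case: ifP.
Qed.

Section Linear.
Variables (m : nat) (F : finFieldType) (R : idomainType).
Local Notation n := m.+1.
Local Notation G := (GLfin m F).
Local Notation B := (borelg m F).
Local Notation U := (unip m F).
Local Notation pe := (@permg m F).
Local Notation q := #|F|.
Local Notation RG := (galg R G).
Local Notation eps := (steinberg_gen m F R).
Local Notation act g := (gelt R g).
Implicit Types (g h b u t v : G) (s w : 'S_n) (i j k : 'I_n) (x y a : RG).
Implicit Types (J : pred nat) (psi : F -> R).

Definition nontriv_char psi :=
  [/\ psi 0 = 1, {morph psi : c d / c + d >-> c * d} & exists c, psi c != 1].

(** Up to conjugation by the torus, the linear characters of U are psi composed
    with these functions. *)
Definition superdiag J u : F :=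
  \sum_i \sum_j ent u i j *+ ((j == i.+1 :> nat) && J j).

Lemma superdiagM J u v : u \in U -> v \in U ->
  superdiag J (u * v)%g = superdiag J u + superdiag J v.
Proof.
move=> /unipP uU /unipP vU; rewrite -big_split; apply: eq_bigr => i _ /=.
rewrite -big_split; apply: eq_bigr => j _ /=; rewrite -mulrnDl.
case: eqP => //= ji; congr (_ *+ _); have nij : i != j by rewrite ltn_ordF // ji.
rewrite entM (bigD1 i) //= (bigD1 j) 1?eq_sym //= big1 => [|k /andP[ki kj]].
  by rewrite (uU i i) // (vU j j) // !eqxx mul1r mulr1 addr0 addrC.
have [lt_ki|le_ik] := ltnP k i.
  by rewrite (uU i k) ?(ltnW lt_ki) // eq_sym (negbTE ki) mul0r.
rewrite (vU k j) ?(negbTE kj) ?mulr0 //; rewrite ji ltn_neqAle le_ik andbT val_eqE.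
by rewrite eq_sym.
Qed.

Lemma superdiag1 J : superdiag J 1%g = 0.
Proof.
rewrite /superdiag big1 // => i _; rewrite big1 // => j _; rewrite ent1.
by have [<-|_] := eqVneq i j; rewrite ?mul0rn // (ltn_eqF (ltnSn i)).
Qed.

Lemma superdiagV J u : u \in U -> superdiag J u^-1%g = - superdiag J u.
Proof.
move=> uU; apply/eqP; rewrite -addr_eq0 -superdiagM ?groupV //.
by rewrite mulVg superdiag1.
Qed.

Lemma superdiag_xroot J i j c : j = i.+1 :> nat -> J j ->
  superdiag J (xroot i j c) = c.
Proof.
move=> ji Jj; have ij : (i < j)%N by rewrite ji.
have Ji : J i.+1 by rewrite -ji.
rewrite /superdiag (bigD1 i) //= (bigD1 j) //= ji eqxx Ji ent_xroot //.
rewrite (ltn_ordF ij) !eqxx !mulr1n add0r big1 ?addr0 => [|k /negbTE kj]; last first.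
  rewrite ent_xroot // kj andbF mulr0n addr0.
  by have [<-|_] := eqVneq i k; rewrite ?mul0rn // (ltn_eqF (ltnSn i)).
rewrite big1 ?addr0 // => k /negbTE ki; rewrite big1 // => l _.
rewrite ent_xroot // ki mulr0n addr0.
by have [<-|_] := eqVneq k l; rewrite ?mul0rn // (ltn_eqF (ltnSn k)).
Qed.

Definition descents J w := forall i j, j = i.+1 :> nat -> J j -> (w j < w i)%N.

(** The stabilizer of the coset of w has zeros wherever w has a descent. *)
Lemma superdiag_descents J w u : descents J w -> u \in unip_stab F w ->
  superdiag J u = 0.
Proof.
move=> Jw /unip_stabP[_ u0]; rewrite /superdiag big1 // => i _; rewrite big1 // => j _.
case: eqP => //= ji; case: (boolP (J j)) => //= Jj.
by rewrite u0 ?mul0rn ?Jw // ji.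
Qed.

Lemma unip_stabV w u : u \in U -> (u^-1%g \in unip_stab F w) = (u \in unip_stab F w).
Proof.
move=> uU; have uVU : u^-1%g \in U by rewrite groupV.
by rewrite !in_unip_stab uU uVU; apply: (@mul_conj_memV _ (borel_group m F)).
Qed.

(** Up to the factor |U|, the idempotent of the linear character of U given by
    J. *)
Definition idem psi J : RG :=
  [ffun u => if u \in U then psi (- superdiag J u) else 0].

(** By idem_gvec every projection of the Steinberg lattice to the linear
    character of J is a multiple of this vector. *)
Definition gvec psi J : RG := idem psi J * eps.

Section Char.
Variables (psi : F -> R).
Hypothesis psiP : nontriv_char psi.

Let psi0 : psi 0 = 1. Proof. by case: psiP. Qed.
Let psiD : {morph psi : c d / c + d >-> c * d}. Proof. by case: psiP. Qed.

Lemma char_mulN c : psi c * psi (- c) = 1.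
Proof. by rewrite -psiD subrr. Qed.

Lemma act_idem J v : v \in U ->
  act v * idem psi J = gscale (psi (superdiag J v)) (idem psi J).
Proof.
move=> vU; apply/ffunP => u; rewrite gelt_mulE !ffunE groupMl ?groupV //.
case: ifP => uU; last by rewrite mulr0.
by rewrite superdiagM ?groupV // superdiagV // opprD opprK psiD.
Qed.

Lemma idem_act J v : v \in U ->
  idem psi J * act v = gscale (psi (superdiag J v)) (idem psi J).
Proof.
move=> vU; apply/ffunP => u; rewrite mul_geltE !ffunE groupMr ?groupV //.
case: ifP => uU; last by rewrite mulr0.
by rewrite superdiagM ?groupV // superdiagV // opprD opprK psiD mulrC.
Qed.

Definition ucoef J a : R := \sum_(u in U) a u * psi (superdiag J u).

Lemma idem_supp J a : unip_supp a -> idem psi J * a = gscale (ucoef J a) (idem psi J).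
Proof.
move=> aU; rewrite [a in LHS]galg_sum mulr_sumr gscale_suml.
rewrite (bigID (fun u => u \in U)) /= [X in _ + X]big1 ?addr0 => [|u uU].
  by apply: eq_bigr => u uU; rewrite gscaleAr idem_act // gscaleA.
by rewrite aU // gscaleAr !gscale0l.
Qed.

Lemma idem_gvec J a : unip_supp a ->
  idem psi J * (a * eps) = gscale (ucoef J a) (gvec psi J).
Proof. by move=> aU; rewrite mulrA idem_supp // gscaleAl. Qed.

Lemma gvec_sum J : gvec psi J = \sum_(u in U) gscale (psi (- superdiag J u)) (act u * eps).
Proof.
rewrite /gvec [idem psi J in LHS]galg_sum mulr_suml [RHS]big_mkcond /=.
apply: eq_bigr => u _; rewrite gscaleAl ffunE; case: ifP => // _.
exact: gscale0l.
Qed.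

Lemma gvec_left J u g : u \in U ->
  gvec psi J (u * g)%g = psi (- superdiag J u) * gvec psi J g.
Proof.
move=> uU; rewrite -[u in LHS]invgK -gelt_mulE /gvec mulrA act_idem ?groupV //.
by rewrite gscaleAl ffunE superdiagV.
Qed.

Lemma gvec_right J g b : b \in B -> gvec psi J (g * b)%g = gvec psi J g.
Proof.
move=> bB; rewrite /gvec !gmulE; apply: eq_bigr => h _.
by rewrite mulgA steinberg_right.
Qed.

(** Translation by a root element multiplies the sum by a value of psi, which
    can be chosen different from 1. *)
Lemma sum_unip_stab0 J w i j : j = i.+1 :> nat -> J j -> (w i < w j)%N ->
  \sum_(u in unip_stab F w) psi (- superdiag J u) = 0.
Proof.
move=> ji Jj wij; have ij : (i < j)%N by rewrite ji.
have [_ _ [c c1]] := psiP; set S := (X in X = 0).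
pose x := xroot i j (- c); have xU : x \in U := upper_unip _.
have xE : superdiag J x = - c by apply: superdiag_xroot.
suff /eqP : (1 - psi c) * S = 0.
  by rewrite mulf_eq0 subr_eq0 eq_sym (negbTE c1) => /eqP.
rewrite mulrBl mul1r; apply/eqP; rewrite subr_eq0; apply/eqP.
rewrite /S [LHS](reindex_inj (mulgI x)) /= mulr_sumr; apply: eq_big => [u|u].
  rewrite !in_unip_stab groupMl //; apply: andb_id2l => uU.
  have := @mul_conj_mem _ (borel_group m F) (pe w) x u (xroot_perm (- c) ij wij).
  by move->.
rewrite in_unip_stab groupMl // => /andP[uU _].
by rewrite superdiagM // xE opprD opprK psiD.
Qed.

Lemma sum_unip_stab J w : descents J w ->
  \sum_(u in unip_stab F w) psi (- superdiag J u) = #|unip_stab F w|%:R.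
Proof.
move=> Jw; rewrite -sum1_card natr_sum; apply: eq_bigr => u uw.
by rewrite (superdiag_descents Jw uw) oppr0 psi0.
Qed.

Lemma gvec_perm J w :
  gvec psi J (pe w) = (-1) ^+ w * \sum_(u in unip_stab F w) psi (- superdiag J u).
Proof.
rewrite gvec_sum gsumE mulr_sumr [RHS]big_mkcond [LHS]big_mkcond /=.
apply: eq_bigr => u _; case: (boolP (u \in U)) => uU; last first.
  by rewrite in_unip_stab (negbTE uU).
rewrite ffunE gelt_mulE steinberg_unip ?groupV //.
rewrite unip_stabV //.
by case: ifP => _; rewrite ?mulr0 // mulr1 mulrC.
Qed.

Lemma gvec_descents J w : descents J w ->
  gvec psi J (pe w) = (-1) ^+ w * (q ^ coinversions w)%:R.
Proof. by move=> Jw; rewrite gvec_perm sum_unip_stab // card_unip_stab. Qed.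

(** The generator is the signed sum of the indicator functions of the cosets of
    B represented by permutations. *)
Lemma cell_sum_form x : (forall g b, b \in B -> x (g * b)%g = x g) ->
  gform x eps = #|B|%:R * \sum_(w : 'S_n) (-1) ^+ w * x (pe w).
Proof.
move=> xB; rewrite mulr_sumr.
transitivity (\sum_g \sum_(w : 'S_n) x g * ((-1) ^+ w * coset_fun R w g)).
  by apply: eq_bigr => g _; rewrite steinberg_eltE cell_sumE mulr_sumr.
rewrite exchange_big; apply: eq_bigr => w _ /=.
rewrite (reindex_inj (mulgI (pe w))) /=.
under eq_bigr => g _ do rewrite /coset_fun mulKg.
rewrite (bigID (fun g => g \in B)) /= [X in _ + X]big1 ?addr0 => [|g /negbTE->]; last first.
  by rewrite !mulr0.
rewrite (eq_bigr (fun=> (-1) ^+ w * x (pe w))) => [|g gB].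
  by rewrite sumr_const mulr_natl.
by rewrite gB mulr1 mulrC xB.
Qed.

(** Reversing the values turns the permutations with descents at J into those
    increasing on the blocks of J, and non-inversions into inversions. *)
Lemma sum_descents J :
  \sum_(w : 'S_n) \sum_(u in unip_stab F w) psi (- superdiag J u) = (pindex m F J)%:R.
Proof.
pose r : 'S_n := perm (@rev_ord_inj n).
rewrite (reindex_inj (mulIg r)) /= /pindex natr_sum [RHS]big_mkcond /=.
have rlt w i j : ((w * r)%g i < (w * r)%g j)%N = (w j < w i)%N.
  by rewrite !permM !permE /= ltn_sub2lE // ltnS.
apply: eq_bigr => w _; case: (boolP (incr J w)) => [/incrP h|].
  rewrite sum_unip_stab => [|i j ji Jj]; last by rewrite rlt; apply: h.
  rewrite card_unip_stab; congr (_ ^ _)%:R; apply: eq_bigr => i _.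
  by apply: eq_bigr => j _; rewrite rlt.
case/forallPn=> i /forallPn[j]; rewrite negb_imply -leqNgt => /andP[/andP[/eqP ji Jj]].
move=> wji; apply: (@sum_unip_stab0 J _ i j) => //; rewrite rlt ltn_neqAle wji andbT.
by rewrite val_eqE (inj_eq perm_inj) eq_sym ltn_ordF // ji.
Qed.

(** This is how the indices of parabolic subgroups enter: a permutation without
    descents at J contributes nothing to the form, by sum_unip_stab0. *)
Lemma gform_gvec J : gform (gvec psi J) eps = (#|B| * pindex m F J)%:R.
Proof.
rewrite cell_sum_form => [|g b]; last exact: gvec_right.
rewrite natrM -sum_descents; congr (_ * _); apply: eq_bigr => w _.
by rewrite gvec_perm mulrA -expr2 sqrr_sign mul1r.
Qed.

(** The coefficient of a projection can be read off from the values on a single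
    Bruhat cell. *)
Lemma ucoefE J a w : unip_supp a -> descents J w ->
  \sum_(u in U) psi (superdiag J u) * (a * eps) (u * pe w)%g =
  (-1) ^+ w * (q ^ coinversions w)%:R * ucoef J a.
Proof.
move=> aU Jw.
transitivity (\sum_(u in U) \sum_(v in U)
    psi (superdiag J u) * (a v * eps (v^-1 * u * pe w)%g)).
  apply: eq_bigr => u uU; rewrite gmulE mulr_sumr [LHS](bigID (fun v => v \in U)) /=.
  rewrite [X in _ + X]big1 ?addr0 => [|v vU]; last by rewrite aU // mul0r mulr0.
  by apply: eq_bigr => v _; rewrite mulgA.
rewrite exchange_big mulr_sumr; apply: eq_bigr => v vU /=.
rewrite (reindex_inj (mulgI v)) /=.
transitivity (\sum_(u in U) a v * psi (superdiag J v) *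
   ((-1) ^+ w * (psi (superdiag J u) * (u \in unip_stab F w)%:R))).
  apply: eq_big => [u|u]; rewrite groupMl // => uU.
  rewrite mulKg steinberg_unip //.
  rewrite superdiagM //.
  rewrite psiD.
  by rewrite mulrCA -!mulrA; congr (_ * (_ * _)); rewrite mulrCA.
rewrite -!mulr_sumr sum_indicator; last first.
  by apply/subsetP => u; rewrite in_unip_stab => /andP[].
rewrite (eq_bigr (fun=> 1)) => [|u uw]; last first.
  by rewrite (superdiag_descents Jw uw) psi0.
by rewrite sumr_const card_unip_stab mulrC.
Qed.

End Char.
End Linear.

(** * Generation between eigenvectors *)

Lemma levi_factor (gT : finGroupType) (y u a p : gT) :
  (y * (u * a) = (y * p * y^-1) * ((y * a) * (a^-1 * (p^-1 * u) * a)))%g.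
Proof. by rewrite -!mulgA !mulKg !mulKVg. Qed.

Section Levi.
Variables (m : nat) (F : finFieldType).
Local Notation n := m.+1.
Local Notation G := (GLfin m F).
Local Notation U := (unip m F).
Local Notation pe := (@permg m F).
Implicit Types (u v : G) (s w : 'S_n) (i j k : 'I_n).

(** The projection of U onto its intersection with the Levi subgroup. *)
Definition levi (J : pred nat) u : G :=
  upper (fun i j => ent u i j *+ (blk J i == blk J j)).

Section Projection.
Variable J : pred nat.

Lemma levi_unip u : levi J u \in U. Proof. exact: upper_unip. Qed.

Lemma ent_levi u i j : u \in U ->
  ent (levi J u) i j = ent u i j *+ (blk J i == blk J j).
Proof.
move=> /unipP uU; rewrite ent_upper; case: leqP => // ji.
by rewrite uU //; case: (eqVneq i j) => [->|_]; rewrite ?eqxx ?mul0rn.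
Qed.

Lemma leviM u v : u \in U -> v \in U -> levi J (u * v)%g = (levi J u * levi J v)%g.
Proof.
move=> uU vU; apply: entP => i j; rewrite ent_levi ?groupM // !entM -sumrMnl.
apply: eq_bigr => k _; rewrite !ent_levi // mulrnAl mulrnAr -mulrnA.
have [ki|ik] := ltnP k i.
  by rewrite (unipP _ uU i k (ltnW ki)) eq_sym (ltn_ordF ki) mul0r !mul0rn.
have [jk|kj] := ltnP j k.
  by rewrite (unipP _ vU k j (ltnW jk)) eq_sym (ltn_ordF jk) mulr0 !mul0rn.
congr (_ *+ _); have := blk_mono J ik; have := blk_mono J kj.
by case: eqP; case: eqP; case: eqP; lia.
Qed.

Lemma levi1 : levi J 1%g = 1%g.
Proof.
apply: entP => i j; rewrite ent_levi ?group1 // ent1.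
by case: (eqVneq i j) => [->|_]; rewrite ?eqxx ?mul0rn.
Qed.

Lemma levi_id u : u \in U -> levi J (levi J u) = levi J u.
Proof.
move=> uU; apply: entP => i j; rewrite !ent_levi ?levi_unip //.
by case: eqP; rewrite ?mulr1n // !mulr0n.
Qed.

Lemma levi_kernel u i j : u \in U -> (i < j)%N -> blk J i = blk J j ->
  ent ((levi J u)^-1 * u)%g i j = 0.
Proof.
move=> uU ij bij; set r := ((levi J u)^-1 * u)%g.
have lVU : ((levi J u)^-1)%g \in U by rewrite groupV levi_unip.
have rU : r \in U by rewrite groupM.
have r1 : levi J r = 1%g.
  have := leviM lVU (levi_unip u); rewrite mulVg levi1 levi_id // => ->.
  by rewrite leviM.
have := ent_levi i j rU; rewrite r1 ent1 (ltn_ordF ij) bij eqxx mulr1n.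
by move=> <-.
Qed.

(** The other factor of u is trivial inside the blocks, and s keeps the order of
    positions in different blocks. *)
Lemma levi_stab u s : u \in U -> s \in young n J ->
  ((levi J u)^-1 * u)%g \in unip_stab F s.
Proof.
move=> uU sJ; apply/unip_stabP; split=> [|i j ij sij].
  by rewrite groupM // groupV levi_unip.
apply: levi_kernel => //; apply/eqP; apply: contraLR sij => bij.
by rewrite -leqNgt ltnW // (young_lt sJ bij).
Qed.
End Projection.

Section Twist.
Variables J J' : pred nat.
Hypothesis sub : forall k : nat, (0 < k < n)%N -> J' k -> J k.
Variables a b : 'S_n.
Hypotheses (aJ' : a \in young n J') (bJ : b \in young n J).
Hypothesis rev_a : forall i j, blk J' i = blk J' j -> (a i + i = a j + j)%N.
Hypothesis rev_b : forall i j, blk J i = blk J j -> (b i + i = b j + j)%N.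
Let y := (b * a^-1)%g.
Let z := (a * b^-1)%g.

Lemma twist_blk i j : blk J' i = blk J' j -> blk J (z i) = blk J (z j).
Proof.
move=> bij; have bV (k : 'I_n) : blk J (b^-1%g k) = blk J k.
  by apply: youngP; rewrite groupV.
have aV (k : 'I_n) : blk J' (a k) = blk J' k by apply: youngP.
have same (k l : 'I_n) : (k <= l)%N -> blk J' k = blk J' l -> blk J k = blk J l.
  by move=> kl; apply: (blk_sub sub); rewrite kl ltn_ord.
rewrite !permM !bV; case/orP: (leq_total (a i) (a j)) => le_a.
  by apply: same; rewrite ?aV.
by apply/esym/same; rewrite ?aV.
Qed.

(** Both reversals send consecutive positions of a block to consecutive
    positions, so z shifts every block of J' as a whole into a block of J. *)
Lemma twist_shift i j : blk J' i = blk J' j -> (z i + j = z j + i)%N.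
Proof.
move=> bij; have := rev_a bij; have := rev_b (twist_blk bij).
rewrite !permM !permKV; lia.
Qed.

Lemma twistK : cancel z y. Proof. by move=> i; rewrite !permM permKV permK. Qed.

Lemma twist_levi u : u \in U -> (pe y * levi J' u * (pe y)^-1)%g \in U.
Proof.
move=> uU; apply/unipP => i j ji; rewrite ent_perm_conj ent_levi //.
have zy (k : 'I_n) : z (y k) = k by rewrite !permM permKV permK.
have [yij|yji] := ltnP (y i) (y j); last first.
  rewrite (unipP _ uU) // (inj_eq perm_inj).
  by case: (eqVneq i j) => [->|_]; rewrite ?eqxx ?mul0rn.
have -> : (i == j) = false.
  by apply/eqP => ij; rewrite ij ltnn in yij.
case: eqP => // /twist_shift; rewrite !zy; lia.
Qed.

(** Conjugation by y identifies the superdiagonal entries inside the blocks of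
    J' with superdiagonal entries inside the blocks of J. *)
Lemma superdiag_twist u : u \in U ->
  superdiag J (pe y * levi J' u * (pe y)^-1)%g = superdiag J' u.
Proof.
move=> uU; rewrite /superdiag (reindex_inj (@perm_inj _ z)) /=.
apply: eq_bigr => i _; rewrite (reindex_inj (@perm_inj _ z)) /=.
apply: eq_bigr => j _; rewrite ent_perm_conj !twistK ent_levi // -mulrnA.
have [ij|] := ltnP i j; last first.
  rewrite leq_eqVlt => /orP[/eqP/val_inj<-|ji].
    by rewrite !(ltn_eqF (ltnSn _)) muln0.
  by rewrite (unipP _ uU) ?(ltnW ji) // eq_sym (ltn_ordF ji) !mul0rn.
congr (_ *+ _); have J'S : j = i.+1 :> nat -> J' j = (blk J' i == blk J' j).
  by move=> ji; rewrite ji blkS.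
have JS : z j = (z i).+1 :> nat -> J (z j) = (blk J (z i) == blk J (z j)).
  by move=> ji; rewrite ji blkS.
have [bij|bij] := eqVneq (blk J' i) (blk J' j); last first.
  by case: (eqVneq (j : nat) i.+1) => // /J'S->; rewrite (negbTE bij).
have := twist_shift bij; have zb := twist_blk bij.
case: (eqVneq (j : nat) i.+1) => [ji|ji] zij.
  have zji : z j = (z i).+1 :> nat by lia.
  by rewrite J'S // bij eqxx zji eqxx -zji JS // zb eqxx.
by have -> : (z j == (z i).+1 :> nat) = false by [apply/eqP; lia].
Qed.

End Twist.
End Levi.

Section Generation.
Variables (m : nat) (F : finFieldType) (R : idomainType).
Local Notation n := m.+1.
Local Notation B := (borelg m F).
Local Notation U := (unip m F).
Local Notation pe := (@permg m F).
Local Notation q := #|F|.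
Local Notation eps := (steinberg_gen m F R).
Local Notation act g := (gelt R g).

Local Notation idem := (@idem m F R).
Local Notation gvec := (@gvec m F R).

Lemma block_reversal_descents (J : pred nat) (s : 'S_n) :
  (forall i j : 'I_n, blk J i = blk J j -> (s i + i = s j + j)%N) -> descents J s.
Proof.
move=> rev i j ji Jj; suff : (s i + i = s j + j)%N by lia.
by apply/rev/eqP; rewrite ji blkS -ji.
Qed.

(** Translate gvec J by the permutation that shifts the blocks of J' into those
    of J, and project to the character of J'.  On the cell of the reversal a of
    the blocks of J' the result takes, up to values of psi, the single value
    gvec J (pe b), where b reverses the blocks of J. *)
Lemma gvec_generates (psi : F -> R) (J J' : pred nat) : nontriv_char psi ->
  (forall k : nat, (0 < k < n)%N -> J' k -> J k) ->
  exists g c, idem psi J' * (act g * gvec psi J) = gscale c (gvec psi J') /\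
    exists k1 k2 (sg : bool), c * (q ^ k1)%:R = (-1) ^+ sg * (q ^ k2)%:R.
Proof.
move=> psiP sub; have [psi0 psiD _] := psiP.
have [a [aJ' rev_a]] := block_reversal J' n.
have [b [bJ rev_b]] := block_reversal J n.
pose y := (b * a^-1)%g; pose g := ((pe y)^-1)%g.
have [c cU cE] := steinberg_span (act g * idem psi J).
exists g, (ucoef psi J' c); rewrite /gvec [act g * _]mulrA cE; split.
  exact: idem_gvec.
have value u : u \in U -> (c * eps) (u * pe a)%g =
    psi (- superdiag J' u) * gvec psi J (pe b).
  move=> uU; rewrite -cE -mulrA gelt_mulE invgK.
  rewrite (levi_factor (pe y) u (pe a) (levi J' u)) -/(gvec psi J).
  rewrite gvec_left ?(twist_levi sub aJ' bJ rev_a rev_b uU) //.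
  rewrite (superdiag_twist sub aJ' bJ rev_a rev_b uU) -perm_eltM mulgKV gvec_right //.
  by have := levi_stab uU aJ'; rewrite in_unip_stab => /andP[].
have := ucoefE psiP cU (block_reversal_descents rev_a).
rewrite (eq_bigr (fun=> gvec psi J (pe b))) => [|u uU]; last first.
  by rewrite value // mulrA (char_mulN psiP) mul1r.
rewrite sumr_const card_unip (gvec_descents psiP); last first.
  exact: block_reversal_descents rev_b.
move=> val_c; exists (coinversions a), (coinversions b + coinversions (1%g : 'S_n))%N,
  (odd_perm a (+) odd_perm b).
rewrite signr_addb expnD natrM.
set x := _ * (q ^ coinversions a)%:R.
have -> : x = (-1) ^+ odd_perm a * ((-1) ^+ odd_perm a * x).
  by rewrite mulrA -expr2 sqrr_sign mul1r.
rewrite -[RHS]mulrA; congr (_ * _).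
by rewrite {}/x [ucoef _ _ _ * _]mulrC [LHS]mulrA -val_c ?[RHS]mulrA [RHS]mulr_natr.
Qed.

Lemma nontriv_charN (psi : F -> R) : nontriv_char psi ->
  nontriv_char (fun c => psi (- c)).
Proof.
case=> psi0 psiD [c c1]; split; first by rewrite oppr0.
  by move=> x y; rewrite opprD psiD.
by exists (- c); rewrite opprK.
Qed.

Lemma gadj_idem (psi : F -> R) J : gadj (idem psi J) = idem (fun c => psi (- c)) J.
Proof.
apply/ffunP => g; rewrite !ffunE groupV; case: ifP => // gU.
by rewrite superdiagV.
Qed.

(** Both coefficients are read off one value of the form, so the symmetry of
    the form relates them through the lengths of the two vectors. *)
Lemma gvec_reciprocity (psi : F -> R) (J J' : pred nat) g c : nontriv_char psi ->
  #|B|%:R != 0 :> R ->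
  idem psi J' * (act g * gvec psi J) = gscale c (gvec psi J') ->
  let psi' x := psi (- x) in
  exists c', idem psi' J * (act g^-1%g * gvec psi' J') = gscale c' (gvec psi' J) /\
             c * (pindex m F J')%:R = c' * (pindex m F J)%:R.
Proof.
move=> psiP B0 cE psi'; have psi'P := nontriv_charN psiP.
have [a aU aE] := steinberg_span (act g^-1%g * idem psi' J').
have e : act g^-1%g * gvec psi' J' = a * eps by rewrite -aE -mulrA.
exists (ucoef psi' J a); split; first by rewrite e idem_gvec.
apply: (mulfI B0); rewrite mulrCA [RHS]mulrCA -!natrM.
rewrite -(gform_gvec m psiP) -(gform_gvec m psi'P) -!gform_scale -cE.
rewrite gform_mul gadj_idem gform_gelt -/psi' -/(gvec psi' J') e.
by rewrite gform_mul gadj_idem -/psi' (idem_gvec psi'P) // gformC.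
Qed.
End Generation.

(** * Columns of the unipotent group and the mirabolic subgroups *)

Section Mirabolic.
Variables (m : nat) (F : finFieldType).
Local Notation n := m.+1.
Local Notation G := (GLfin m F).
Local Notation U := (unip m F).
Local Notation pe := (@permg m F).
Implicit Types (g h u v w : G) (i j : 'I_n).

Definition last_columns (k : nat) : {set G} :=
  [set u in U | [forall i : 'I_n, forall j : 'I_n, (j < k)%N ==> (ent u i j == (i == j)%:R)]].

Lemma last_columnsP k u : reflect
  (u \in U /\ forall i j, (j < k)%N -> ent u i j = (i == j)%:R) (u \in last_columns k).
Proof.
rewrite [u \in last_columns k]in_set; apply: (iffP andP) => -[uU h]; split=> //.
  by move=> i j jk; have /forallP/(_ j)/implyP/(_ jk)/eqP := forallP h i.
by apply/forallP => i; apply/forallP => j; apply/implyP => jk; rewrite h.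
Qed.

Section Column.
Variable k : 'I_n.

Definition column : {set G} :=
  [set u : G | [forall i : 'I_n, forall j : 'I_n,
    (j != k) || (k <= i)%N ==> (ent u i j == (i == j)%:R)]].

Lemma columnP u : reflect
  (forall i j, (j != k) || (k <= i)%N -> ent u i j = (i == j)%:R) (u \in column).
Proof.
rewrite [u \in column]in_set; apply: (iffP forallP) => [h i j jk|h i].
  by have /forallP/(_ j)/implyP/(_ jk)/eqP := h i.
by apply/forallP => j; apply/implyP => jk; rewrite h.
Qed.

Lemma column_unip u : u \in column -> u \in U.
Proof.
move=> /columnP uN; apply/unipP => i j ji; apply: uN.
by case: (eqVneq j k) => //= jk; rewrite -jk.
Qed.

Lemma ent_column_mul u g i j : u \in column -> (i < k)%N ->
  ent (u * g)%g i j = ent g i j + ent u i k * ent g k j.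
Proof.
move=> /columnP uN ik; rewrite entM (bigD1 k) //= addrC; congr (_ + _).
rewrite (bigD1 i) ?(ltn_ordF ik) //= (uN i i) ?(ltn_ordF ik) // eqxx mul1r.
rewrite big1 ?addr0 // => l.
by case/andP=> lk li; rewrite uN ?lk // eq_sym (negbTE li) mul0r.
Qed.

Lemma ent_column_mul_ge u g i j : u \in column -> (k <= i)%N ->
  ent (u * g)%g i j = ent g i j.
Proof.
move=> /columnP uN ki; rewrite entM (bigD1 i) //= (uN i i) ?ki ?orbT // eqxx mul1r.
by rewrite big1 ?addr0 // => l li; rewrite uN ?ki ?orbT // eq_sym (negbTE li) mul0r.
Qed.

Lemma column_group_set : group_set column.
Proof.
apply/group_setP; split=> [|u v uN vN]; first by apply/columnP => i j _; rewrite ent1.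
apply/columnP => i j ijk; have [ki|ik] := leqP k i.
  by rewrite ent_column_mul_ge // (columnP _ vN) // ki orbT.
rewrite ent_column_mul // !(columnP _ vN) ?leqnn ?orbT //.
have jk : j != k by move: ijk; rewrite leqNgt ik orbF.
by rewrite [k == j]eq_sym (negbTE jk) mulr0 addr0.
Qed.
Canonical column_group := Group column_group_set.

Lemma ent_columnM u v i : u \in column -> v \in column -> (i < k)%N ->
  ent (u * v)%g i k = ent u i k + ent v i k.
Proof.
move=> uN vN ik; rewrite ent_column_mul // (columnP _ vN k k) ?leqnn ?orbT //.
by rewrite eqxx mulr1 addrC.
Qed.

Lemma last_columns_factor u : u \in last_columns k ->
  exists w v, [/\ w \in column, v \in last_columns k.+1 & u = (w * v)%g].
Proof.
case/last_columnsP=> uU uk.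
pose w : G := upper (fun i j => ent u i j *+ (j == k)).
have wN : w \in column.
  apply/columnP => i j; rewrite ent_upper; case: ltnP => // ij.
  rewrite (ltn_ordF ij); case: (eqVneq j k) => [<-|_ _]; rewrite ?mulr0n //=.
  by rewrite leqNgt ij.
pose v := (w^-1 * u)%g; have vU : v \in U by rewrite groupM // groupV column_unip.
have uE : u = (w * v)%g by rewrite /v mulKVg.
exists w, v; split=> //; apply/last_columnsP; split=> // i j.
rewrite ltnS => jk; have [ki|ik] := leqP k i.
  by apply: (unipP _ vU); apply: leq_trans jk ki.
have := ent_column_mul v j wN ik; rewrite -uE.
have [jE|jk'] := eqVneq j k.
  rewrite jE (unipP _ vU k k) // eqxx mulr1 ent_upper ik eqxx mulr1n (ltn_ordF ik).
  by move/eqP; rewrite -subr_eq subrr => /eqP.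
have {}jk : (j < k)%N by rewrite ltn_neqAle jk'.
by rewrite (unipP _ vU k j) ?(ltnW jk) // eq_sym (ltn_ordF jk) mulr0 addr0 uk.
Qed.

(** Apart from column k these matrices act on the coordinates before k only;
    conjugation by them fixes the superdiagonal of the columns after k, by
    superdiag_mirabolic. *)
Definition mirabolic : {set G} :=
  [set h : G | [forall i : 'I_n, forall j : 'I_n,
    (k <= i)%N || (k < j)%N ==> (ent h i j == (i == j)%:R)]].

Lemma mirabolicP h : reflect
  (forall i j, (k <= i)%N || (k < j)%N -> ent h i j = (i == j)%:R) (h \in mirabolic).
Proof.
rewrite [h \in mirabolic]in_set; apply: (iffP forallP) => [hh i j jk|hh i].
  by have /forallP/(_ j)/implyP/(_ jk)/eqP := hh i.
by apply/forallP => j; apply/implyP => jk; rewrite hh.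
Qed.

Lemma mirabolic_group_set : group_set mirabolic.
Proof.
apply/group_setP; split=> [|g h /mirabolicP gH /mirabolicP hH].
  by apply/mirabolicP => i j _; rewrite ent1.
apply/mirabolicP => i j /orP[ki|kj]; rewrite entM.
  rewrite (bigD1 i) //= gH ?ki // eqxx mul1r hH ?ki // big1 ?addr0 // => l li.
  by rewrite gH ?ki // eq_sym (negbTE li) mul0r.
rewrite (bigD1 j) //= [ent h j j]hH ?kj ?orbT // eqxx mulr1 gH ?kj ?orbT //.
rewrite big1 ?addr0 // => l lj.
by rewrite hH ?kj ?orbT // (negbTE lj) mulr0.
Qed.
Canonical mirabolic_group := Group mirabolic_group_set.

Lemma column_mirabolic u : u \in column -> u \in mirabolic.
Proof.
move=> /columnP uN; apply/mirabolicP => i j /orP[ki|kj]; apply: uN.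
  by rewrite ki orbT.
by rewrite eq_sym (ltn_ordF kj).
Qed.

Lemma ent_mirabolic_conj h u i j : h \in mirabolic -> u \in last_columns k.+1 ->
  ent (h * u * h^-1)%g i j =
  if (j <= k)%N then (i == j)%:R else \sum_l ent h i l * ent u l j.
Proof.
move=> hH /last_columnsP[uU uk].
have /mirabolicP h'H : (h^-1)%g \in mirabolic by rewrite groupV.
have uhE l : ent (u * h^-1)%g l j = if (j <= k)%N then ent h^-1%g l j else ent u l j.
  rewrite entM; case: leqP => jk.
    rewrite (bigD1 l) //=.
    have [lk|kl] := leqP l k.
      rewrite uk // eqxx mul1r big1 ?addr0 // => b bl.
      have [bk|kb] := leqP b k; first by rewrite uk // eq_sym (negbTE bl) mul0r.
      rewrite h'H ?(ltnW kb) // (_ : b == j = false) ?mulr0 //.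
      by apply/eqP => bj; rewrite bj ltnNge jk in kb.
    rewrite (unipP _ uU l l) // eqxx mul1r big1 ?addr0 // => b bl.
    have [bk|kb] := leqP b k; first by rewrite uk // eq_sym (negbTE bl) mul0r.
    rewrite [ent h^-1%g b j]h'H ?(ltnW kb) // (_ : b == j = false) ?mulr0 //.
    by apply/eqP => bj; rewrite bj ltnNge jk in kb.
  rewrite (bigD1 j) //= [ent h^-1%g j j]h'H ?jk ?orbT // eqxx mulr1.
  rewrite big1 ?addr0 // => b bj.
  by rewrite h'H ?jk ?orbT // (negbTE bj) mulr0.
rewrite -mulgA entM; under eq_bigr => l _ do rewrite uhE.
by case: leqP => // jk; rewrite -entM mulgV ent1.
Qed.

Lemma ent_mirabolic_conj_ge h u i j : h \in mirabolic -> u \in last_columns k.+1 ->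
  (k <= i)%N -> ent (h * u * h^-1)%g i j = ent u i j.
Proof.
move=> hH uk ki; rewrite ent_mirabolic_conj //; case/last_columnsP: uk => uU uk.
case: ifP => [jk|_]; first by rewrite uk.
have /mirabolicP h1 := hH; rewrite (bigD1 i) //= h1 ?ki // eqxx mul1r.
by rewrite big1 ?addr0 // => l li; rewrite h1 ?ki // eq_sym (negbTE li) mul0r.
Qed.

Lemma mirabolic_last_columns h u : h \in mirabolic -> u \in last_columns k.+1 ->
  (h * u * h^-1)%g \in last_columns k.+1.
Proof.
move=> hH uk; apply/last_columnsP; split=> [|i j jk]; last first.
  by rewrite ent_mirabolic_conj // -ltnS jk.
apply/unipP => i j ji; have [jk|kj] := leqP j k.
  by rewrite ent_mirabolic_conj // jk.
rewrite ent_mirabolic_conj_ge ?(leq_trans (ltnW kj)) //.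
by case/last_columnsP: uk => /unipP uU _; rewrite uU.
Qed.

Lemma superdiag_mirabolic J h u : h \in mirabolic -> u \in last_columns k.+1 ->
  superdiag J (h * u * h^-1)%g = superdiag J u.
Proof.
move=> hH uk; apply: eq_bigr => i _; apply: eq_bigr => j _.
case: eqP => //= ji; congr (_ *+ _).
have [jk|kj] := leqP j k.
  rewrite ent_mirabolic_conj // jk; case/last_columnsP: uk => _ uk.
  by rewrite uk.
by rewrite ent_mirabolic_conj_ge // -ltnS -ji.
Qed.

Lemma eq_superdiag J J' u : u \in last_columns k.+1 ->
  (forall l : nat, (k < l)%N -> J l = J' l) -> superdiag J u = superdiag J' u.
Proof.
move=> /last_columnsP[_ uk] JJ'; apply: eq_bigr => i _; apply: eq_bigr => j _.
case: eqP => //= ji; have [jk|kj] := leqP j k; last by rewrite JJ'.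
by rewrite uk // ltn_ordF ?ji // !mul0rn.
Qed.

(** The characters of the column subgroup are psi composed with the dot a, for
    a row vector a. *)
Definition dot (a : 'rV[F]_n) u : F := \sum_(i : 'I_n | (i < k)%N) a 0 i * ent u i k.

Lemma dotM a u v : u \in column -> v \in column ->
  dot a (u * v)%g = dot a u + dot a v.
Proof.
move=> uN vN; rewrite -big_split; apply: eq_bigr => i ik /=.
by rewrite ent_columnM // mulrDr.
Qed.

Lemma dot1 a : dot a 1%g = 0.
Proof. by apply: big1 => i ik; rewrite ent1 (ltn_ordF ik) mulr0. Qed.

Lemma dotD a b u : dot (a + b) u = dot a u + dot b u.
Proof. by rewrite -big_split; apply: eq_bigr => i _ /=; rewrite mxE mulrDl. Qed.

Lemma dot_neq1 u : u \in column -> u != 1%g ->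
  exists2 i : 'I_n, (i < k)%N & ent u i k != 0.
Proof.
move=> /columnP uN u1; apply/exists_inP; apply: contraR u1 => /exists_inPn u0.
apply/eqP/entP => i j; rewrite ent1.
case: (boolP ((j != k) || (k <= i)%N)) => [/uN//|].
rewrite negb_or negbK -ltnNge => /andP[/eqP-> ik].
by rewrite (ltn_ordF ik); apply/eqP; have := u0 i ik; rewrite negbK.
Qed.

End Column.

Section RowChange.
Variables (k l i0 : 'I_n) (a : 'rV[F]_n).
Hypotheses (kl : k = l.+1 :> nat) (i0k : (i0 < k)%N) (a0 : a 0 i0 != 0).

Let row_mx (c : 'I_n -> F) : 'M[F]_n :=
  \matrix_(i, j) if i == i0 then c j *+ (j < k)%N else (i == j)%:R.

(** The given vector has a nonzero entry, so it is a row of an invertible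
    matrix.  By dot_row_change, conjugation turns the character of the column
    given by a into the one that reads the superdiagonal entry. *)
Lemma row_change : exists h : G,
  [/\ h \in mirabolic k, (forall i, ent h i k = (i == k)%:R) &
      forall j, (j < k)%N -> ent h l j = a 0 j].
Proof.
pose c j := a 0 j; pose d j := if j == i0 then (a 0 i0)^-1 else - (a 0 j / a 0 i0).
have mulE (x y : 'I_n -> F) j : \sum_l' row_mx x i0 l' * row_mx y l' j =
    (x i0 * y j + (if j == i0 then 0 else x j)) *+ (j < k)%N.
  rewrite (bigD1 i0) //= !mxE eqxx i0k mulr1n mulrnDl mulrnAr; congr (_ + _).
  have [->|ji] := eqVneq j i0.
    rewrite mul0rn big1 // => l' /negbTE li; rewrite !mxE eqxx li mulr0 //.
  rewrite (bigD1 j) //= !mxE eqxx (negbTE ji) eqxx mulr1 big1 ?addr0 //.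
  by move=> l' /andP[/negbTE li /negbTE lj]; rewrite !mxE li lj mulr0.
have cd : row_mx c *m row_mx d = 1%:M.
  apply/matrixP => i j; rewrite mxE [RHS]mxE.
  have [->|ii] := eqVneq i i0.
    rewrite mulE /c /d [i0 == j]eq_sym; case: (eqVneq j i0) => [->|ji].
      by rewrite i0k addr0 mulfV.
    by rewrite mulrN mulrCA mulfV // mulr1 addrC subrr mul0rn.
  rewrite (bigD1 i) //= !mxE (negbTE ii) eqxx mul1r big1 ?addr0 // => l' li.
  by rewrite !mxE (negbTE ii) eq_sym (negbTE li) mul0r.
have [Mu _] := mulmx1_unit cd.
(* The identity matrix with row i0 replaced by the vector, after which rows i0
   and l are exchanged. *)
pose M : G := mkGL (row_mx c); pose h := (pe (tperm i0 l) * M)%g.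
have hE i j : ent h i j = if i == l then c j *+ (j < k)%N else (tperm i0 l i == j)%:R.
  rewrite ent_perm_mul /ent mkGLE // mxE -[in RHS](inj_eq (@perm_inj _ (tperm i0 l)) i) tpermR.
  by [].
have lk : (l < k)%N by rewrite kl.
have tk i : (k <= i)%N -> tperm i0 l i = i.
  move=> ki; rewrite tpermD // ltn_ordF // (leq_trans _ ki) //.
have tlt i : (i < k)%N -> (tperm i0 l i < k)%N.
  by move=> ik; case: tpermP => // _; rewrite ?kl.
exists h; split=> [|i|j jk]; last by rewrite hE eqxx jk.
  apply/mirabolicP => i j ijk; rewrite hE; case: eqP => [il|il].
    have jk : (k < j)%N by case/orP: ijk => //; rewrite il leqNgt lk.
    by rewrite il ltnNge (ltnW jk) (ltn_ordF (ltn_trans lk jk)).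
  have [/tk-> //|ik] := leqP k i.
  have jk : (k < j)%N by case/orP: ijk => //; rewrite leqNgt ik.
  by rewrite !ltn_ordF // (ltn_trans _ jk) // tlt.
rewrite hE; case: eqP => [->|il]; first by rewrite ltnn ltn_ordF.
have [/tk-> //|ik] := leqP k i; by rewrite !ltn_ordF // tlt.
Qed.

Lemma row_change_column h w : h \in mirabolic k -> (forall i, ent h i k = (i == k)%:R) ->
  w \in column k -> (h^-1 * w * h)%g \in column k.
Proof.
move=> hH hk wN; apply/columnP => i j ijk.
have h'H : (h^-1)%g \in mirabolic k by rewrite groupV.
have whE b : ent (w * h)%g b j = ent h b j + (if (b < k)%N then ent w b k *+ (j == k) else 0).
  case: ltnP => bk; last by rewrite (ent_column_mul_ge _ _ wN) // addr0.
  rewrite (ent_column_mul _ _ wN) // (mirabolicP _ _ hH k j) ?leqnn // eq_sym.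
  by rewrite mulr_natr.
rewrite -mulgA entM; under eq_bigr => b _ do rewrite whE mulrDr.
rewrite big_split /= -entM mulVg ent1 [X in _ + X]big1 ?addr0 // => b _.
have [jk|] := eqVneq j k; last by case: ifP; rewrite ?mulr0n mulr0.
move: ijk; rewrite jk eqxx /= => ki; rewrite (mirabolicP _ _ h'H i b) ?ki //.
case: ltnP => bk; last by rewrite mulr0.
by rewrite eq_sym ltn_ordF ?mul0r // (leq_trans bk).
Qed.

Lemma dot_row_change h w : (forall i, ent h i k = (i == k)%:R) ->
  (forall j, (j < k)%N -> ent h l j = a 0 j) -> h \in mirabolic k ->
  w \in column k -> dot k a (h^-1 * w * h)%g = ent w l k.
Proof.
move=> hk hl hH wN; set w' := (_ * w * h)%g.
have w'N : w' \in column k by apply: row_change_column.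
have e : (h * w' = w * h)%g by rewrite /w' !mulgA mulgV mul1g.
have lk : (l < k)%N by rewrite kl.
have := congr1 (fun g => ent g l k) e;
rewrite (ent_column_mul _ _ wN) // !hk eqxx (ltn_ordF lk).
rewrite add0r mulr1 => <-; rewrite entM (bigID (fun i : 'I_n => (i < k)%N)) /=.
rewrite [X in _ + X]big1 ?addr0 => [|i].
  by apply: eq_bigr => i ik; rewrite hl.
rewrite -leqNgt leq_eqVlt => /orP[/eqP/val_inj<-|ki].
  by rewrite hk (ltn_ordF lk) mul0r.
by rewrite (columnP _ _ w'N) ?(ltnW ki) ?orbT // eq_sym (ltn_ordF ki) mulr0.
Qed.
End RowChange.
End Mirabolic.

(** * Submodules are determined by their eigenvectors *)

(** A nonzero coordinate of F over its prime field, composed with the powers of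
    the root of unity. *)
Lemma nontriv_char_exists (F : finFieldType) (R : idomainType) (p : nat) (z : R) :
  p \in [pchar F] -> p.-primitive_root z -> exists psi : F -> R, nontriv_char psi.
Proof.
move=> charF zprim; have p_prime := pcharf_prime charF.
pose V : vectType 'F_p := pPrimeCharType charF.
have V1 : (1 : V) != 0 by apply: oner_neq0.
pose X := vbasis (fullv : {vspace V}).
have [i ci] : exists i, coord X i (1 : V) != 0.
  apply/existsP; apply: contraR V1 => /existsPn c0.
  rewrite (coord_vbasis (memvf (1 : V))) big1 // => i _.
  by have /negPn/eqP-> := c0 i; rewrite scale0r.
exists (fun x : F => z ^+ (coord X i (x : V) : nat)); split.
- by rewrite (_ : coord X i _ = 0) ?expr0 //; apply: linear0.
- move=> x y; rewrite -exprD -(prim_expr_mod zprim (_ + _)).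
  have -> : coord X i (x + y : V) = coord X i (x : V) + coord X i (y : V).
    exact: linearD.
  have addE (a b : 'F_p) : (a + b)%R = ((a + b) %% p)%N :> nat.
    by rewrite -[X in (_ %% X)%N](Fp_cast p_prime).
  by rewrite addE.
exists 1; rewrite -(prim_order_dvd zprim) gtnNdvd //; first by rewrite lt0n.
by rewrite -[X in (_ < X)%N](Fp_cast p_prime) ltn_ord.
Qed.

Section CharSum.
Variables (m : nat) (F : finFieldType) (R : idomainType) (psi : F -> R).
Hypothesis psiP : nontriv_char psi.
Variable k : 'I_m.+1.

(** Orthogonality: translating a changes the sum by a factor, which is not 1 for
    a suitable translation unless u is trivial. *)
Lemma sum_dot u : u \in column F k ->
  \sum_a psi (- dot k a u) = (#|{: 'rV[F]_m.+1}| * (u == 1%g))%:R.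
Proof.
move=> uN; have [psi0 psiD [c c1]] := psiP.
have [->|u1] := eqVneq u 1%g.
  rewrite muln1 (eq_bigr (fun=> 1)) => [|a _]; last by rewrite dot1 oppr0 psi0.
  by rewrite sumr_const.
have [i ik ui] := dot_neq1 uN u1; rewrite muln0.
pose b : 'rV[F]_m.+1 := \row_j (- (c / ent u i k) *+ (j == i)).
have dotb : dot k b u = - c.
  rewrite /dot (bigD1 i) //= mxE eqxx mulr1n mulNr mulfVK // big1 ?addr0 // => j.
  by case/andP=> _ /negbTE ji; rewrite mxE ji mulr0n mul0r.
set S := \sum_a _; suff /eqP : (1 - psi c) * S = 0.
  by rewrite mulf_eq0 subr_eq0 eq_sym (negbTE c1) => /eqP.
rewrite mulrBl mul1r; apply/eqP; rewrite subr_eq0; apply/eqP.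
rewrite /S [LHS](reindex_inj (addrI b)) /= mulr_sumr; apply: eq_bigr => a _.
by rewrite dotD dotb opprD opprK psiD.
Qed.
End CharSum.

Section Submodules.
Variables (m : nat) (F : finFieldType) (R : idomainType) (ell : nat).
Local Notation n := m.+1.
Local Notation G := (GLfin m F).
Local Notation U := (unip m F).
Local Notation q := #|F|.
Local Notation RG := (galg R G).
Local Notation eps := (steinberg_gen m F R).
Local Notation act g := (gelt R g).
Local Notation idem := (@idem m F R).
Local Notation gvec := (@gvec m F R).
Implicit Types (x y : RG) (r s : R) (J : pred nat).

Hypothesis ell_prime : prime ell.
Hypothesis ell_q : coprime ell q.

Definition ell_divides r := exists s, r = ell%:R * s.
Hypothesis ell_ndivides1 : ~ ell_divides 1.
Hypothesis ell_divides_or_inv : forall r, ell_divides r \/ exists s t, r * s = 1 + ell%:R * t.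

Lemma ell_divides_mul r s : ell_divides (r * s) -> ell_divides r \/ ell_divides s.
Proof.
case=> t rs; have [|[r' [t' e]]] := ell_divides_or_inv r; first by left.
right; exists (r' * t - t' * s).
transitivity (r * s * r' - ell%:R * t' * s); last by rewrite rs; ring.
by rewrite mulrAC e; ring.
Qed.

Lemma ell_divides_nat (k : nat) : coprime ell k -> ~ ell_divides k%:R.
Proof.
move=> ck [s ks]; apply: ell_ndivides1.
have k0 : (0 < k)%N.
  by case: k ck {ks} => //; rewrite /coprime gcdn0 => /eqP e; move: ell_prime; rewrite e.
have [a b e _] := egcdnP ell k0.
rewrite gcdnC (eqP ck) in e.
exists (a%:R * s - b%:R); rewrite mulrBr mulrCA -ks -!natrM e natrD mulnC.
by rewrite addrAC subrr add0r.
Qed.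

Lemma ell_divides_qpow (k : nat) : ~ ell_divides (q ^ k)%:R.
Proof. by apply: ell_divides_nat; apply: coprimeXr. Qed.

Definition steinberg_mem x := exists a, x = a * eps.

(** The preimages in RG of the submodules of L = I / ell I. *)
Record lsub (T : RG -> Prop) : Prop := LSub {
  lsub_mem : forall x, T x -> steinberg_mem x;
  lsub0 : T 0;
  lsubD : forall x y, T x -> T y -> T (x + y);
  lsubM : forall a x, T x -> T (a * x);
  lsub_ell : forall x, steinberg_mem x -> T (gscale ell%:R x) }.

Section OneSub.
Variable T : RG -> Prop.
Hypothesis TP : lsub T.

Lemma lsubZ r x : T x -> T (gscale r x).
Proof. by move=> Tx; rewrite gscaleE; apply: lsubM. Qed.

Lemma lsub_sum (I : Type) (l : seq I) (P : pred I) (f : I -> RG) :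
  (forall i, P i -> T (f i)) -> T (\sum_(i <- l | P i) f i).
Proof. by move=> h; elim/big_ind: _ => //; [exact: lsub0|exact: lsubD]. Qed.

(** A scalar that ell does not divide is invertible modulo ell. *)
Lemma lsub_unit r x : ~ ell_divides r -> steinberg_mem x -> T (gscale r x) -> T x.
Proof.
move=> nr xI Trx; have [//|[s [t e]]] := ell_divides_or_inv r.
have -> : x = gscale s (gscale r x) + gscale (- t) (gscale ell%:R x).
  rewrite !gscaleA -gscaleDl [s * r]mulrC e.
  by rewrite mulNr [t * _]mulrC addrK gscale1.
by apply: (lsubD TP); apply: lsubZ => //; apply: lsub_ell.
Qed.

Lemma lsub_ell_divides r x : ell_divides r -> steinberg_mem x -> T (gscale r x).
Proof.
case=> s -> xI; rewrite mulrC -gscaleA; apply: lsubZ; exact: lsub_ell.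
Qed.

Lemma lsub_act g x : T (act g * x) -> T x.
Proof.
move=> /(lsubM TP (act g^-1%g)); rewrite mulrA -geltM mulVg.
by rewrite (gelt1 R G) mul1r.
Qed.
End OneSub.

Section Eigenvectors.
Variable psi : F -> R.
Hypothesis psiP : nontriv_char psi.
Let psi0 : psi 0 = 1. Proof. by case: psiP. Qed.
Let psiD : {morph psi : c d / c + d >-> c * d}. Proof. by case: psiP. Qed.

Lemma gvec_mem J : steinberg_mem (gvec psi J).
Proof. by exists (idem psi J). Qed.

Variables S T : RG -> Prop.
Hypotheses (SP : lsub S) (TP : lsub T).

Definition eigen (D : {set G}) J x :=
  forall u, u \in D -> act u * x = gscale (psi (superdiag J u)) x.

Section Step.
Variable k : 'I_n.

(** Up to the order of the column subgroup, the component of x on which the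
    column acts by the character of a. *)
Definition column_part (a : 'rV[F]_n) x : RG :=
  \sum_(u in column F k) gscale (psi (- dot k a u)) (act u * x).

Lemma column_part_sum x :
  \sum_a column_part a x = gscale #|{: 'rV[F]_n}|%:R x.
Proof.
have inner u : u \in column F k ->
    \sum_a gscale (psi (- dot k a u)) (act u * x) =
    gscale (#|{: 'rV[F]_n}| * (u == 1%g))%:R (act u * x).
  by move=> uN; rewrite -(sum_dot psiP uN) gscale_suml.
have N1 : 1%g \in column F k := group1 (column_group F k).
rewrite exchange_big (eq_bigr _ inner) (bigD1 1%g N1) /= eqxx muln1.
rewrite (gelt1 R G) mul1r big1 ?addr0 // => u /andP[_ /negbTE->].
by rewrite muln0 gscale0l.
Qed.

Lemma column_part_eigen a x w : w \in column F k ->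
  act w * column_part a x = gscale (psi (dot k a w)) (column_part a x).
Proof.
move=> wN; rewrite /column_part mulr_sumr gscale_sumr.
rewrite [RHS](reindex_inj (mulgI w)) /=; apply: eq_big => [u|u uN].
  by rewrite groupMl.
have e : psi (dot k a w) * psi (- dot k a (w * u)%g) = psi (- dot k a u).
  by rewrite dotM // opprD psiD mulrA char_mulN // mul1r.
by rewrite gscaleAr gscaleA e geltM mulrA.
Qed.

Lemma conj_eigen J h x : h \in mirabolic F k -> eigen (last_columns m F k.+1) J x ->
  eigen (last_columns m F k.+1) J (act h * x).
Proof.
move=> hH xJ u uk; have h'H : (h^-1)%g \in mirabolic F k by rewrite groupV.
have := mirabolic_last_columns h'H uk; rewrite invgK => uk'.
rewrite gelt_conj (xJ _ uk') gscaleAr; congr (gscale (psi _) _).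
by have := superdiag_mirabolic J h'H uk; rewrite invgK.
Qed.

Lemma eigenD D J x y : eigen D J x -> eigen D J y -> eigen D J (x + y).
Proof.
move=> xJ yJ u uD; rewrite mulrDr xJ // yJ //.
by rewrite gscaleDr.
Qed.

Lemma eigenZ D J r x : eigen D J x -> eigen D J (gscale r x).
Proof. by move=> xJ u uD; rewrite gscaleAr xJ // !gscaleA mulrC. Qed.

Lemma column_part_last J a x : eigen (last_columns m F k.+1) J x ->
  eigen (last_columns m F k.+1) J (column_part a x).
Proof.
move=> xJ; rewrite /column_part; elim/big_ind: _ => [|y z|u uN].
- move=> u _; by rewrite mulr0 gscale0r.
- exact: eigenD.
by apply/eigenZ/conj_eigen => //; apply: column_mirabolic.
Qed.

(** The columns from k on factor through column k and the later ones. *)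
Lemma eigen_column J x (b : bool) : eigen (last_columns m F k.+1) J x ->
  (forall w, w \in column F k ->
     act w * x = gscale (psi (superdiag (fun l => if l == k then b else false) w)) x) ->
  eigen (last_columns m F k) (fun l => if l == k :> nat then b else J l) x.
Proof.
move=> xJ xk u /last_columns_factor[w [v [wN vk ->]]].
set J' := fun l : nat => _; set Jb := fun l : nat => _ in xk.
have -> : superdiag J' (w * v)%g = superdiag Jb w + superdiag J v.
  case/last_columnsP: (vk) => vU _.
  rewrite superdiagM //; last exact: column_unip wN.
  congr (_ + _).
    apply: eq_bigr => i _; apply: eq_bigr => j _; rewrite /J' /Jb.
    case: (eqVneq (j : nat) k) => [//|jk]; rewrite andbF.
    rewrite (columnP _ _ wN i j); last by rewrite -val_eqE /= jk.
    case: (eqVneq i j) => [->|_]; last by rewrite /= mulr0n !mul0rn.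
    by rewrite (ltn_eqF (ltnSn j)).
  apply: (eq_superdiag vk) => l kl; rewrite /J'.
  by case: eqP => // lk; rewrite lk ltnn in kl.
by rewrite geltM -mulrA xJ // gscaleAr xk // gscaleA psiD mulrC.
Qed.

(** The components of x under column k add up to x times a power of q, so one of
    them lies outside T.  If its character is nontrivial, row_change moves it to
    the character reading the superdiagonal entry, while the columns after k
    keep acting as before. *)
Lemma eigen_step J x : S x -> ~ T x -> eigen (last_columns m F k.+1) J x ->
  exists J' y, [/\ S y, ~ T y & eigen (last_columns m F k) J' y].
Proof.
move=> Sx Tx xJ; have xI := lsub_mem SP Sx.
have [a Ta] : exists a, ~ T (column_part a x).
  apply: contrapT => /forallNP h; apply: Tx.
  apply: (@lsub_unit _ TP #|{: 'rV[F]_n}|%:R) => //.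
    by rewrite card_mx; apply: ell_divides_qpow.
  by rewrite -column_part_sum; apply: lsub_sum => // a _; apply: contrapT; exact: h.
have Sa : S (column_part a x).
  by apply: lsub_sum => // u _; apply: lsubZ => //; apply: lsubM.
have aJ := column_part_last a xJ.
have superdiag_col w (b : bool) : w \in column F k ->
    superdiag (fun l => if l == k then b else false) w =
    (\sum_(l : 'I_n | k == l.+1 :> nat) ent w l k) *+ b.
  move=> wN; rewrite /superdiag -sumrMnl [RHS]big_mkcond; apply: eq_bigr => i _.
  rewrite (bigD1 k) //= eqxx big1 ?addr0 => [|j jk]; last first.
    by rewrite (_ : (j == k :> nat) = false) ?andbF // val_eqE (negbTE jk).
  by case: eqP => //=; rewrite mul0rn.
have [/exists_inP[i0 i0k a0]|/exists_inPn a0] :=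
  boolP [exists i0 in [pred i : 'I_n | (i < k)%N], a 0 i0 != 0]; last first.
  exists (fun l => if l == k :> nat then false else J l), (column_part a x); split=> //.
  apply: eigen_column => // w wN; rewrite column_part_eigen // superdiag_col // mulr0n.
  congr (gscale (psi _) _); apply: big1 => i ik.
  by have := a0 i ik; rewrite negbK => /eqP->; rewrite mul0r.
have k0 : (0 < k)%N by apply: leq_ltn_trans i0k.
have ltl : (k.-1 < n)%N by apply: leq_ltn_trans (leq_pred k) (ltn_ord k).
pose l := Ordinal ltl; have kl : k = l.+1 :> nat by rewrite /= prednK.
have [h [hH hk hl]] := row_change kl i0k a0.
exists (fun l => if l == k :> nat then true else J l), (act h * column_part a x); split.
- exact: lsubM.
- by move=> /(lsub_act TP).
apply: eigen_column; first exact: conj_eigen.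
move=> w wN; rewrite superdiag_col // mulr1n (big_pred1 l) => [|i]; last first.
  by rewrite /= kl eqSS eq_sym.
have wN' := row_change_column hH hk wN.
rewrite gelt_conj (column_part_eigen _ _ wN').
by rewrite gscaleAr (dot_row_change kl hk hl hH wN).
Qed.
End Step.

Lemma eigen_exists x : S x -> ~ T x ->
  exists J y, [/\ S y, ~ T y & eigen U J y].
Proof.
move=> Sx Tx.
have [J [y [Sy Ty yJ]]] : exists J y, [/\ S y, ~ T y & eigen (last_columns m F 0) J y].
  suff : forall k, (k <= n)%N -> exists J y,
      [/\ S y, ~ T y & eigen (last_columns m F (n - k)) J y].
    by move=> /(_ n (leqnn n)); rewrite subnn.
  elim=> [_|k IHk kn].
    exists pred0, x; split=> // u /last_columnsP[_ un].
    have -> : u = 1%g by apply: entP => i j; rewrite un ?subn0 // ent1.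
    by rewrite superdiag1 psi0 gscale1 (gelt1 R G) mul1r.
  have [J [y [Sy Ty yJ]]] := IHk (ltnW kn).
  have lt_kn : (n - k.+1 < n)%N by rewrite ltn_subrL.
  have e : (n - k)%N = (Ordinal lt_kn).+1 by rewrite /= subnSK.
  by rewrite e in yJ; apply: (eigen_step Sy Ty yJ).
exists J, y; split=> // u uU; apply: yJ.
by apply/last_columnsP; split.
Qed.

(** Diagonalizing the columns from the last to the first gives an eigenvector of
    U in S and outside T.  Its multiple by a power of q is its own projection,
    hence a multiple of gvec J by idem_gvec; neither factor is divisible by ell. *)
Theorem separating_gvec x : S x -> ~ T x -> exists J, S (gvec psi J) /\ ~ T (gvec psi J).
Proof.
move=> Sx Tx; have [J [y [Sy Ty yJ]]] := eigen_exists Sx Tx.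
have [b [bU bE]] : exists b, unip_supp b /\ y = b * eps.
  have [a ->] := lsub_mem SP Sy; have [b bU e] := steinberg_span a.
  by exists b.
have yE : gscale (q ^ coinversions (1%g : 'S_n))%:R y = gscale (ucoef psi J b) (gvec psi J).
  rewrite -idem_gvec // -bE [idem psi J]galg_sum mulr_suml.
  rewrite (bigID (fun u => u \in U)) /= [X in _ + X]big1 ?addr0 => [|u uU]; last first.
    by rewrite ffunE (negbTE uU) gscaleAl gscale0l.
  rewrite (eq_bigr (fun=> y)) => [|u uU]; last first.
    rewrite ffunE uU gscaleAl yJ // gscaleA mulrC char_mulN // gscale1 //.
  by rewrite -card_unip sumr_const gscale_nat.
have nc : ~ ell_divides (ucoef psi J b).
  move=> dc; apply: Ty; apply: (lsub_unit TP (@ell_divides_qpow (coinversions (1%g : 'S_n)))).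
    exact: lsub_mem SP _ Sy.
  by rewrite yE; apply: lsub_ell_divides => //; apply: gvec_mem.
exists J; split.
  by apply: (lsub_unit SP nc (gvec_mem J)); rewrite -yE; apply: lsubZ.
move=> Tg; apply: Ty; apply: (lsub_unit TP (@ell_divides_qpow (coinversions (1%g : 'S_n)))).
  exact: lsub_mem SP _ Sy.
by rewrite yE; apply: lsubZ.
Qed.
End Eigenvectors.
End Submodules.

(** * The filtration on eigenvectors *)

Section Filtration.
Variables (m : nat) (F : finFieldType) (R : idomainType) (ell : nat).
Local Notation n := m.+1.
Local Notation G := (GLfin m F).
Local Notation B := (borelg m F).
Local Notation q := #|F|.
Local Notation RG := (galg R G).
Local Notation eps := (steinberg_gen m F R).
Local Notation idem := (@idem m F R).
Local Notation gvec := (@gvec m F R).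
Local Notation pindex := (pindex m F).
Local Notation lsub := (@lsub m F R ell).
Local Notation ell_divides := (@ell_divides R ell).
Implicit Types (x y : RG) (r s : R) (J : pred nat).

Hypothesis ell_prime : prime ell.
Hypothesis ell_q : coprime ell q.
Hypothesis charR0 : forall k : nat, (k%:R == 0 :> R) = (k == 0)%N.
Hypothesis ell_ndivides1 : ~ ell_divides 1.
Hypothesis ell_divides_or_inv : forall r, ell_divides r \/ exists s t, r * s = 1 + ell%:R * t.

Let q1 : (1 < q)%N. Proof. exact: card_finRing_gt1. Qed.

Lemma card_borel_neq0 : #|B|%:R != 0 :> R.
Proof. by rewrite charR0 -lt0n (cardG_gt0 (borel_group m F)). Qed.

Lemma ell_neq0 : ell%:R != 0 :> R.
Proof. by rewrite charR0 -lt0n prime_gt0. Qed.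

Lemma ell_divides_sign (b : bool) r : ell_divides ((-1) ^+ b * r) -> ell_divides r.
Proof.
case=> s e; exists ((-1) ^+ b * s).
by rewrite mulrCA -e mulrA -expr2 sqrr_sign mul1r.
Qed.

Lemma block_pos_gt0 J k : (0 < block_pos J k)%N.
Proof. by case: k => //= k; case: (J _). Qed.

Lemma prod_qint_gt0 J : (0 < \prod_(i < n) qint q (block_pos J i))%N.
Proof. by apply: prodn_gt0 => i; rewrite qint_gt0 ?block_pos_gt0 // ltnW. Qed.

Lemma pindex_gt0 J : (0 < pindex J)%N.
Proof.
have := pindexE m F J; case: (posnP (pindex J)) => // ->; rewrite mul0n => e.
have : (0 < \prod_(i < n) qint q i.+1)%N.
  by apply: prodn_gt0 => i; rewrite qint_gt0 // ltnW.
by rewrite -e.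
Qed.

Lemma logn_prod (I : Type) (l : seq I) (f : I -> nat) : (forall i, 0 < f i)%N ->
  logn ell (\prod_(i <- l) f i) = (\sum_(i <- l) logn ell (f i))%N.
Proof.
move=> f0; elim: l => [|i l IHl]; first by rewrite !big_nil logn1.
by rewrite !big_cons lognM ?IHl // prodn_gt0.
Qed.

Definition pval J := logn ell (pindex J).

Lemma pval_qdefect J : (pval J + qdefect q ell n J = qfval q ell n)%N.
Proof.
have := congr1 (logn ell) (pindexE m F J).
rewrite lognM ?pindex_gt0 ?prod_qint_gt0 // !logn_prod // => i.
  by rewrite qint_gt0 // ltnW.
by rewrite qint_gt0 ?block_pos_gt0 // ltnW.
Qed.

Section Psi.
Variable psi : F -> R.
Hypothesis psiP : nontriv_char psi.

Lemma gvec_coef_unit c k1 k2 (b : bool) :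
  c * (q ^ k1)%:R = (-1) ^+ b * (q ^ k2)%:R -> ~ ell_divides c.
Proof.
move=> e [s cs]; apply: (ell_divides_qpow ell_prime ell_q ell_ndivides1 (k := k2)).
apply: (@ell_divides_sign b); rewrite -e cs; exists (s * (q ^ k1)%:R).
by rewrite mulrA.
Qed.

(** The coefficient in gvec_generates is prime to ell. *)
Lemma gvec_sub (T : RG -> Prop) J J' : lsub T ->
  (forall k : nat, (0 < k < n)%N -> J' k -> J k) ->
  T (gvec psi J) -> T (gvec psi J').
Proof.
move=> TP sub TJ; have [g [c [e [k1 [k2 [b cE]]]]]] := gvec_generates psiP sub.
apply: (lsub_unit ell_divides_or_inv TP (gvec_coef_unit cE)); first exact: gvec_mem.
by rewrite -e; apply: (lsubM TP); apply: (lsubM TP).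
Qed.

(** By reciprocity the reverse coefficient differs from the one in
    gvec_generates by a quotient of indices of the same valuation.  The
    character is inverted in passing to the adjoint, so one starts from the
    opposite character. *)
Lemma gvec_sup (T : RG -> Prop) J J' : lsub T ->
  (forall k : nat, (0 < k < n)%N -> J' k -> J k) -> pval J = pval J' ->
  T (gvec psi J') -> T (gvec psi J).
Proof.
move=> TP sub vJ TJ'; pose chi c := psi (- c); have chiP := nontriv_charN psiP.
have [g [c [e [k1 [k2 [b cE]]]]]] := gvec_generates (chiP : nontriv_char chi) sub.
have [c' []] := gvec_reciprocity chiP card_borel_neq0 e.
have -> : (fun d : F => chi (- d)) = psi by apply/funext => d; rewrite /chi opprK.
move=> e' cc'.
suff dc' : ~ ell_divides c'.
  apply: (lsub_unit ell_divides_or_inv TP dc'); first exact: gvec_mem.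
  by rewrite -e'; apply: (lsubM TP); apply: (lsubM TP); exact: TJ'.
move: cc'; case: (pfactor_coprime ell_prime (pindex_gt0 J')) => k' ck' ->.
case: (pfactor_coprime ell_prime (pindex_gt0 J)) => k ck ->.
rewrite -!/(pval _) vJ !natrM !mulrA => /mulIf cc' dc'.
have [||] := @ell_divides_mul R ell ell_divides_or_inv c k'%:R.
- rewrite cc' ?natrX ?expf_neq0 ?ell_neq0 //.
  by case: dc' => s ->; exists (s * k%:R); rewrite mulrA.
- exact: gvec_coef_unit cE.
exact: ell_divides_nat.
Qed.

Definition gen J J' := forall T, lsub T -> T (gvec psi J) -> T (gvec psi J').

Lemma gen_of_pval (e : nat) J J' : (1 < e)%N -> (ell %| qint q e)%N ->
  (forall i : nat, (1 < i)%N -> (ell %| qint q i)%N -> (e <= i)%N) ->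
  (pval J <= pval J')%N ->
  (n %/ e <= ell)%N \/ (qdefect q ell n J' <= qval q ell e * ell)%N -> gen J J'.
Proof.
move=> e2 e_dvd e_min vJ.
have qle K : (qdefect q ell n K <= qfval q ell n)%N.
  by rewrite -(pval_qdefect K) leq_addl.
apply: (gens_of_qdefect q1 ell_prime e2 e_dvd e_min qle (gen := gen)).
- by move=> J1 J2 J3 g1 g2 T TP /(g1 T TP)/(g2 T TP).
- by move=> J1 J2 sub T TP; apply: gvec_sub.
- move=> J1 J2 sub d12 T TP; apply: gvec_sup => //.
  by have := pval_qdefect J1; rewrite d12 -(pval_qdefect J2) => /addIn.
by have := pval_qdefect J; have := pval_qdefect J'; lia.
Qed.

(** The condition defining I(c), multiplied by |B| so as to stay in R. *)
Definition form_filt c x := steinberg_mem x /\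
  forall y, steinberg_mem y -> exists r, gform x y = #|B|%:R * (ell%:R ^+ c * r).

(** The preimage of L(c) in RG. *)
Definition form_filt_ell c x :=
  exists x1 x2, [/\ form_filt c x1, steinberg_mem x2 & x = x1 + gscale ell%:R x2].

Lemma form_filt_left c a x : form_filt c x -> form_filt c (a * x).
Proof.
case=> -[b ->] fx; split=> [|y [b' ->]]; first by exists (a * b); rewrite mulrA.
rewrite gform_mul mulrA; apply: fx; by exists (gadj a * b').
Qed.

(** All values of the form at gvec J are multiples of its value at the
    generator, |B| [G : P_J].  Conversely, if gvec J is congruent modulo ell I to
    a vector of I(c), projecting the latter to the character of J gives a
    multiple of gvec J in I(c) by a scalar prime to ell. *)
Lemma gvec_filt c J : form_filt_ell c (gvec psi J) <-> (c <= pval J)%N.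
Proof.
have [k ck pE] := pfactor_coprime ell_prime (pindex_gt0 J).
rewrite -/(pval J) in pE; split=> [[x1 [x2 [[[a1 x1E] fx1] [a2 x2E] e]]]|cJ]; last first.
  exists (gvec psi J), 0; split; last by rewrite gscale0r addr0.
    split=> [|y [b ->]]; first exact: gvec_mem.
    have [b' b'U ->] := steinberg_span b.
    rewrite gform_mul gadj_idem gformC idem_gvec //; last exact: nontriv_charN.
    rewrite gform_scale gform_gvec; last exact: nontriv_charN.
    exists (ucoef (fun c => psi (- c)) J b' * (k * ell ^ (pval J - c))%:R).
    have -> : pindex J = (ell ^ c * (k * ell ^ (pval J - c)))%N.
      by rewrite mulnCA -expnD subnKC.
    by rewrite natrM [X in _ * (_ * X) = _]natrM natrX mulrCA; congr (_ * _); rewrite mulrCA.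
  by exists 0; rewrite mul0r.
rewrite leqNgt; apply/negP => vc.
have idem_supp_U : unip_supp (idem psi J) by move=> g gU; rewrite ffunE (negbTE gU).
have [b2 b2U e2] := steinberg_span a2.
pose N : R := (q ^ coinversions (1%g : 'S_n))%:R; pose c2 := ucoef psi J b2.
have coefN : ucoef psi J (idem psi J) = N.
  rewrite /N -card_unip -sum1_card natr_sum; apply: eq_bigr => u uU.
  by rewrite ffunE uU mulrC char_mulN.
have projE : gscale (N - ell%:R * c2) (gvec psi J) = idem psi J * x1.
  have := congr1 (fun z => idem psi J * z) e.
  rewrite /= mulrDr gscaleAr x2E e2 [LHS](idem_gvec psiP J idem_supp_U) coefN.
  rewrite (idem_gvec psiP J b2U) gscaleA => /eqP; rewrite -subr_eq => /eqP <-.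
  by rewrite gscaleDl; congr (_ + _);
    apply/ffunP => g; rewrite [LHS]ffunE goppE [X in _ = - X]ffunE mulNr.
have [_ /(_ eps)] : form_filt c (idem psi J * x1)
  by apply: form_filt_left; split=> //; exists a1.
case=> [|r]; first by exists 1; rewrite mul1r.
rewrite -projE gform_scale gform_gvec // natrM mulrCA => /(mulfI card_borel_neq0).
rewrite pE -(subnKC (ltnW vc)) natrM natrX exprD mulrA [_ * r]mulrAC -[RHS]mulrA.
rewrite [RHS]mulrC => /(mulIf (expf_neq0 _ ell_neq0)) e3.
have [||] := @ell_divides_mul R ell ell_divides_or_inv (N - ell%:R * c2) k%:R.
- rewrite e3; exists (ell%:R ^+ (c - pval J).-1 * r).
  by rewrite mulrA -exprS prednK ?subn_gt0 // mulrC.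
- case=> t Nt; apply: (ell_divides_qpow ell_prime ell_q ell_ndivides1
      (k := coinversions (1%g : 'S_n))).
  by exists (t + c2); rewrite mulrDr -Nt subrK.
exact: ell_divides_nat.
Qed.
End Psi.
End Filtration.

(** * Series of submodules *)

Section SubmoduleOrder.
Variables (A : pzRingType) (M : lmodType A).
Implicit Types (N S T W : submod M) (x y : M).

Lemma submod0 S : S 0. Proof. exact: (submodP S).1. Qed.

Lemma submod_add S x y : S x -> S y -> S (x + y).
Proof. by move=> Sx Sy; rewrite -[x]scale1r submod_lin. Qed.

Lemma submod_scale S a x : S x -> S (a *: x).
Proof. by move=> Sx; rewrite -[_ *: _]addr0; apply: submod_lin (submod0 S). Qed.

Lemma submod_le_trans S T W : submod_le S T -> submod_le T W -> submod_le S W.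
Proof. by move=> ST TW x /ST/TW. Qed.

Lemma submod_le_anti S T : submod_le S T -> submod_le T S -> S = T.
Proof. by move=> ST TS; apply: submod_eqP => x; apply/idP/idP; [exact: ST|exact: TS]. Qed.

Lemma zero_submodE x : zero_submod M x <-> x = 0.
Proof. by split=> [/asboolP|->]; last exact/asboolP. Qed.

Lemma zero_submod_le S : submod_le (zero_submod M) S.
Proof. by move=> x /zero_submodE->; apply: submod0. Qed.

Lemma full_submod_ge S : submod_le S (full_submod M).
Proof. by move=> x _; apply/asboolP. Qed.

End SubmoduleOrder.

Section Covers.
Variables (A : pzRingType) (M : lmodType A).
Implicit Types (N S T W : submod M) (x y : M).

Lemma quotm_piP S (y : quotm S) : exists x, y = quotm_pi S x.
Proof. by exists (quotm_repr y); rewrite quotm_reprK. Qed.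

Lemma quotm_pi0 S x : quotm_pi S x = 0 <-> S x.
Proof.
have pi0 : quotm_pi S 0 = 0.
  by apply: (addrI (quotm_pi S 0)); rewrite -quotm_piD !addr0.
by rewrite -pi0 quotm_eqP subr0.
Qed.

Lemma factorP S T x : submod_le S T -> factor S T (quotm_pi S x) <-> T x.
Proof.
move=> ST; split=> [/asboolP[t Tt /quotm_eqP xt]|Tx]; last by apply/asboolP; exists x.
by rewrite -[x](subrK t); apply: submod_add => //; apply: ST.
Qed.

Lemma factor_le S T W : submod_le T W -> submod_le (factor S T) (factor S W).
Proof. by move=> TW y /asboolP[t /TW Wt ->]; apply/asboolP; exists t. Qed.

Lemma factor_neq0 S T : submod_le S T -> S <> T -> factor S T <> zero_submod (quotm S).
Proof.
move=> ST nST f0; apply: nST; apply: submod_le_anti => // x Tx.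
by apply/quotm_pi0/zero_submodE; rewrite -f0; apply/(factorP _ ST).
Qed.

Lemma preim_quotE S (W : submod (quotm S)) x : preim_quot W x <-> W (quotm_pi S x).
Proof. by split=> /asboolP. Qed.

Definition covers S T :=
  [/\ submod_le S T, S <> T &
      forall W, submod_le S W -> submod_le W T -> W = S \/ W = T].

(** The submodules of T/S are those lying between S and T. *)
Lemma irreducible_factorP S T : irreducible_factor S T <-> covers S T.
Proof.
split=> [[ST [f0 simple_f]]|[ST nST cov]].
  split=> // [e|W SW WT].
    apply: f0; apply: submod_le_anti; last exact: zero_submod_le.
    move=> y /asboolP[t Tt ->]; apply/zero_submodE/quotm_pi0.
    by rewrite e.
  case: (simple_f _ (factor_le (S := S) WT)) => fW; [left|right].
    apply: submod_le_anti => // x Wx.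
    by apply/quotm_pi0/zero_submodE; rewrite -fW; apply/(factorP _ SW).
  by apply: submod_le_anti => // x Tx; apply/(factorP _ SW); rewrite fW; apply/factorP.
split=> //; split=> [|W Wf]; first exact: factor_neq0.
have SW : submod_le S (preim_quot W).
  by move=> x /quotm_pi0 x0; apply/preim_quotE; rewrite x0; apply: submod0.
have WT : submod_le (preim_quot W) T.
  by move=> x /preim_quotE /Wf /(factorP _ ST).
case: (cov _ SW WT) => eW; [left|right]; apply: submod_le_anti.
- move=> y; have [x ->] := quotm_piP y => Wx; apply/zero_submodE/quotm_pi0.
  by rewrite -eW; apply/preim_quotE.
- exact: zero_submod_le.
- exact: Wf.
- move=> y /asboolP[t Tt ->]; by apply/preim_quotE; rewrite eW.
Qed.

(** T/S is then contained in every nonzero submodule of M/S, so it is the only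
    simple one. *)
Lemma socle_quot S T : submod_le S T -> S <> T ->
  (forall W, submod_le S W -> W <> S -> submod_le T W) ->
  covers S T /\ preim_quot (socle (quotm S)) = T.
Proof.
move=> ST nST least.
have cov : covers S T.
  split=> // W SW WT; case: (pselect (W = S)) => [->|nWS]; first by left.
  by right; apply: submod_le_anti => //; apply: least.
split=> //; have [_ simple_f] := (irreducible_factorP S T).2 cov.
apply: submod_le_anti => x.
  move=> /preim_quotE /asboolP[s [hs xs]]; apply/(factorP _ ST); rewrite xs.
  have {hs} : forall y : quotm S, y \in s -> factor S T y.
    move=> y /hs [W [nW0 simW] Wy].
    have SW : submod_le S (preim_quot W).
      by move=> z /quotm_pi0 z0; apply/preim_quotE; rewrite z0; apply: submod0.
    have nWS : preim_quot W <> S.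
      move=> eW; apply: nW0; apply: submod_le_anti; last exact: zero_submod_le.
      move=> z; have [z' ->] := quotm_piP z => Wz; apply/zero_submodE/quotm_pi0.
      by rewrite -eW; apply/preim_quotE.
    have fW : submod_le (factor S T) W.
      by move=> z /asboolP[t Tt ->]; apply/preim_quotE; apply: least.
    case: (simW _ fW) => [f0|->//].
    by case: simple_f => /(_ f0).
  elim: s {xs} => [_|y s IHs hs]; first by rewrite big_nil; apply: submod0.
  rewrite big_cons; apply: submod_add; first by apply: hs; rewrite mem_head.
  by apply: IHs => z zs; apply: hs; rewrite inE zs orbT.
move=> Tx; apply/preim_quotE/asboolP; exists [:: quotm_pi S x]; rewrite big_seq1.
split=> // y; rewrite inE => /eqP->; exists (factor S T) => //.
exact/(factorP _ ST).
Qed.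

Lemma composition_series_le N (s : seq (submod M)) i j : composition_series N s ->
  (i <= j < size s)%N ->
  submod_le (nth (zero_submod M) s i) (nth (zero_submod M) s j).
Proof.
case=> _ _ _ irr /andP[/subnKC <-]; elim: (j - i)%N => [|k IHk] kn.
  by rewrite addn0.
rewrite addnS in kn *; apply: submod_le_trans (IHk (ltnW kn)) _.
by have [] := irr _ kn.
Qed.

(** In a chain a submodule has at most one cover, so that the terms of a series
    are determined one after the other. *)
Lemma composition_series_unique N (s t : seq (submod M)) :
  (forall S T, submod_le S T \/ submod_le T S) ->
  composition_series N s -> composition_series N t -> t = s.
Proof.
move=> total; suff le_size s' t' : composition_series N s' -> composition_series N t' ->
    (size s' <= size t')%N /\
    forall i, (i < size s')%N -> nth (zero_submod M) t' i = nth (zero_submod M) s' i.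
  move=> cs ct; have [st e] := le_size s t cs ct; have [ts _] := le_size t s ct cs.
  apply: (@eq_from_nth _ (zero_submod M)); first by apply/eqP; rewrite eqn_leq st ts.
  by move=> i it; apply: e; apply: leq_trans it ts.
move=> {s t} cs ct.
have [s0 s_head s_last s_irr] := cs; have [t0 t_head t_last t_irr] := ct.
have eq_nth i : (i < size s')%N -> (i < size t')%N ->
    nth (zero_submod M) t' i = nth (zero_submod M) s' i.
  elim: i => [|i IHi] si ti; first by rewrite !nth0 s_head t_head.
  have e := IHi (ltnW si) (ltnW ti).
  have /irreducible_factorP := s_irr i si; have /irreducible_factorP := t_irr i ti.
  rewrite e => -[le_t nt cov_t] [le_s ns cov_s].
  case: (total (nth (zero_submod M) t' i.+1) (nth (zero_submod M) s' i.+1)) => le_ts.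
    by case: (cov_s _ le_t le_ts) => // e'; case: nt.
  by case: (cov_t _ le_s le_ts) => // e'; case: ns.
suff st : (size s' <= size t')%N.
  by split=> // i si; apply: eq_nth => //; apply: leq_trans si st.
rewrite leqNgt; apply/negP => ts.
have t1 : ((size t').-1 < size t')%N by rewrite prednK.
have e := eq_nth _ (ltn_trans t1 ts) t1; rewrite nth_last t_last in e.
have /irreducible_factorP[le_N nN _] : irreducible_factor
    (nth (zero_submod M) s' (size t').-1) (nth (zero_submod M) s' (size t').-1.+1).
  by apply: s_irr; rewrite prednK.
apply: nN; apply: submod_le_anti => //; rewrite -e -s_last -nth_last prednK //.
by apply: composition_series_le cs _; lia.
Qed.

End Covers.

Section Chains.
Variables (A : pzRingType) (M : lmodType A).
Implicit Types (N S T W : submod M) (r : seq (submod M)).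

Definition submod_leb S T := `[< submod_le S T >].

Lemma submod_lebP S T : submod_leb S T <-> submod_le S T.
Proof. by split=> /asboolP. Qed.

Lemma submod_leb_trans : transitive submod_leb.
Proof. by move=> T S W /submod_lebP ST /submod_lebP TW; apply/submod_lebP => x /ST/TW. Qed.

(** An increasing list in which all submodules occur admits no refinement. *)
Lemma composition_series_sorted r : sorted submod_leb r -> uniq r -> (forall W, W \in r) ->
  composition_series (full_submod M) r.
Proof.
move=> sorted_r uniq_r all_r; pose X := nth (zero_submod M) r.
have r0 : (0 < size r)%N.
  by apply: (@leq_ltn_trans (index (zero_submod M) r)); rewrite ?index_mem ?all_r.
have X_le i j : (i <= j)%N -> (j < size r)%N -> submod_le (X i) (X j).
  rewrite leq_eqVlt => /orP[/eqP-> _ //|ij jr].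
  apply/submod_lebP.
  by apply: (sorted_ltn_nth submod_leb_trans) => //; rewrite inE (ltn_trans ij).
have X_idx W : exists2 k, (k < size r)%N & W = X k.
  by exists (index W r); rewrite ?index_mem ?all_r // /X nth_index.
split=> //.
- have [k kr e] := X_idx (zero_submod M).
  rewrite -nth0; apply: submod_le_anti; last exact: zero_submod_le.
  by rewrite [X in submod_le _ X]e; apply: X_le.
- have [k kr e] := X_idx (full_submod M).
  rewrite -nth_last; apply: submod_le_anti; first exact: full_submod_ge.
  by rewrite [X in submod_le X _]e; apply: X_le; rewrite ?prednK //; lia.
move=> i ir; apply/irreducible_factorP; split=> [|/eqP|W le_iW le_Wi].
- by apply: X_le.
- by rewrite nth_uniq ?(ltnW ir) //; lia.
have [k kr e] := X_idx W; have [ki|ik] := leqP k i.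
  by left; apply: submod_le_anti => //; rewrite e; apply: X_le => //; apply: ltnW.
by right; apply: submod_le_anti => //; rewrite e; apply: X_le.
Qed.

Lemma chain_composition_series (X : nat -> submod M) (N : nat) :
  (forall c c', (c <= c')%N -> submod_le (X c') (X c)) ->
  (forall c, (N <= c)%N -> X c = X N) -> (forall W, exists c, W = X c) ->
  [/\ uniserial (full_submod M),
      composition_series (full_submod M) (rev (undup (mkseq X N.+1))) &
      forall t, composition_series (full_submod M) t -> t = rev (undup (mkseq X N.+1))].
Proof.
move=> X_le X_N X_all.
have total S T : submod_le S T \/ submod_le T S.
  have [c ->] := X_all S; have [c' ->] := X_all T.
  by have [/X_le|/ltnW/X_le] := leqP c c'; [right|left].
have series : composition_series (full_submod M) (rev (undup (mkseq X N.+1))).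
  apply: composition_series_sorted => [||W].
  - rewrite rev_sorted; apply: (subseq_sorted _ (undup_subseq _)).
      by move=> T S W /= TS WT; apply: submod_leb_trans WT TS.
    apply: (homo_sorted (e := leq)); last exact: iota_sorted.
    by move=> c c' cc'; apply/submod_lebP/X_le.
  - by rewrite rev_uniq undup_uniq.
  rewrite mem_rev mem_undup; have [c ->] := X_all W; apply/mapP.
  have [cN|/ltnW Nc] := leqP c N; first by exists c => //; rewrite mem_iota; lia.
  by exists N; rewrite ?(X_N c) // mem_iota; lia.
split=> [S T _ _||t t_series]; [exact: total|exact: series|].
exact: composition_series_unique series t_series.
Qed.
End Chains.

(** * Submodules of the reduction modulo ell *)

Section Reduction.
Variables (m : nat) (F : finFieldType) (R : idomainType) (ell : nat).
Local Notation n := m.+1.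
Local Notation G := (GLfin m F).
Local Notation B := (borelg m F).
Local Notation RG := (galg R G).
Local Notation lsub := (@lsub m F R ell).
Local Notation steinberg_mem := (@steinberg_mem m F R).
Local Notation form_filt_ell := (@form_filt_ell m F R ell).
Local Notation I := (steinberg_lattice n F R).
Local Notation L := (steinberg_mod n F R ell).
Local Notation pi := (@mod_pi n F R ell).
Implicit Types (x : RG) (y z : I) (S T : submod L).

(** Elements of I as members of the group algebra over GLfin. *)
Definition to_galg y : RG := val y.

Lemma to_galg_inj : injective to_galg.
Proof. by move=> y z; apply: val_inj. Qed.

Lemma to_galg_mem y : steinberg_mem (to_galg y).
Proof. by have /asboolP := valP y. Qed.

Lemma to_galg_surj x : steinberg_mem x -> exists y, to_galg y = x.
Proof.
move=> xI; have xS : steinberg_ideal n F R x by apply/asboolP.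
by exists (exist _ x xS).
Qed.

Lemma to_galgD y z : to_galg (y + z) = to_galg y + to_galg z. Proof. by []. Qed.
Lemma to_galgZ (a : RG) y : to_galg (a *: y) = a * to_galg y. Proof. by []. Qed.
Lemma to_galg_ell y : to_galg (y *+ ell) = gscale ell%:R (to_galg y).
Proof.
rewrite gscale_nat; elim: ell => [|k IHk]; first by rewrite !mulr0n.
by rewrite !mulrS to_galgD IHk.
Qed.

Lemma mod_pi_ell y : pi (y *+ ell) = 0.
Proof. by apply/quotm_pi0/asboolP; exists y. Qed.

Lemma mod_pi_eq y z : pi y = pi z -> exists t, y = z + t *+ ell.
Proof.
by move=> /quotm_eqP/asboolP[t e]; exists t; rewrite -e addrC subrK.
Qed.

(** The preimage in RG of a submodule of L. *)
Definition pull S x := exists2 y, to_galg y = x & S (pi y).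

Lemma pull_galg S y : pull S (to_galg y) <-> S (pi y).
Proof. by split=> [[z /to_galg_inj->]|]; last by exists y. Qed.

Lemma lsub_pull S : lsub (pull S).
Proof.
split=> [x [y <- _]||x x' [y <- Sy] [y' <- Sy']|a x [y <- Sy]|x].
- exact: to_galg_mem.
- by exists 0 => //; rewrite -(mul0rn _ ell) mod_pi_ell; apply: submod0.
- by exists (y + y') => //; rewrite mod_piD; apply: submod_add.
- exists (a *: y); first exact: to_galgZ.
  by rewrite -mod_scaleE; apply: submod_scale.
move=> /to_galg_surj[y <-]; exists (y *+ ell); first exact: to_galg_ell.
by rewrite mod_pi_ell; apply: submod0.
Qed.

Lemma pull_le S T : (forall x, pull S x -> pull T x) <-> submod_le S T.
Proof.
split=> [ST z Sz|ST x [y <- Sy]]; last by exists y => //; apply: ST.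
have /ST/pull_galg : pull S (to_galg (mod_repr z)) by apply/pull_galg; rewrite mod_reprK.
by rewrite mod_reprK.
Qed.

(** The fraction field serves to divide by |B| only. *)
Lemma steinberg_formE c y : #|B|%:R != 0 :> R ->
  (forall z, exists r : R, steinberg_form y z = tofrac (ell%:R ^+ c * r)) <->
  form_filt ell c (to_galg y).
Proof.
move=> B0; have formE z r : steinberg_form y z = tofrac (ell%:R ^+ c * r) <->
    gform (to_galg y) (to_galg z) = #|B|%:R * (ell%:R ^+ c * r).
  have B0' : (#|B|%:R : {fraction R}) != 0.
    by rewrite -(rmorph_nat (@tofrac R)) tofrac_eq0.
  rewrite [#|B|%:R * _]mulrC; split=> [|e].
    move=> /(canRL (divfK B0')); rewrite -(rmorph_nat (@tofrac R)) -tofracM.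
    by move=> /eqP; rewrite tofrac_eq => /eqP.
  apply: (canLR (mulfK B0')); rewrite -(rmorph_nat (@tofrac R)) -tofracM.
  by congr (tofrac _).
split=> [fy|[_ fy] z].
  split=> [|_ /to_galg_surj[z <-]]; first exact: to_galg_mem.
  by have [r /formE e] := fy z; exists r.
by have [r /formE e] := fy _ (to_galg_mem z); exists r.
Qed.

Lemma pull_filt c x : #|B|%:R != 0 :> R ->
  pull (mod_filt n F R ell c) x <-> form_filt_ell c x.
Proof.
move=> B0; split=> [[y <- /asboolP[u /asboolP[u1 [u2 [/asboolP fu1 /asboolP[t ->] ->]]] yu]]|].
  have [t' ->] := mod_pi_eq yu.
  exists (to_galg u1), (to_galg (t + t')); split.
  - exact/steinberg_formE.
  - exact: to_galg_mem.
  by rewrite -to_galg_ell -addrA -mulrnDl.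
move=> [x1 [x2 [fx1 x2I ->]]]; have [x1I _] := fx1.
have [y1 e1] := to_galg_surj x1I; have [y2 e2] := to_galg_surj x2I.
exists (y1 + y2 *+ ell); first by rewrite to_galgD to_galg_ell e1 e2.
apply/asboolP; exists (y1 + y2 *+ ell) => //; apply/asboolP.
exists y1, (y2 *+ ell); split=> //; apply/asboolP; last by exists y2.
by apply/steinberg_formE => //; rewrite e1.
Qed.
End Reduction.

(** * The submodules of the reduced Steinberg lattice *)

(** If c 0 > ... > c k are the largest values, every decreasing enumeration of
    all values starts with them. *)
Lemma decreasing_enumeration (vals : seq nat) (V k : nat) (f c : nat -> nat) :
  size (undup vals) = V ->
  (forall i, (i < V)%N -> f i \in vals) ->
  (forall i j, (i < j)%N -> (j < V)%N -> (f j < f i)%N) ->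
  (forall s, (s <= k)%N -> c s \in vals) ->
  (forall s t, (s < t)%N -> (t <= k)%N -> (c t < c s)%N) ->
  (forall v, v \in vals -> (c k <= v)%N -> exists2 s, (s <= k)%N & v = c s) ->
  (k < V)%N /\ forall i, (i <= k)%N -> f i = c i.
Proof.
move=> sizeV f_vals f_dec c_vals c_dec c_top.
have c_inj : {in iota 0 k.+1 &, injective c}.
  move=> s t; rewrite !mem_iota !add0n !ltnS => sk tk e.
  by have [/c_dec/(_ tk)|/c_dec/(_ sk)|//] := ltngtP s t; rewrite e ltnn.
have f_inj : {in iota 0 V &, injective f}.
  move=> s t; rewrite !mem_iota !add0n => sV tV e.
  by have [/f_dec/(_ tV)|/f_dec/(_ sV)|//] := ltngtP s t; rewrite e ltnn.
have kV : (k < V)%N.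
  rewrite -sizeV -(size_iota 0 k.+1) -(size_map c); apply: uniq_leq_size.
    by rewrite map_inj_in_uniq ?iota_uniq.
  by move=> v /mapP[s]; rewrite mem_iota mem_undup => /= sk ->; apply: c_vals.
split=> //.
have f_onto v : v \in vals -> exists2 j, (j < V)%N & v = f j.
  have uniq_f : uniq (map f (iota 0 V)) by rewrite map_inj_in_uniq ?iota_uniq.
  have sub_f : {subset map f (iota 0 V) <= undup vals}.
    by move=> w /mapP[j]; rewrite mem_iota mem_undup => /= jV ->; apply: f_vals.
  have [|_ f_mem] := uniq_min_size uniq_f sub_f.
    by rewrite size_map size_iota sizeV.
  rewrite -mem_undup -f_mem => /mapP[j]; rewrite mem_iota => /= jV ->.
  by exists j.
elim/ltn_ind=> i IHi ik.
have [j jV cj] := f_onto _ (c_vals i ik).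
have ij : (i <= j)%N.
  rewrite leqNgt; apply/negP => ji; have := c_dec j i ji ik.
  by rewrite cj IHi ?ltnn // (leq_trans (ltnW ji)).
have fi : (c i <= f i)%N.
  by rewrite cj; move: ij; rewrite leq_eqVlt => /orP[/eqP->//|/f_dec/(_ jV)/ltnW].
have cki : (c k <= c i)%N.
  by move: ik; rewrite leq_eqVlt => /orP[/eqP->//|/c_dec/(_ (leqnn k))/ltnW].
have [s sk fs] := c_top _ (f_vals i (leq_ltn_trans ik kV)) (leq_trans cki fi).
have [si|is_|si] := ltngtP s i; last by rewrite fs si.
  have := f_dec s i si (leq_ltn_trans ik kV).
  by rewrite fs IHi ?ltnn // (leq_trans (ltnW si)).
by have := c_dec i s is_ sk; rewrite -fs ltnNge fi.
Qed.

Section SubmoduleLattice.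
Variables (m : nat) (F : finFieldType) (R : idomainType) (ell e : nat).
Local Notation n := m.+1.
Local Notation G := (GLfin m F).
Local Notation q := #|F|.
Local Notation L := (steinberg_mod n F R ell).
Local Notation pval := (@pval m F ell).
Local Notation ell_divides := (@ell_divides R ell).
Local Notation filt := (mod_filt n F R ell).
Local Notation defect := (qdefect q ell n).
Local Notation maxval := (qfval q ell n).
Local Notation a := (qval q ell e).
Implicit Types (S T W : submod L) (J : pred nat).

Hypothesis ell_prime : prime ell.
Hypothesis ell_q : coprime ell q.
Hypothesis charR0 : forall k : nat, (k%:R == 0 :> R) = (k == 0)%N.
Hypothesis ell_ndivides1 : ~ ell_divides 1.
Hypothesis ell_divides_or_inv : forall r, ell_divides r \/ exists s t, r * s = 1 + ell%:R * t.
Hypothesis e2 : (1 < e)%N.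
Hypothesis e_dvd : (ell %| qint q e)%N.
Hypothesis e_min : forall i, (1 < i)%N -> (ell %| qint q i)%N -> (e <= i)%N.
Variable psi : F -> R.
Hypothesis psiP : nontriv_char psi.

Let q1 : (1 < q)%N. Proof. exact: card_finRing_gt1. Qed.
Let a0 : (0 < a)%N. Proof. exact: qval_e_gt0. Qed.

Lemma pvalE J : (pval J + defect J)%N = maxval.
Proof. exact: pval_qdefect. Qed.

Definition has_gvec S J := pull S (@gvec m F R psi J).

(** By separating_gvec, a submodule is known by its eigenvectors. *)
Lemma submod_leP S T : submod_le S T <-> forall J, has_gvec S J -> has_gvec T J.
Proof.
split=> [/pull_le ST J|ST]; first exact: ST.
apply/pull_le => x Sx; apply: contrapT => Tx.
have [J [SJ]] := separating_gvec ell_prime ell_q ell_ndivides1 ell_divides_or_inv psiP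
  (lsub_pull S) (lsub_pull T) Sx Tx.
by apply; apply: ST.
Qed.

Lemma has_gvec_filt c J : has_gvec (filt c) J <-> (c <= pval J)%N.
Proof.
rewrite -(gvec_filt m ell_prime ell_q charR0 ell_ndivides1 ell_divides_or_inv psiP).
exact/pull_filt/card_borel_neq0.
Qed.

Lemma has_gvec_zero J : ~ has_gvec (zero_submod L) J.
Proof.
move=> /(submod_leP _ (filt (pval J).+1)).1 h.
by have /has_gvec_filt := h (@zero_submod_le _ _ _); rewrite ltnn.
Qed.

Lemma has_gvec_up S J J' : has_gvec S J -> (pval J <= pval J')%N ->
  (n %/ e <= ell)%N \/ (defect J' <= a * ell)%N -> has_gvec S J'.
Proof.
move=> SJ vJ good; apply: (gen_of_pval _ _ _ _ _ psiP e2 e_dvd e_min vJ good) => //.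
exact: lsub_pull.
Qed.

Lemma filt_anti c c' : (c <= c')%N -> submod_le (filt c') (filt c).
Proof.
move=> cc'; apply/submod_leP => J /has_gvec_filt c'J.
by apply/has_gvec_filt; apply: leq_trans c'J.
Qed.

Lemma filt_zero c : (maxval < c)%N -> filt c = zero_submod L.
Proof.
move=> c_big; apply: submod_le_anti; last exact: zero_submod_le.
by apply/submod_leP => J /has_gvec_filt; have := pvalE J; lia.
Qed.

(** An eigenvector of least value in W generates all those of larger value. *)
Lemma submod_eq_filt W : (n %/ e <= ell)%N -> exists c, W = filt c.
Proof.
move=> ne; have [[J WJ]|none] := pselect (exists J, has_gvec W J); last first.
  exists maxval.+1; apply: submod_le_anti; apply/submod_leP => J WJ.
    by case: none; exists J.
  by case: (@has_gvec_zero J); rewrite -(@filt_zero maxval.+1).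
have exP : exists c, `[< exists2 J, has_gvec W J & pval J = c >].
  by exists (pval J); apply/asboolP; exists J.
case: (ex_minnP exP) => c /asboolP[J0 WJ0 <-] c_min.
exists (pval J0); apply: submod_le_anti; apply/submod_leP => J1.
  by move=> WJ1; apply/has_gvec_filt/c_min/asboolP; exists J1.
by move=> /has_gvec_filt vJ1; apply: has_gvec_up WJ0 vJ1 _; left.
Qed.

Lemma small_weight : (n %/ e <= ell)%N ->
  uniserial (full_submod L) /\
  exists s : seq (submod L),
    [/\ repeats_deleted filt s, composition_series (full_submod L) (rev s) &
        forall t, composition_series (full_submod L) t -> t = rev s].
Proof.
(* From maxval.+1 on the filtration vanishes. *)
move=> ne; have [|W|uni series uniq_series] :=
  chain_composition_series (N := maxval.+1) filt_anti.
- by move=> c Nc; rewrite !filt_zero.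
- exact: submod_eq_filt.
split=> //; exists (undup (mkseq filt maxval.+2)); split=> //.
by exists maxval.+1; split=> // c Nc; rewrite !filt_zero.
Qed.

Section LargeWeight.
Hypothesis ne : (ell < n %/ e)%N.

(** The terms of the socle series: a * s, for s up to ell, are the ell + 1
    smallest defects. *)
Definition layer i : submod L :=
  if i is s.+1 then filt (maxval - a * s) else zero_submod L.

Lemma defect_exists s : (s <= ell)%N -> exists J, defect J = (a * s)%N.
Proof.
move=> s_ell; apply: qdefect_attained => //.
by apply: leq_trans (leq_trunc_div n e); rewrite leq_mul2r; lia.
Qed.

Lemma has_gvec_layer i J : (i <= ell.+1)%N ->
  has_gvec (layer i) J <-> exists2 t, (t < i)%N & defect J = (a * t)%N.
Proof.
case: i => [_|s s_ell]; first by split=> [/has_gvec_zero|[t]].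
have [K dK] := defect_exists (s_ell : (s <= ell)%N).
have vK := pvalE K; have vJ := pvalE J.
rewrite /layer has_gvec_filt; split=> [low|[t ts dJ]].
  have [|t t_ell dJ] := @qdefect_low q ell e q1 ell_prime e2 e_dvd e_min n J.
    by apply: (@leq_trans (a * s)%N); [lia | rewrite leq_mul2l; lia].
  exists t => //; rewrite ltnS -(leq_pmul2l a0) -dJ; lia.
have : (a * t <= a * s)%N by rewrite leq_mul2l; lia.
by lia.
Qed.

(** W contains an eigenvector outside the layer i.  Its defect is at least a * i
    because small defects are multiples of a, so it generates every eigenvector
    of defect at most a * i. *)
Lemma layer_least i W : (i <= ell)%N -> submod_le (layer i) W -> W <> layer i ->
  submod_le (layer i.+1) W.
Proof.
move=> i_ell iW nW; have [J WJ iJ] : exists2 J, has_gvec W J & ~ has_gvec (layer i) J.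
  apply: contrapT => none; apply: nW; apply: submod_le_anti => //.
  by apply/submod_leP => J WJ; apply: contrapT => iJ; apply: none; exists J.
have dJ : (a * i <= defect J)%N.
  rewrite leqNgt; apply/negP => dJ; apply: iJ; apply/has_gvec_layer; first lia.
  have [|t t_ell dJ'] := @qdefect_low q ell e q1 ell_prime e2 e_dvd e_min n J.
    by apply: leq_trans (ltnW dJ) _; rewrite leq_mul2l i_ell orbT.
  by exists t => //; rewrite -(ltn_pmul2l a0) -dJ'.
apply/submod_leP => J' /has_gvec_layer[|t ti dJ']; first lia.
have ta : (a * t <= a * i)%N by rewrite leq_mul2l; lia.
apply: has_gvec_up WJ _ _; first by have := pvalE J; have := pvalE J'; lia.
by right; rewrite dJ' leq_mul2l; lia.
Qed.

Lemma layer_covers i : (i <= ell)%N ->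
  covers (layer i) (layer i.+1) /\ preim_quot (socle (quotm (layer i))) = layer i.+1.
Proof.
move=> i_ell; apply: socle_quot => [|eq_layer|W].
- apply/submod_leP => J /has_gvec_layer[|t ti dJ]; first lia.
  by apply/has_gvec_layer; [lia | exists t => //; lia].
- have [J dJ] := defect_exists i_ell.
  have /has_gvec_layer : has_gvec (layer i) J.
    by rewrite eq_layer; apply/has_gvec_layer; [lia | exists i].
  case=> [|t ti]; first lia.
  by move=> /eqP; rewrite dJ eqn_pmul2l //; lia.
exact: layer_least.
Qed.

Lemma socle_series_layer i : (i <= ell.+1)%N -> socle_series L i = layer i.
Proof.
elim: i => [//|i IHi] i_ell; rewrite [LHS]/= IHi ?(ltnW i_ell) //.
by have [] := layer_covers (i_ell : (i <= ell)%N).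
Qed.

(** Eigenvectors of the last layer are linearly ordered by generation. *)
Lemma layer_uniserial : uniserial (layer ell.+1).
Proof.
move=> S T /submod_leP S_top /submod_leP T_top.
have [|nST] := pselect (submod_le S T); first by left.
right; apply/submod_leP => J' TJ'.
have good J : has_gvec (layer ell.+1) J -> (defect J <= a * ell)%N.
  by move=> /has_gvec_layer[//|t ti ->]; rewrite leq_mul2l; lia.
apply: contrapT => SJ'; apply: nST; apply/submod_leP => J SJ.
have [vJ|/ltnW vJ] := leqP (pval J) (pval J').
  by case: SJ'; apply: has_gvec_up SJ vJ _; right; apply/good/T_top.
by apply: has_gvec_up TJ' vJ _; right; apply/good/S_top.
Qed.

Lemma parabolic_layers (P : nat -> {group {'GL_n[F]}}) :
  (forall i, (i < num_parabolic_values n F ell)%N -> P i \in parabolics n F) ->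
  (forall i j, (i < j)%N -> (j < num_parabolic_values n F ell)%N ->
     (parabolic_value ell (P j) < parabolic_value ell (P i))%N) ->
  (ell < num_parabolic_values n F ell)%N /\
  forall i, (i <= ell)%N -> mod_filt_parabolic R ell (P i) = layer i.+1.
Proof.
move=> P_par P_dec.
have value_pval (Q : {group G}) : borel n F \subset Q ->
    parabolic_value ell Q = pval (parabolic_joins Q).
  by move=> BQ; congr (logn _ _); apply: parabolic_index.
have max_le s : (s <= ell)%N -> (a * s <= maxval)%N.
  by move=> /defect_exists[J dJ]; have := pvalE J; lia.
have [|||||ell_V P_val] := @decreasing_enumeration
  [seq parabolic_value ell Q | Q in parabolics n F] _ ell
  (fun i => parabolic_value ell (P i)) (fun s => maxval - a * s)%N (erefl _).
- by move=> i iV; apply/imageP; exists (P i) => //; apply: P_par.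
- exact: P_dec.
- move=> s s_ell; have [J dJ] := defect_exists s_ell.
  have [Q BQ indQ] := @parabolic_exists m F J.
  apply/imageP; exists Q; first by rewrite inE.
  have := pvalE J; rewrite -[pval J]/(logn ell (pindex m F J)) -indQ dJ => <-.
  by rewrite addnK.
- move=> s t st t_ell; have := max_le t t_ell.
  have : (a * s < a * t)%N by rewrite ltn_pmul2l.
  by lia.
- move=> v /imageP[Q]; rewrite inE => BQ -> low.
  have vQ := pvalE (parabolic_joins Q); rewrite -value_pval // in vQ.
  have [|s s_ell dQ] := @qdefect_low q ell e q1 ell_prime e2 e_dvd e_min n (parabolic_joins Q).
    by have := max_le ell (leqnn _); lia.
  by exists s => //; lia.
split=> // i i_ell; rewrite /mod_filt_parabolic P_val //.
Qed.

End LargeWeight.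
End SubmoduleLattice.

(** * Uniseriality and the socle series *)

Section LocalRing.
Variables (R : idomainType) (ell : nat).
Hypothesis max_ell : maximal_ideal (pideal (ell%:R : R)).

Lemma maximal_ideal_proper : ~ ell_divides ell (1 : R).
Proof.
case: max_ell => proper _ [s e1]; apply: proper.
apply: submod_le_anti; first exact: full_submod_ge.
by move=> x _; apply/asboolP; exists (s * x); rewrite mulrA -e1 mul1r.
Qed.

Lemma maximal_ideal_inverse (r : R) :
  ell_divides ell r \/ exists s t, r * s = 1 + ell%:R * t.
Proof.
case: max_ell => _ /(_ (add_submod (pideal ell%:R) (pideal r))).
have in_l x : pideal (ell%:R : R) x -> add_submod (pideal ell%:R) (pideal r) x.
  by move=> xl; apply/asboolP; exists x, 0; rewrite addr0 submod0.
case=> // sum_eq.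
  left; suff /asboolP : pideal (ell%:R : R) r by [].
  rewrite -sum_eq; apply/asboolP; exists 0, r; rewrite add0r submod0; split=> //.
  by apply/asboolP; exists 1; rewrite mulr1.
right; have : full_submod R^o (1 : R^o) by apply/asboolP.
rewrite -sum_eq => /asboolP[_ [_ [/asboolP[t ->] /asboolP[s ->] e1]]].
by exists s, (- t); apply/eqP; rewrite mulrN eq_sym subr_eq addrC; apply/eqP.
Qed.
End LocalRing.

Lemma coprime_card_finField (F : finFieldType) p ell :
  p \in [pchar F] -> prime ell -> ell != p -> coprime ell #|F|.
Proof.
move=> charF ell_prime neq; have p_prime := pcharf_prime charF.
have -> : #|F| = (p ^ logn p #|F|)%N := card_pprimeChar charF.
by apply: coprimeXr; rewrite prime_coprime // dvdn_prime2.
Qed.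

Theorem theorem6p1 (n p q ell e : nat) (F : finFieldType) (R : idomainType)
  (n_ge2 : (2 <= n)%N)
  (charF : p \in [pchar F]) (cardF : #|F| = q)
  (ell_prime : prime ell) (ell_neq_p : ell != p)
  (pidR : is_pid R) (charR : [pchar R] =i pred0)
  (localR : local_with_maximal_ideal (pideal (ell%:R : R)))
  (rootR : exists z : R, p.-primitive_root z)
  (e_ge2 : (2 <= e)%N) (e_dvd : (ell %| (q ^ e - 1) %/ (q - 1))%N)
  (e_min : forall i : nat, (2 <= i)%N ->
     (ell %| (q ^ i - 1) %/ (q - 1))%N -> (e <= i)%N) :
  let L := steinberg_mod n F R ell in
  let V := num_parabolic_values n F ell in
  ((n %/ e <= ell)%N ->
     uniserial (full_submod L) /\
     exists s : seq (submod L),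
       [/\ repeats_deleted (@mod_filt n F R ell) s,
           composition_series (full_submod L) (rev s) &
           forall t : seq (submod L),
             composition_series (full_submod L) t -> t = rev s])
  /\
  ((ell < n %/ e)%N ->
     forall P : nat -> {group {'GL_n[F]}},
     (forall i, (i < V)%N -> P i \in parabolics n F) ->
     (forall i j, (i < j)%N -> (j < V)%N ->
        (parabolic_value ell (P j) < parabolic_value ell (P i))%N) ->
     let LP (i : nat) := mod_filt_parabolic R ell (P i) in
     let series (i : nat) := if i is j.+1 then LP j else zero_submod L in
     [/\ (ell < V)%N,
         forall i, (i <= ell.+1)%N -> socle_series L i = series i,
         composition_series (LP ell) (mkseq series ell.+2),
         uniserial (LP ell) /\ has_length (LP ell) ell.+1 &
         forall i, (i < ell.+1)%N ->
           irreducible_factor (series i) (series i.+1)]).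
Proof.
case: n n_ge2 => [//|m] _.
have q1 : (1 < q)%N by rewrite -cardF; apply: card_finRing_gt1.
have {}e_dvd : (ell %| qint #|F| e)%N by rewrite cardF -qintE.
have {}e_min i : (1 < i)%N -> (ell %| qint #|F| i)%N -> (e <= i)%N.
  by rewrite cardF -qintE //; apply: e_min.
have max_ell := (localR _).2 (erefl (pideal (ell%:R : R))).
have ell_ndivides1 := maximal_ideal_proper max_ell.
have ell_divides_or_inv := maximal_ideal_inverse max_ell.
have charR0 := (pcharf0P R).1 charR.
have ell_q := coprime_card_finField charF ell_prime ell_neq_p.
have [z z_prim] := rootR; have [psi psiP] := nontriv_char_exists charF z_prim.
move=> L V; split=> [ne|ne P P_par P_dec LP series].
  exact: (small_weight ell_prime ell_q charR0 ell_ndivides1 ell_divides_or_inv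
    e_ge2 e_dvd e_min psiP ne).
have [ell_V LP_layer] := parabolic_layers R ell_prime ell_q e_ge2 e_dvd e_min ne P_par P_dec.
have seriesE i : (i <= ell.+1)%N -> series i = @layer m F R ell e i.
  by case: i => [//|i] i_ell; apply: LP_layer.
have covers_series i : (i < ell.+1)%N -> irreducible_factor (series i) (series i.+1).
  move=> i_ell; rewrite !seriesE ?(ltnW i_ell) //; apply/irreducible_factorP.
  by have [] := layer_covers ell_prime ell_q charR0 ell_ndivides1
    ell_divides_or_inv e_ge2 e_dvd e_min psiP ne i_ell.
have comp_series : composition_series (LP ell) (mkseq series ell.+2).
  split; rewrite ?size_mkseq //; first by rewrite -nth_last size_mkseq nth_mkseq.
  by move=> i i_ell; rewrite !nth_mkseq ?(ltnW i_ell) //; apply: covers_series.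
split=> //.
  move=> i i_ell; rewrite seriesE //.
  exact: (socle_series_layer ell_prime ell_q charR0 ell_ndivides1
    ell_divides_or_inv e_ge2 e_dvd e_min psiP ne i_ell).
split; last by exists (mkseq series ell.+2); rewrite ?size_mkseq.
rewrite /LP LP_layer //.
exact: (layer_uniserial ell_prime ell_q charR0 ell_ndivides1
  ell_divides_or_inv e_ge2 e_dvd e_min psiP ne).
Qed.
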